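(* Let $\phi=\tilde p/p$ be a bidegree $(m,n)$ rational inner function on $\mathbb{D}^2$ and let $\alpha\in\mathbb{T}$ be a generic value for $\phi$. Then the Clark embedding $J_\alpha:K_\phi\to L^2(\sigma_\alpha)$ is unitary.
   Context: $\mathbb{D}$ is the open unit disk and $\mathbb{T}$ the unit circle. A rational inner function (RIF) on $\mathbb{D}^2$ is a bounded holomorphic rational function on $\mathbb{D}^2$ whose non-tangential boundary values have modulus $1$ almost everywhere on $\mathbb{T}^2$. Here $\phi=\tilde p/p$ where $p\in\mathbb{C}[z_1,z_2]$ has no zeros in $\mathbb{D}^2$, has degree $m$ in $z_1$ and degree $n$ in $z_2$, $\tilde p(z)=z_1^m z_2^n\,\overline{p(1/\bar z_1,1/\bar z_2)}$, and $p,\tilde p$ have no common factor. Then $\phi$ has bidegree $(m,n)$. Standing assumption: $m>0$ and $n>0$. For $\alpha\in\mathbb{T}$, the Clark measure $\sigma_\alpha$ is the unique positive Borel measure on $\mathbb{T}^2$ with $\frac{1-|\phi(z)|^2}{|\alpha-\phi(z)|^2}=\int_{\mathbb{T}^2}P_{z}(\zeta)\,d\sigma_\alpha(\zeta)$ for $z\in\mathbb{D}^2$, where $P_z(\zeta)=\prod_{j=1}^2\frac{1-|z_j|^2}{|\zeta_j-z_j|^2}$. $\alpha\in\mathbb{T}$ is exceptional for $\phi$ if $\phi(\tau,z_2)\equiv\alpha$ or $\phi(z_1,\tau)\equiv\alpha$ for some $\tau\in\mathbb{T}$; otherwise $\alpha$ is generic. The model space is $K_\phi=H^2(\mathbb{D}^2)\ominus\phi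 H^2(\mathbb{D}^2)$, where $H^2(\mathbb{D}^2)$ is the Hardy space of the bidisk; its reproducing kernel is $K_w(z)=(1-\overline{\phi(w)}\phi(z))C_w(z)$, where $C_w(z)=\prod_{j=1}^2\frac{1}{1-z_j\bar w_j}$. The Clark embedding $J_\alpha:K_\phi\to L^2(\sigma_\alpha)$ is the linear isometry determined by $J_\alpha[K_w](\zeta)=(1-\alpha\overline{\phi(w)})C_w(\zeta)$ for $w\in\mathbb{D}^2$, $\zeta\in\mathbb{T}^2$; it preserves inner products of reproducing kernels and extends to all of $K_\phi$ by density of their span. Being unitary means being an isometry onto $L^2(\sigma_\alpha)$. *)

(* Defs.v *)
From HB Require Import structures.
From mathcomp Require Import all_boot all_order all_algebra.
From mathcomp Require Import polyXY.
From mathcomp Require Import all_classical all_reals all_analysis.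
From mathcomp Require Import complex.

Set Implicit Arguments.
Unset Strict Implicit.
Unset Printing Implicit Defensive.

Import Order.TTheory GRing.Theory Num.Theory.
Import numFieldNormedType.Exports.

Local Open Scope classical_set_scope.
Local Open Scope ring_scope.

(* MathComp-Analysis topologizes abstract numeric fields only; this transports
   the norm topology to the concrete carrier R[i]. *)
HB.instance Definition _ (R : realType) :=
  NormedModule.copy R[i] (R[i] : numClosedFieldType).

Section Points.
Variable R : realType.

Definition bidisk : set (R[i] * R[i]) := [set z | `|z.1| < 1 /\ `|z.2| < 1].

Definition torus_set : set (R[i] * R[i]) := [set z | `|z.1| = 1 /\ `|z.2| = 1].

(* The torus as a type, with the topology induced by R[i] * R[i]. *)
Definition torus := set_type torus_set.

HB.instance Definition _ := Topological.on torus.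

Lemma torus_set11 : (1, 1) \in torus_set.
Proof. by rewrite inE; split; rewrite /= normr1. Qed.

HB.instance Definition _ := isPointed.Build torus (exist _ (1, 1) torus_set11).

Definition borel_torus := g_sigma_algebraType (@open torus).

HB.instance Definition _ := Measurable.on borel_torus.

Definition pt (zeta : borel_torus) : R[i] * R[i] := @set_val _ torus_set zeta.

End Points.

Section RationalInner.
Variable R : realType.
Implicit Types (p : {poly {poly R[i]}}) (z : R[i] * R[i]).

(* A polynomial in (z1, z2) is an element of {poly {poly R[i]}} whose outer
   variable is z1: the coefficient of z1 ^ j * z2 ^ k is p`_j`_k. *)
Definition eval2 p z : R[i] := p.[z.1%:P].[z.2].

Definition bidegree m n p : Prop := size p = m.+1 /\ sizeY p = n.+1.

(* z1 ^ m * z2 ^ n * conj (p (1 / conj z1, 1 / conj z2)); see eval2_reflect. *)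
Definition reflect_poly (m n : nat) p : {poly {poly R[i]}} :=
  \poly_(j < m.+1) \poly_(k < n.+1) (p`_(m - j)`_(n - k))^*.

Definition no_common_factor p q : Prop :=
  forall d u v : {poly {poly R[i]}},
    p = d * u -> q = d * v -> d \is a GRing.unit.

Definition rif_denominator (m n : nat) p : Prop :=
  [/\ bidegree m n p,
      forall z, bidisk z -> eval2 p z != 0 &
      no_common_factor p (reflect_poly m n p)].

Definition rif (m n : nat) p : R[i] * R[i] -> R[i] :=
  fun z => eval2 (reflect_poly m n p) z / eval2 p z.

(* If p is as in rif_denominator and `|tau| = 1, then p(tau, .) and p(., tau)
   have no zero in the open disk (a zero there would force a common factor
   of p and its reflection), so no division by zero occurs here; an identity
   of one-variable rational functions can be tested on the disk. *)
Definition exceptional (phi : R[i] * R[i] -> R[i]) (alpha : R[i]) : Prop :=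
  exists2 tau : R[i], `|tau| = 1 &
    (forall z2 : R[i], `|z2| < 1 -> phi (tau, z2) = alpha) \/
    (forall z1 : R[i], `|z1| < 1 -> phi (z1, tau) = alpha).

Definition generic phi alpha : Prop := ~ exceptional phi alpha.

Lemma eval2E (m n : nat) p z : (size p <= m)%N -> (sizeY p <= n)%N ->
  eval2 p z = \sum_(j < m) \sum_(k < n) p`_j`_k * z.1 ^+ j * z.2 ^+ k.
Proof.
move=> sp sY; rewrite /eval2 (horner_coef_wide _ sp) horner_sum.
apply: eq_bigr => j _; have sj := leq_trans (max_size_coefXY p j) sY.
rewrite -polyC_exp hornerM hornerC (horner_coef_wide _ sj) mulr_suml.
by apply: eq_bigr => k _; rewrite mulrAC.
Qed.

Lemma eval2_reflect m n p z : bidegree m n p -> z.1 != 0 -> z.2 != 0 ->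
  eval2 (reflect_poly m n p) z =
  z.1 ^+ m * z.2 ^+ n * (eval2 p ((z.1^*)^-1, (z.2^*)^-1))^*.
Proof.
case=> sp sY z1 z2.
have sr : (size (reflect_poly m n p) <= m.+1)%N by exact: size_poly.
have srY : (sizeY (reflect_poly m n p) <= n.+1)%N.
  apply/bigmax_leqP => j _; rewrite /reflect_poly coef_poly.
  by case: ifP => _; rewrite ?size_poly0 ?size_poly.
rewrite (eval2E _ sr srY) (@eval2E m.+1 n.+1) ?sp ?sY//= rmorph_sum mulr_sumr.
rewrite [LHS](reindex_inj rev_ord_inj) /=.
apply: eq_bigr => j _; rewrite rmorph_sum mulr_sumr.
rewrite [LHS](reindex_inj rev_ord_inj) /=.
apply: eq_bigr => k _; have jm : (j <= m)%N by rewrite -ltnS.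
have kn : (k <= n)%N by rewrite -ltnS.
rewrite !subSS /reflect_poly coef_poly ltnS leq_subr coef_poly ltnS leq_subr.
rewrite !subKn// !rmorphM !rmorphXn /= !fmorphV /= !conjCK !exprVn.
rewrite !expfB_cond ?(negPf z1, negPf z2)//= ?add0n//.
have ACA (a b c d e : R[i]) : c * (a * b) * (d * e) = a * d * (c * b * e).
  by rewrite [c * _]mulrCA mulrACA.
exact: ACA.
Qed.

End RationalInner.

Section Clark.
Variable R : realType.
Local Notation normc := (@Normc.normc R).
Implicit Types (z w : R[i] * R[i]) (phi f g h : R[i] * R[i] -> R[i]).

Definition poisson_kernel z (zeta : borel_torus R) : R :=
  ((1 - normc z.1 ^+ 2) / normc ((pt zeta).1 - z.1) ^+ 2) *
  ((1 - normc z.2 ^+ 2) / normc ((pt zeta).2 - z.2) ^+ 2).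

Definition clark_measure phi (alpha : R[i])
    (sigma : {measure set (borel_torus R) -> \bar R}) : Prop :=
  forall z, bidisk z ->
    ((1 - normc (phi z) ^+ 2) / normc (alpha - phi z) ^+ 2)%:E =
    (\int[sigma]_zeta (poisson_kernel z zeta)%:E)%E.

(* f has the square-summable Taylor coefficients a on the bidisk. The double
   series converges absolutely there, so summing over squares is harmless. *)
Definition hardy_coef f (a : nat -> nat -> R[i]) : Prop :=
  (\esum_(jk in [set: nat * nat]) (normc (a jk.1 jk.2) ^+ 2)%:E < +oo)%E /\
  forall z, bidisk z ->
    \sum_(j < N) \sum_(k < N) a j k * z.1 ^+ j * z.2 ^+ k @[N --> \oo] --> f z.

(* H^2(D^2); an element is represented by any function on R[i] * R[i], of
   which only the restriction to the bidisk matters. *)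
Definition hardy : set (R[i] * R[i] -> R[i]) :=
  [set f | exists a, hardy_coef f a].

(* The coefficient family of an element of H^2 is unique. *)
Definition taylor f : nat -> nat -> R[i] :=
  xget (fun _ _ => 0) [set a | hardy_coef f a].

Definition hardy_dot f g : R[i] :=
  lim ((\sum_(j < N) \sum_(k < N) taylor f j k * (taylor g j k)^*)
       @[N --> \oo]).

Definition hardy_norm f : R := Num.sqrt (complex.Re (hardy_dot f f)).

Definition model_space phi : set (R[i] * R[i] -> R[i]) :=
  [set f | hardy f /\
    forall h, hardy h -> hardy_dot f (fun z => phi z * h z) = 0].

Definition cauchy_kernel w z : R[i] :=
  (1 - z.1 * w.1^*)^-1 * (1 - z.2 * w.2^*)^-1.

Definition model_kernel phi w z : R[i] :=
  (1 - (phi w)^* * phi z) * cauchy_kernel w z.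

Section L2.
Variable sigma : {measure set (borel_torus R) -> \bar R}.
Implicit Types u v : borel_torus R -> R[i].

Definition L2_norm u : \bar R :=
  Lnorm sigma 2%:E (fun x => (normc (u x))%:E).

Definition L2 : set (borel_torus R -> R[i]) :=
  [set u | [/\ measurable_fun setT (fun x => complex.Re (u x)),
               measurable_fun setT (fun x => complex.Im (u x)) &
               (L2_norm u < +oo)%E]].

Definition ae_equal u v : Prop := {ae sigma, forall x, u x = v x}.

(* J is a linear isometry from K, with the norm of H^2, to L^2(sigma); elements
   of L^2(sigma) are functions up to sigma-a.e. equality. *)
Definition linear_isometry (K : set (R[i] * R[i] -> R[i]))
    (J : (R[i] * R[i] -> R[i]) -> borel_torus R -> R[i]) : Prop :=
  [/\ forall f, K f -> L2 (J f),
      forall (c : R[i]) f g, K f -> K g ->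
        ae_equal (J (fun z => c * f z + g z))
                 (fun zeta => c * J f zeta + J g zeta) &
      forall f, K f -> L2_norm (J f) = (hardy_norm f)%:E].

Definition unitary (K : set (R[i] * R[i] -> R[i]))
    (J : (R[i] * R[i] -> R[i]) -> borel_torus R -> R[i]) : Prop :=
  linear_isometry K J /\
  forall v, L2 v -> exists2 f, K f & ae_equal (J f) v.

Definition clark_embedding phi (alpha : R[i])
    (J : (R[i] * R[i] -> R[i]) -> borel_torus R -> R[i]) : Prop :=
  linear_isometry (model_space phi) J /\
  forall w, bidisk w ->
    ae_equal (J (model_kernel phi w))
             (fun zeta => (1 - alpha * (phi w)^*) * cauchy_kernel w (pt zeta)).

End L2.

End Clark.

(* Main.v *)
(* The range of an isometry defined on a complete space is closed, so it is enough that the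
   Cauchy kernels C_w, which are multiples of the J K_w, span a dense subspace M of
   L^2(sigma).
   Let q = p~ - alpha p. Comparing 1 - |phi|^2 with |alpha - phi|^2 through Poisson
   integrals over grids of radius r -> 1 shows that q = 0 sigma-a.e. The functions zeta_1
   and zeta_2 multiply M into itself because zeta C_w is a combination of kernels. Write
   q(zeta) = q0(zeta_2) + zeta_1 q1(zeta), with q0 = q(0, .) zero-free in the disk; on
   {q = 0} one has q0(zeta_2) conj zeta_1 = - q1(zeta), which lies in M. Since alpha is
   generic, sigma does not charge the slices {zeta_2 = tau}, so the linear factors of q0,
   whose zeros lie outside the open disk, can be divided out by Cesaro means; hence
   conj zeta_1, and symmetrically conj zeta_2, multiply M into itself. Real multipliers are
   then stable under bounded pointwise limits, so the indicators of half-spaces, then of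
   all Borel sets, are multipliers, and M = L^2(sigma).
   On the Hardy side, phi and its products with H^2 functions are handled through Taylor
   coefficients, which grow at most polynomially for a rational function without poles in
   the bidisk; |phi| = 1 at the boundary is used through Jensen's formula, as the decay of
   the means of 1 - |phi|^2 over grids of radius r -> 1. *)

Require Import Defs.
From mathcomp Require Import all_boot all_order all_algebra.
From mathcomp Require Import polyXY cyclic separable cyclotomic.
From mathcomp Require Import all_classical all_reals all_analysis.
From mathcomp Require Import measurable_realfun complex.
From mathcomp Require Import ring lra zify.

Set Implicit Arguments.
Unset Strict Implicit.
Unset Printing Implicit Defensive.

Import Order.TTheory GRing.Theory Num.Theory.
Import numFieldNormedType.Exports.

Local Open Scope classical_set_scope.
Local Open Scope ring_scope.

(** * The modulus, roots of unity, zero-free polynomials *)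

(** The closed span of the kernels contains only analytic polynomials, and their closure in
    $L^2(\sigma)$ need not be stable under conjugation. The algebraic relation $q=0$ supplies the
    missing conjugates, and genericity permits the division at those zeros of $q_0$ that lie on the
    circle. Integrals over the torus are replaced by means over grids of $N$-th roots of unity at
    radius $r<1$. On monomials of degree below $N$ the orthogonality relations are exact, so a power
    series enters with an error that vanishes as $N$ grows. The same grids serve on the Clark side,
    since in each variable the Poisson kernels of a grid add up to a quantity comparable to $N$. One
    identity governs the measure: $|q|^2$ times the Poisson integral of $\sigma$ equals
    $|p|^2-|\tilde p|^2$, which is $O(1-r)$ at radius $r$. It gives both the vanishing of $q$ almost
    everywhere and the nullity of the slices. The bound $|\phi|\le 1$ is read off from the
    positivity of $\sigma$, and $\phi\ne\alpha$ in the bidisk from $\sigma\ne 0$; the case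
    $\sigma=0$ is separate. Estimates use the real-valued modulus because the order on [R[i]] is
    partial. *)

Notation nm := (@Normc.normc _).

Section Modulus.
Variable R : realType.
Implicit Types x y z : R[i].

Lemma normE x : `|x| = (nm x)%:C%C.
Proof. by []. Qed.

Lemma nm_ge0 x : 0 <= nm x.
Proof. by rewrite -lecR -normE normr_ge0. Qed.

Lemma nm0 : nm (0 : R[i]) = 0.
Proof. exact: Normc.normc0. Qed.

Lemma nm1 : nm (1 : R[i]) = 1.
Proof. exact: Normc.normc1. Qed.

Lemma nmM x y : nm (x * y) = nm x * nm y.
Proof. exact: Normc.normcM. Qed.

Lemma nmD x y : nm (x + y) <= nm x + nm y.
Proof. exact: le_normcD. Qed.

Lemma nmN x : nm (- x) = nm x.
Proof. exact: normcN. Qed.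

Lemma nmV x : nm x^-1 = (nm x)^-1.
Proof. exact: Normc.normcV. Qed.

Lemma nmX x n : nm (x ^+ n) = nm x ^+ n.
Proof. by elim: n => [|n IH]; rewrite ?nm1// !exprS nmM IH. Qed.

Lemma nm_eq0 x : (nm x == 0) = (x == 0).
Proof. by apply/eqP/eqP => [/Normc.eq0_normc//|->]; rewrite nm0. Qed.

Lemma nm_gt0 x : (0 < nm x) = (x != 0).
Proof. by rewrite lt0r nm_eq0 nm_ge0 andbT. Qed.

Lemma nmJ x : nm (x^*) = nm x.
Proof. by apply: (@complexI R); rewrite -!normE norm_conjC. Qed.

Lemma nm_real (a : R) : nm (a%:C%C) = `|a|.
Proof. by rewrite /Normc.normc /= expr0n /= addr0 sqrtr_sqr. Qed.

Lemma nm_nat n : nm (n%:R : R[i]) = n%:R.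
Proof. by rewrite -(rmorph_nat (real_complex R)) nm_real ger0_norm. Qed.

Lemma nm_distC x y : nm (x - y) = nm (y - x).
Proof. by rewrite -nmN opprB. Qed.

Lemma nmB x y : nm (x - y) <= nm x + nm y.
Proof. by rewrite -(nmN y) nmD. Qed.

Lemma nm_subr x y : nm x - nm y <= nm (x - y).
Proof. by rewrite lerBlDr -{1}(subrK y x) nmD. Qed.

Lemma nm_sum (I : Type) (s : seq I) (P : pred I) (F : I -> R[i]) :
  nm (\sum_(i <- s | P i) F i) <= \sum_(i <- s | P i) nm (F i).
Proof.
elim/big_ind2 : _ => //; first by rewrite nm0.
by move=> x1 x2 y1 y2 h1 h2; exact: le_trans (nmD _ _) (lerD h1 h2).
Qed.

Lemma nm_prod (I : Type) (s : seq I) (P : pred I) (F : I -> R[i]) :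
  nm (\prod_(i <- s | P i) F i) = \prod_(i <- s | P i) nm (F i).
Proof. by elim/big_ind2 : _ => //; [exact: nm1|move=> ? ? ? ? <- <-; exact: nmM]. Qed.

Lemma norm_lt1 x : (`|x| < 1) = (nm x < 1).
Proof. by rewrite normE -ltcR. Qed.

Lemma norm_eq1 x : (`|x| = 1) <-> (nm x = 1).
Proof. by rewrite normE; split=> [/(@complexI R)//|->]. Qed.

Lemma sqr_nmE x : nm x ^+ 2 = complex.Re x ^+ 2 + complex.Im x ^+ 2.
Proof. by case: x => a b /=; rewrite sqr_sqrtr// addr_ge0// sqr_ge0. Qed.

Lemma sqr_nm_conj x : (nm x ^+ 2)%:C%C = x * x^*.
Proof. by rewrite rmorphXn /= -normE -normCK. Qed.

Lemma nm_Re x : `|complex.Re x| <= nm x.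
Proof. by rewrite -(lecR `|_|) -normE normc_ge_Re. Qed.

Lemma nm_Im x : `|complex.Im x| <= nm x.
Proof.
case: x => a b /=; rewrite -(sqrtr_sqr b) ler_sqrt ?lerDr ?sqr_ge0//.
by rewrite addr_ge0// sqr_ge0.
Qed.

Lemma nm_ReIm x : nm x <= `|complex.Re x| + `|complex.Im x|.
Proof.
rewrite -ler_sqr ?nnegrE ?nm_ge0 ?addr_ge0// sqr_nmE.
rewrite sqrrD !real_normK ?num_real// [leRHS]addrAC lerDl.
by rewrite mulrn_wge0// mulr_ge0.
Qed.

Lemma sqr_nmD x y : nm (x + y) ^+ 2 <= 2 * nm x ^+ 2 + 2 * nm y ^+ 2.
Proof.
have h : nm (x + y) ^+ 2 <= (nm x + nm y) ^+ 2.
  by rewrite ler_sqr ?nnegrE ?nm_ge0 ?addr_ge0 ?nm_ge0// nmD.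
apply: le_trans h _; rewrite -subr_ge0.
have -> : 2 * nm x ^+ 2 + 2 * nm y ^+ 2 - (nm x + nm y) ^+ 2
  = (nm x - nm y) ^+ 2 by ring.
exact: sqr_ge0.
Qed.

Lemma conj_unit x : nm x = 1 -> x^* = x^-1.
Proof.
move=> h; have x0 : x != 0 by rewrite -nm_gt0 h ltr01.
by apply: (mulfI x0); rewrite mulfV// -sqr_nm_conj h expr1n.
Qed.

Lemma conj_real (a : R) : (a%:C%C : R[i])^* = a%:C%C.
Proof. exact: conjc_real. Qed.

End Modulus.

Section RootsOfUnity.
Variable R : realType.
Local Notation C := R[i].

(** In characteristic zero $X^N-1$ is separable, so its splitting gives $N$ distinct $N$-th roots of
    unity, enough to force a primitive one. *)
Lemma prim_root_exists N : (0 < N)%N -> exists z : C, N.-primitive_root z.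
Proof.
move=> N0; pose P : {poly C} := 'X^N - 1.
have [r defP] := closed_field_poly_normal P.
rewrite (monicP _) ?monicXnsubC// scale1r in defP.
have rN : all N.-unity_root r by apply/allP => w; rewrite -root_prod_XsubC -defP.
have sr : (N < (size r).+1)%N by rewrite -(size_prod_XsubC r id) -defP size_XnsubC.
have [|z] := hasP (has_prim_root N0 rN _ sr); last by exists z.
by rewrite -separable_prod_XsubC -defP separable_Xn_sub_1// pnatr_eq0 -lt0n.
Qed.

Section Mean.
Variables (N : nat) (z : C).
Hypothesis zP : N.-primitive_root z.

Let N_gt0 : (0 < N)%N. Proof. exact: prim_order_gt0 zP. Qed.

Lemma nm_root k : nm (z ^+ k) = 1.
Proof.
have h : nm z ^+ N = 1 by rewrite -nmX (prim_expr_order zP) nm1.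
rewrite nmX; have -> : nm z = 1; last by rewrite expr1n.
by apply/eqP; rewrite -(eqrXn2 N_gt0) ?nm_ge0// ?ler01// h expr1n.
Qed.

(** A geometric sum of ratio $z^{j-k}$. The bounds on [j] and [k] exclude aliasing: exponents
    congruent modulo $N$ could not be told apart. *)
Lemma sum_roots (j k : nat) : (j < N)%N -> (k < N)%N ->
  \sum_(i < N) (z ^+ i) ^+ j * ((z ^+ i) ^+ k)^* = (N * (j == k))%:R.
Proof.
move=> jN kN.
have uz (i : nat) : (z ^+ i)^* = (z ^+ i)^-1 by apply: conj_unit; exact: nm_root.
have z0 (i : nat) : z ^+ i != 0 by rewrite -nm_gt0 nm_root ltr01.
have E (i : nat) : (z ^+ i) ^+ j * ((z ^+ i) ^+ k)^* = (z ^+ j / z ^+ k) ^+ i.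
  by rewrite rmorphXn /= uz exprVn expr_div_n -!exprM [(i * j)%N]mulnC [(i * k)%N]mulnC.
under eq_bigr do rewrite E.
have [->|jk] := eqVneq j k.
  rewrite divff// (eq_bigr (fun=> 1)); last by move=> i _; rewrite expr1n.
  by rewrite sumr_const card_ord muln1.
rewrite muln0; set x := _ / _.
have x1 : x != 1.
  apply: contra_neq jk => /divr1_eq/eqP.
  by rewrite (eq_prim_root_expr zP) !modn_small// => /eqP.
apply: (mulfI (x := x - 1)); first by rewrite subr_eq0.
rewrite mulr0 -subrX1 expr_div_n -!exprM.
by rewrite ![(_ * N)%N]mulnC !exprM (prim_expr_order zP) !expr1n divr1 subrr.
Qed.

(** Evaluate $X^N-1=\prod(X-z^i)$ at $1/x$ and clear denominators. This is what turns Jensen's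
    formula into an exact product. *)
Lemma prod_roots (x : C) : \prod_(i < N) (1 - x * z ^+ i) = 1 - x ^+ N.
Proof.
have [->|x0] := eqVneq x 0.
  rewrite expr0n gtn_eqF// subr0 big1// => i _.
  by rewrite mul0r subr0.
have h : \prod_(i < N) ('X - (z ^+ i)%:P).[x^-1] = x^-1 ^+ N - 1.
  by rewrite -horner_prod -(big_mkord xpredT (fun i => 'X - (z ^+ i)%:P))
    (factor_Xn_sub_1 zP) hornerD hornerN hornerC hornerXn.
transitivity (x ^+ N * \prod_(i < N) (x^-1 - z ^+ i)).
  rewrite -[N in x ^+ N]card_ord -prodr_const -big_split /=.
  by apply: eq_bigr => i _; rewrite mulrBr mulfV.
under eq_bigr do rewrite -hornerXsubC.
by rewrite h mulrBr mulr1 -exprMn mulfV// expr1n.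
Qed.

(** Since $(xz^i)^N=x^N$, each resolvent is a finite geometric sum divided by $1-x^N$, and only its
    constant term survives the summation over the roots. *)
Lemma sum_resolvent (x : C) : nm x < 1 ->
  \sum_(i < N) (1 - x * z ^+ i)^-1 = N%:R / (1 - x ^+ N).
Proof.
move=> x1.
have nz (y : C) : nm y < 1 -> 1 - y != 0.
  move=> y1; apply/eqP => /subr0_eq/(congr1 nm); rewrite nm1 => h.
  by rewrite -h ltxx in y1.
have xi (i : nat) : nm (x * z ^+ i) < 1 by rewrite nmM nm_root mulr1.
have xN : nm (x ^+ N) < 1 by rewrite nmX exprn_ilt1 ?nm_ge0// -lt0n.
apply: (mulIf (nz _ xN)); rewrite divfK ?nz// mulr_suml.
have E (i : 'I_N) : (1 - x * z ^+ i)^-1 * (1 - x ^+ N)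
    = \sum_(k < N) x ^+ k * ((z ^+ i) ^+ k * ((z ^+ i) ^+ 0)^*).
  have -> : 1 - x ^+ N = (1 - x * z ^+ i) * \sum_(k < N) (x * z ^+ i) ^+ k.
    have := subrX1 (x * z ^+ i) N.
    rewrite exprMn -exprM mulnC exprM (prim_expr_order zP) expr1n mulr1.
    by move/(congr1 -%R); rewrite opprB -mulNr opprB.
  rewrite mulKf ?nz//; apply: eq_bigr => k _.
  by rewrite expr0 rmorph1 mulr1 exprMn.
under eq_bigr do rewrite E.
rewrite exchange_big /=.
under eq_bigr do rewrite -mulr_sumr sum_roots//.
rewrite (bigD1 (Ordinal N_gt0))//= big1 ?addr0 ?expr0 ?mul1r ?muln1// => k.
by rewrite -val_eqE /= => /negPf ->; rewrite muln0 mulr0.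
Qed.

End Mean.
End RootsOfUnity.

Section ZeroFree.
Variable R : realType.
Local Notation C := R[i].

(** Each [b] is the inverse of a root. In this normal form the absence of zeros in the disk reads
    $|b|\le 1$, and every later bound is a bound on one factor $1-bX$. *)
Lemma zero_free_factor (P : {poly C}) :
  (forall z, nm z < 1 -> P.[z] != 0) ->
  exists s : seq C, [/\ (size s <= (size P).-1)%N, {in s, forall b, nm b <= 1} &
    P = P.[0] *: \prod_(b <- s) (1 - b *: 'X)].
Proof.
move=> h; have [r defP] := closed_field_poly_normal P.
have P0 : P != 0 by apply/eqP => P0; have := h 0; rewrite nm0 P0 horner0 eqxx => /(_ ltr01).
have rP (b : C) : b \in r -> 1 <= nm b.
  move=> br; rewrite leNgt; apply/negP => /h/negP; apply.
  rewrite defP hornerZ mulf_eq0 horner_prod; apply/orP; right.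
  by rewrite prodf_seq_eq0; apply/hasP; exists b => //=; rewrite !hornerE subrr.
exists [seq b^-1 | b <- r]; split.
- rewrite size_map defP size_scale ?lead_coef_eq0//.
  by rewrite size_prod_XsubC.
- move=> _ /mapP[b /rP br ->]; rewrite nmV invf_le1//.
  exact: lt_le_trans br.
rewrite big_map {1 2}defP hornerZ -scalerA; congr (_ *: _).
rewrite horner_prod -scaler_prod.
rewrite big_seq [RHS]big_seq; apply: eq_bigr => b /rP br; rewrite !hornerE.
have b0 : b != 0 by rewrite -nm_gt0 (lt_le_trans ltr01).
by rewrite scalerBr scalerA mulNr mulfV// scaleN1r opprK addrC alg_polyC polyCN.
Qed.

(** Each factor $1-bx$ has modulus at most $2$ on the closed disk. *)
Lemma harnack_le (P : {poly C}) n x : (forall z, nm z < 1 -> P.[z] != 0) ->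
  ((size P).-1 <= n)%N -> nm x <= 1 -> nm P.[x] <= nm P.[0] * 2 ^+ n.
Proof.
move=> /zero_free_factor[s [ss hs defP]] sn x1.
rewrite {1}defP hornerZ horner_prod nmM nm_prod ler_wpM2l ?nm_ge0//.
apply: (@le_trans _ _ (2 ^+ size s)); last first.
  by rewrite ler_weXn2l ?ler1n// (leq_trans ss).
elim: s hs {ss defP} => [|b s IH] hs; first by rewrite big_nil expr0.
rewrite big_cons exprS ler_pM ?nm_ge0// ?prodr_ge0//; last 2 first.
- have /hs b1 : b \in b :: s by rewrite inE eqxx.
  rewrite !hornerE (le_trans (nmB _ _))// nm1 nmM.
  by rewrite (_ : 2 = 1 + 1 * 1 :> R)// ?mulr1// lerD2l mulr_ile1 ?nm_ge0.
- by apply: IH => y ys; apply: hs; rewrite inE ys orbT.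
by move=> ? _; exact: nm_ge0.
Qed.

End ZeroFree.

(** * Power series on the bidisk *)

Section RealSequences.
Variable R : realType.

Lemma nd_bounded_cauchy (u : nat -> R) (B : R) :
  nondecreasing_seq u -> (forall n, u n <= B) ->
  forall e, 0 < e -> exists n0, forall n m, (n0 <= n)%N -> u m - u n <= e.
Proof.
move=> ndu uB e e0.
have cu : cvgn u by apply: nondecreasing_is_cvgn => //; exists B => _ [n _ <-].
have /cvgrPdist_le/(_ _ e0)[n0 _ hn] := cu.
exists n0 => n m n0n; have := hn n n0n.
rewrite ger0_norm ?subr_ge0; last exact: nondecreasing_cvgn_le.
by apply: le_trans; rewrite lerB// nondecreasing_cvgn_le.
Qed.

(** Majorant in one variable for coefficients of growth $(j+1)^d$ at radius $r$. As the growth bound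
    is a product in the two indices, its square majorizes the double series. *)
Definition geom_sum (d : nat) (r : R) (n : nat) : R :=
  \sum_(j < n) j.+1%:R ^+ d * r ^+ j.

Lemma geom_sum_nd d r : 0 <= r -> nondecreasing_seq (geom_sum d r).
Proof.
move=> r0; apply/nondecreasing_seqP => n; rewrite /geom_sum big_ord_recr /= lerDl.
by rewrite mulr_ge0 ?exprn_ge0.
Qed.

Lemma geom_sum_ge0 d r n : 0 <= r -> 0 <= geom_sum d r n.
Proof. by move=> r0; apply: sumr_ge0 => j _; rewrite mulr_ge0 ?exprn_ge0. Qed.

Lemma succ_expr_le (d j : nat) :
  j.+1%:R ^+ d.+1 - j%:R ^+ d.+1 <= d.+1%:R * j.+1%:R ^+ d :> R.
Proof.
rewrite subrXX -natrB ?leqnSn// subSnn mul1r.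
have -> : d.+1%:R * j.+1%:R ^+ d = \sum_(i < d.+1) j.+1%:R ^+ d :> R.
  by rewrite sumr_const card_ord mulr_natl.
apply: ler_sum => i _ /=; have id : (i <= d)%N by rewrite -ltnS.
have <- : j.+1%:R ^+ (d - i) * j.+1%:R ^+ i = j.+1%:R ^+ d :> R by rewrite -exprD subnK.
by rewrite ler_wpM2l ?exprn_ge0// lerXn2r ?nnegrE// ler_nat.
Qed.

(* Abel summation: [(1 - r) * sum (j+1)^d r^j <= d * sum (j+1)^(d-1) r^j] *)
Lemma geom_sum_bounded d r : 0 <= r < 1 -> exists B, forall n, geom_sum d r n <= B.
Proof.
case/andP=> r0 r1; have r10 : 0 < 1 - r by rewrite subr_gt0.
elim: d => [|d [B hB]].
  exists (1 - r)^-1 => n; rewrite /geom_sum.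
  under eq_bigr do rewrite expr0 mul1r.
  rewrite -(ler_pM2l r10) mulfV ?gt_eqF// -[leLHS]opprK -mulNr opprB -subrX1.
  by rewrite opprB gerBl exprn_ge0.
exists (d.+1%:R * B / (1 - r)) => n; rewrite ler_pdivlMr// mulrC.
apply: (@le_trans _ _ (d.+1%:R * geom_sum d r n)); last by rewrite ler_wpM2l.
have -> : (1 - r) * geom_sum d.+1 r n =
    \sum_(j < n) (j.+1%:R ^+ d.+1 - j%:R ^+ d.+1) * r ^+ j - n%:R ^+ d.+1 * r ^+ n.
  elim: n => [|n IH]; first by rewrite /geom_sum !big_ord0 expr0n mul0r mulr0 subr0.
  rewrite /geom_sum !big_ord_recr /= mulrDr -/(geom_sum _ _ _) IH [r ^+ n.+1]exprS.
  ring.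
rewrite lerBlDr ler_wpDr ?mulr_ge0 ?exprn_ge0// /geom_sum mulr_sumr.
by apply: ler_sum => j _; rewrite mulrA ler_wpM2r ?exprn_ge0// succ_expr_le.
Qed.

End RealSequences.

Section DoubleSeries.
Variable R : realType.
Local Notation C := R[i].
Implicit Types (x y : nat -> nat -> C) (F G : C * C -> C) (z : C * C).

Definition cvgC (u : nat -> C) (l : C) : Prop :=
  forall e : R, 0 < e -> exists n0, forall n, (n0 <= n)%N -> nm (u n - l) <= e.

Lemma cvgCP (u : nat -> C) (l : C) : cvgC u l <-> u @ \oo --> l.
Proof.
split=> [h|h e e0].
  apply/cvgrPdist_le => e e0.
  have eR : (complex.Re e)%:C%C = e by apply: RRe_real; exact: gtr0_real.
  have [|n0 hn] := h (complex.Re e); first by rewrite -ltcR eR.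
  by exists n0 => // n /= /hn; rewrite -lecR eR nm_distC -normE.
have /cvgrPdist_le/(_ (e%:C%C))[|n0 _ hn] := h; first by rewrite ltcR.
by exists n0 => n /hn; rewrite normE lecR nm_distC.
Qed.

Definition psum x N z : C := \sum_(j < N) \sum_(k < N) x j k * z.1 ^+ j * z.2 ^+ k.

(** A class wide enough for square-summable arrays and for the Taylor coefficients of rational
    functions without poles in the bidisk, stable under Cauchy products, and still forcing absolute
    convergence in the open bidisk. *)
Definition poly_growth x := exists B d,
  forall j k, nm (x j k) <= B * (j.+1%:R * k.+1%:R) ^+ d.

End DoubleSeries.

Section Truncation.
Variable R : realType.
Local Notation C := R[i].
Implicit Types (x y : nat -> nat -> C) (F G : C * C -> C) (z : C * C).
Implicit Types Q : {poly {poly C}}.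

Definition trunc x n : {poly {poly C}} := \poly_(j < n) \poly_(k < n) x j k.

Lemma coef_trunc x n j k :
  (trunc x n)`_j`_k = if (j < n)%N && (k < n)%N then x j k else 0.
Proof.
rewrite coef_poly; case: ifP => _; last by rewrite coef0.
by rewrite coef_poly.
Qed.

Lemma sizeY_trunc x n : (sizeY (trunc x n) <= n)%N.
Proof.
apply/bigmax_leqP => j _; rewrite coef_poly.
by case: ifP => _; rewrite ?size_poly0 ?size_poly.
Qed.

Lemma eval2_trunc x n z : eval2 (trunc x n) z = psum x n z.
Proof.
rewrite (eval2E _ (size_poly _ _) (sizeY_trunc x n)).
by apply: eq_bigr => j _; apply: eq_bigr => k _; rewrite coef_trunc !ltn_ord.
Qed.

Lemma eval2B Q1 Q2 z : eval2 (Q1 - Q2) z = eval2 Q1 z - eval2 Q2 z.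
Proof. by rewrite /eval2 hornerD hornerN hornerD hornerN. Qed.

Lemma eval2M Q1 Q2 z : eval2 (Q1 * Q2) z = eval2 Q1 z * eval2 Q2 z.
Proof. by rewrite /eval2 !hornerM. Qed.

Lemma eval2_sum I (s : seq I) (P : pred I) (Q : I -> {poly {poly C}}) z :
  eval2 (\sum_(i <- s | P i) Q i) z = \sum_(i <- s | P i) eval2 (Q i) z.
Proof. by rewrite /eval2 !horner_sum. Qed.

Lemma eval2_widen Q : exists N, forall M z, (N <= M)%N ->
  eval2 Q z = \sum_(j < M) \sum_(k < M) Q`_j`_k * z.1 ^+ j * z.2 ^+ k.
Proof.
exists (maxn (size Q) (sizeY Q)) => M z; rewrite geq_max => /andP[h1 h2].
exact: eval2E.
Qed.

(** The sum of $a_ja_k$ over a square is the square of a one-variable sum, so the part outside the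
    $n$-square is a difference of two squares. *)
Lemma tail_le Q n B d r z : 0 <= r -> nm z.1 <= r -> nm z.2 <= r ->
  (forall j k, nm Q`_j`_k <= B * (j.+1%:R * k.+1%:R) ^+ d) ->
  (forall j k, (j < n)%N -> (k < n)%N -> Q`_j`_k = 0) ->
  exists N, (n <= N)%N /\
  nm (eval2 Q z) <= B * (geom_sum d r N ^+ 2 - geom_sum d r n ^+ 2).
Proof.
move=> r0 z1 z2 hB hn.
have [N0 hN0] := eval2_widen Q.
set N := maxn N0 n; exists N; split; first by rewrite leq_maxr.
rewrite (hN0 N) ?leq_maxl//.
pose a (j : nat) : R := j.+1%:R ^+ d * r ^+ j.
have a0 j : 0 <= a j by rewrite mulr_ge0 ?exprn_ge0.
have B0 : 0 <= B by have := hB 0%N 0%N; rewrite mulr1 expr1n mulr1; apply: le_trans (nm_ge0 _).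
have Ea (M : nat) : geom_sum d r M ^+ 2 = \sum_(j < M) \sum_(k < M) a j * a k.
  by rewrite expr2 /geom_sum mulr_suml; apply: eq_bigr => j _; rewrite mulr_sumr.
pose b (j : nat) := if (j < n)%N then a j else 0.
have Eb : geom_sum d r n ^+ 2 = \sum_(j < N) \sum_(k < N) b j * b k.
  have -> : geom_sum d r n = \sum_(j < N) b j.
    by rewrite /geom_sum (big_ord_widen N a) ?leq_maxr// big_mkcond.
  by rewrite expr2 mulr_suml; apply: eq_bigr => j _; rewrite mulr_sumr.
rewrite Ea Eb -sumrB mulr_sumr; apply: le_trans (nm_sum _ _ _) _.
apply: ler_sum => j _; rewrite -sumrB mulr_sumr; apply: le_trans (nm_sum _ _ _) _.
apply: ler_sum => k _; rewrite /b.
have le1 : nm (Q`_j`_k * z.1 ^+ j * z.2 ^+ k) <= B * (a j * a k).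
  rewrite !nmM !nmX /a.
  have -> : B * (j.+1%:R ^+ d * r ^+ j * (k.+1%:R ^+ d * r ^+ k)) =
    B * (j.+1%:R * k.+1%:R) ^+ d * r ^+ j * r ^+ k by rewrite exprMn; ring.
  by rewrite !ler_pM ?mulr_ge0 ?exprn_ge0 ?nm_ge0// ?lerXn2r ?nnegrE ?nm_ge0.
case: ifP => jn; case: ifP => kn; rewrite ?mul0r ?mulr0 ?subr0 ?subrr//.
by rewrite hn// !mul0r nm0 mulr0.
Qed.

(* Stated for polynomials so as to cover truncations, products and Taylor remainders at
   once. *)
Lemma tail_small B d r e : 0 <= r < 1 -> 0 < e ->
  exists n0, forall n Q z, (n0 <= n)%N -> nm z.1 <= r -> nm z.2 <= r ->
  (forall j k, nm Q`_j`_k <= B * (j.+1%:R * k.+1%:R) ^+ d) ->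
  (forall j k, (j < n)%N -> (k < n)%N -> Q`_j`_k = 0) ->
  nm (eval2 Q z) <= e.
Proof.
move=> /[dup] r01 /andP[r0 r1] e0.
have [S hS] := geom_sum_bounded d r01.
have S0 : 0 <= S by rewrite (le_trans _ (hS 0%N))// geom_sum_ge0.
have B10 : 0 < 1 + `|B| by rewrite ltr_pwDl.
have [] := nd_bounded_cauchy (geom_sum_nd d r0) hS
  (e := e / (1 + `|B|) / (1 + 2 * S)).
  by rewrite !divr_gt0// ltr_pwDl// mulr_ge0.
move=> n0 hn0; exists n0 => n Q z n0n z1 z2 hB hn.
have [N [nN]] := tail_le r0 z1 z2 hB hn.
move/le_trans; apply.
have B0 : 0 <= B by have := hB 0%N 0%N; rewrite mulr1 expr1n mulr1; apply: le_trans (nm_ge0 _).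
have h := hn0 n N n0n.
rewrite subr_sqr.
have dA : 0 <= geom_sum d r N - geom_sum d r n by rewrite subr_ge0 geom_sum_nd.
have sA : 0 <= geom_sum d r N + geom_sum d r n by rewrite addr_ge0// geom_sum_ge0.
have sS : geom_sum d r N + geom_sum d r n <= 1 + 2 * S.
  have := hS N; have := hS n; lra.
have S2 : 0 < 1 + 2 * S by rewrite ltr_pwDl// mulr_ge0.
apply: (@le_trans _ _ ((1 + `|B|) * (e / (1 + `|B|) / (1 + 2 * S) * (1 + 2 * S)))).
  apply: ler_pM => //; first by rewrite mulr_ge0.
    by rewrite ger0_norm// lerDr.
  by rewrite ler_pM.
by rewrite divfK ?gt_eqF// mulrC divfK ?gt_eqF.
Qed.

Definition power_series x F : Prop := poly_growth x /\
  forall z, nm z.1 < 1 -> nm z.2 < 1 -> cvgC (fun n => psum x n z) (F z).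

Lemma poly_growth_ge0 x : poly_growth x -> exists B d, 0 <= B /\
  forall j k, nm (x j k) <= B * (j.+1%:R * k.+1%:R) ^+ d.
Proof.
move=> [B [d h]]; exists B, d; split=> //.
by have := h 0%N 0%N; rewrite mulr1 expr1n mulr1; apply: le_trans (nm_ge0 _).
Qed.

Lemma nm_if (b : bool) (c : C) (M : R) : nm c <= M -> nm (if b then c else 0) <= M.
Proof. by case: b => // h; rewrite nm0 (le_trans _ h)// nm_ge0. Qed.

(** The index [M] at which a partial sum is close to [F z] depends on [z], but the difference of two
    partial sums is a polynomial to which [tail_small] applies uniformly in [z]. Its coefficients
    are bounded with the constant [B + B]. *)
Lemma power_series_unif x F r e : power_series x F -> 0 <= r < 1 -> 0 < e ->
  exists n0, forall n z, (n0 <= n)%N -> nm z.1 <= r -> nm z.2 <= r ->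
  nm (F z - psum x n z) <= e.
Proof.
move=> [/poly_growth_ge0[B [d [B0 hB]]] hF] /[dup] r01 /andP[r0 r1] e0.
have e20 : 0 < e / 2 by rewrite divr_gt0.
have [n0 hn0] := tail_small (B + B) d r01 e20; exists n0 => n z n0n z1 z2.
have [M hM] := hF z (le_lt_trans z1 r1) (le_lt_trans z2 r1) _ e20.
set m := maxn M n.
have := hM m (leq_maxl _ _); rewrite nm_distC => h1.
have h2 : nm (psum x m z - psum x n z) <= e / 2.
  rewrite -!eval2_trunc -eval2B; apply: (hn0 n) => // [j k|j k jn kn].
    rewrite !coefB !coef_trunc (le_trans (nmB _ _))// mulrDl lerD// nm_if//.
  by rewrite !coefB !coef_trunc jn kn !(leq_trans _ (leq_maxr _ _))// subrr.
have -> : F z - psum x n z = (F z - psum x m z) + (psum x m z - psum x n z) by ring.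
by apply: le_trans (nmD _ _) _; rewrite [e]splitr lerD.
Qed.

Definition conv x y : nat -> nat -> C := fun j k =>
  \sum_(i < j.+1) \sum_(l < k.+1) x i l * y (j - i)%N (k - l)%N.

Lemma coefMM Q1 Q2 j k : (Q1 * Q2)`_j`_k =
  conv (fun j k => Q1`_j`_k) (fun j k => Q2`_j`_k) j k.
Proof.
rewrite coefM coef_sum; apply: eq_bigr => i _.
by rewrite coefM.
Qed.

(** The additional power pays for the $(j+1)(k+1)$ summands. *)
Lemma conv_bound x y B1 B2 d1 d2 : 0 <= B1 -> 0 <= B2 ->
  (forall j k, nm (x j k) <= B1 * (j.+1%:R * k.+1%:R) ^+ d1) ->
  (forall j k, nm (y j k) <= B2 * (j.+1%:R * k.+1%:R) ^+ d2) ->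
  forall j k, nm (conv x y j k) <= (B1 * B2) * (j.+1%:R * k.+1%:R) ^+ (d1 + d2).+1.
Proof.
move=> B10 B20 h1 h2 j k; apply: le_trans (nm_sum _ _ _) _.
have -> : (B1 * B2) * (j.+1%:R * k.+1%:R) ^+ (d1 + d2).+1 =
  \sum_(i < j.+1) \sum_(l < k.+1) (B1 * (j.+1%:R * k.+1%:R) ^+ d1) *
     (B2 * (j.+1%:R * k.+1%:R) ^+ d2).
  rewrite !sumr_const !card_ord -mulrnA -[RHS]mulr_natl natrM exprS exprD; ring.
apply: ler_sum => i _; apply: le_trans (nm_sum _ _ _) _; apply: ler_sum => l _.
rewrite nmM ler_pM ?nm_ge0//.
- apply: le_trans (h1 _ _) _; rewrite ler_wpM2l// lerXn2r ?nnegrE ?mulr_ge0//.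
  by rewrite ler_pM// ler_nat.
- apply: le_trans (h2 _ _) _; rewrite ler_wpM2l// lerXn2r ?nnegrE ?mulr_ge0//.
  by rewrite ler_pM// ler_nat ltnS leq_subr.
Qed.

Lemma poly_growth_conv x y : poly_growth x -> poly_growth y -> poly_growth (conv x y).
Proof.
move=> /poly_growth_ge0[B1 [d1 [B10 h1]]] /poly_growth_ge0[B2 [d2 [B20 h2]]].
by exists (B1 * B2), (d1 + d2).+1; exact: conv_bound.
Qed.

Lemma cvgC_squeeze (u v : nat -> C) l : cvgC v l ->
  (forall e, 0 < e -> exists n0, forall n, (n0 <= n)%N -> nm (u n - v n) <= e) -> cvgC u l.
Proof.
move=> hv huv e e0; have e20 : 0 < e / 2 by rewrite divr_gt0.
have [n1 h1] := hv _ e20; have [n2 h2] := huv _ e20.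
exists (maxn n1 n2) => n; rewrite geq_max => /andP[/h1 {}h1 /h2 {}h2].
rewrite -(subrK (v n) (u n)) -addrA (le_trans (nmD _ _))// [e]splitr lerD//.
Qed.

Lemma cvgCM (u v : nat -> C) a b : cvgC u a -> cvgC v b ->
  cvgC (fun n => u n * v n) (a * b).
Proof.
move=> hu hv e e0.
have a1 : 0 < nm a + 1 by rewrite ltr_wpDl// nm_ge0.
have b1 : 0 < nm b + 1 by rewrite ltr_wpDl// nm_ge0.
have [|n1 h1] := hu (Num.min 1 (e / 2 / (nm b + 1))); first by rewrite lt_min ltr01 !divr_gt0.
have [|n2 h2] := hv (e / 2 / (nm a + 1)); first by rewrite !divr_gt0.
exists (maxn n1 n2) => n; rewrite geq_max => /andP[/h1 {}h1 /h2 {}h2].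
have -> : u n * v n - a * b = u n * (v n - b) + (u n - a) * b by ring.
move: h1; rewrite le_min => /andP[h1 h1'].
have un : nm (u n) <= nm a + 1.
  by rewrite -[u n](subrK a) addrC (le_trans (nmD _ _))// lerD2l.
apply: le_trans (nmD _ _) _; rewrite [e]splitr !nmM lerD//.
  by rewrite (le_trans (ler_pM _ _ un h2)) ?nm_ge0// mulrC divfK ?gt_eqF.
rewrite (@le_trans _ _ (e / 2 / (nm b + 1) * (nm b + 1)))//.
  by rewrite ler_pM ?nm_ge0// lerDl.
by rewrite divfK ?gt_eqF.
Qed.

(** The product of the $n$-truncations and the $n$-truncation of the product have the same
    coefficients in the $n$-square, so their difference is a tail in the sense of [tail_small]. *)
Lemma power_series_mul x y F G : power_series x F -> power_series y G ->
  power_series (conv x y) (fun z => F z * G z).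
Proof.
move=> [gx hx] [gy hy]; split; first exact: poly_growth_conv.
move=> z z1 z2; apply: cvgC_squeeze (cvgCM (hx z z1 z2) (hy z z1 z2)) _ => e e0.
have /poly_growth_ge0[B1 [d1 [B10 h1]]] := gx.
have /poly_growth_ge0[B2 [d2 [B20 h2]]] := gy.
pose r := Num.max (nm z.1) (nm z.2).
have r01 : 0 <= r < 1 by rewrite le_max nm_ge0 /= gt_max z1 z2.
have [n0 hn0] := tail_small (B1 * B2 + B1 * B2) (d1 + d2).+1 r01 e0.
exists n0 => n n0n; rewrite -!eval2_trunc -eval2M -eval2B.
have rz1 : nm z.1 <= r by rewrite le_max lexx.
have rz2 : nm z.2 <= r by rewrite le_max lexx orbT.
apply: (hn0 n) => // [j k|j k jn kn].
  rewrite !coefB coef_trunc coefMM (le_trans (nmB _ _))// mulrDl lerD ?nm_if//.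
    exact: conv_bound.
  by apply: conv_bound => // {}j {}k; rewrite coef_trunc nm_if.
rewrite !coefB coef_trunc coefMM jn kn /=; apply/eqP; rewrite subr_eq0; apply/eqP.
apply: eq_bigr => i _; apply: eq_bigr => l _; rewrite !coef_trunc.
have il (a b : nat) (i0 : 'I_a.+1) : (a < b)%N -> (i0 < b)%N && (a - i0 < b)%N.
  move=> ab; have h : (i0 <= a)%N by rewrite -ltnS.
  by rewrite (leq_ltn_trans h ab) (leq_ltn_trans (leq_subr _ _) ab).
by have /andP[-> ->] := il _ _ i jn; have /andP[-> ->] := il _ _ l kn.
Qed.

End Truncation.

(** * Discrete means over grids on the torus of radius [r] *)

Section TorusMeans.
Variable R : realType.
Local Notation C := R[i].
Implicit Types (x y : nat -> nat -> C) (F G : C * C -> C).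

Definition mean (V : numFieldType) N (f : 'I_N * 'I_N -> V) : V :=
  (\sum_q f q) / (N * N)%:R.

Lemma eq_mean (V : numFieldType) N (f g : 'I_N * 'I_N -> V) : f =1 g -> mean f = mean g.
Proof. by move=> fg; rewrite /mean (eq_bigr _ (fun q _ => fg q)). Qed.

Lemma meanD (V : numFieldType) N (f g : 'I_N * 'I_N -> V) :
  mean (fun q => f q + g q) = mean f + mean g.
Proof. by rewrite /mean big_split mulrDl. Qed.

Lemma meanB (V : numFieldType) N (f g : 'I_N * 'I_N -> V) :
  mean (fun q => f q - g q) = mean f - mean g.
Proof. by rewrite /mean sumrB mulrBl. Qed.

Lemma meanZ (V : numFieldType) N c (f : 'I_N * 'I_N -> V) :
  mean (fun q => c * f q) = c * mean f.
Proof. by rewrite /mean -mulr_sumr mulrA. Qed.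

Lemma mean_cst (V : numFieldType) N c : (0 < N)%N ->
  mean (fun _ : 'I_N * 'I_N => c : V) = c.
Proof.
move=> N0; rewrite /mean sumr_const card_prod card_ord -[c *+ _]mulr_natr mulfK//.
by rewrite pnatr_eq0 muln_eq0 orbb -lt0n.
Qed.

Lemma le_mean (V : numFieldType) N (f g : 'I_N * 'I_N -> V) :
  (forall q, f q <= g q) -> mean f <= mean g.
Proof. by move=> fg; rewrite ler_wpM2r ?invr_ge0// ler_sum. Qed.

Lemma mean_ge0 (V : numFieldType) N (f : 'I_N * 'I_N -> V) :
  (forall q, 0 <= f q) -> 0 <= mean f.
Proof. by move=> f0; rewrite divr_ge0// sumr_ge0. Qed.

Lemma nm_mean N (f : 'I_N * 'I_N -> C) : nm (mean f) <= mean (fun q => nm (f q)).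
Proof.
by rewrite /mean nmM nmV nm_nat ler_wpM2r ?invr_ge0// nm_sum.
Qed.

Lemma nm_mean_le N (f : 'I_N * 'I_N -> C) K : (0 < N)%N ->
  (forall q, nm (f q) <= K) -> nm (mean f) <= K.
Proof.
by move=> N0 h; rewrite (le_trans (nm_mean _))// -[leRHS](mean_cst K N0) le_mean.
Qed.

Lemma mean_real N (f : 'I_N * 'I_N -> R) :
  (mean f)%:C%C = mean (fun q => (f q)%:C%C : C).
Proof. by rewrite /mean rmorphM /= fmorphV /= rmorph_nat rmorph_sum. Qed.

Definition tor (r : R) (z : C) N (q : 'I_N * 'I_N) : C * C :=
  (r%:C%C * z ^+ q.1, r%:C%C * z ^+ q.2).

(* partial sums of the inner product of the dilates [x r^(j+k)], [y r^(j+k)] *)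
Definition rdot (r : R) x y N : C :=
  \sum_(j < N) \sum_(k < N) x j k * (y j k)^* * (r ^+ (2 * (j + k)))%:C%C.

Section Fixed.
Variables (N : nat) (z : C).
Hypothesis zP : N.-primitive_root z.

Lemma nm_tor (r : R) q : 0 <= r -> nm (@tor r z N q).1 = r /\ nm (@tor r z N q).2 = r.
Proof. by move=> r0; rewrite /= !nmM !(nm_root zP) !mulr1 !nm_real !ger0_norm. Qed.

(** Orthogonality of the characters [e p] of the grid. The partial sums contain only exponents below
    [N], hence there is no aliasing and no error term. *)
Lemma mean_dot_exact (r : R) x y :
  mean (fun q : 'I_N * 'I_N => psum x N (tor r z q) * (psum y N (tor r z q))^*) = rdot r x y N.
Proof.
pose e (p q : 'I_N * 'I_N) : C := (z ^+ q.1) ^+ p.1 * (z ^+ q.2) ^+ p.2.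
have psE u (q : 'I_N * 'I_N) : psum u N (tor r z q) =
    \sum_(p : 'I_N * 'I_N) (u p.1 p.2 * (r ^+ (p.1 + p.2))%:C%C) * e p q.
  rewrite /psum pair_big; apply: eq_bigr => p _ /=.
  rewrite !exprMn exprD rmorphM !rmorphXn /= /e; ring.
have eE p p' : \sum_q e p q * (e p' q)^* = (N * N * (p == p'))%:R.
  rewrite -(pair_big xpredT xpredT (fun i k => e p (i, k) * (e p' (i, k))^*)) /=.
  transitivity ((\sum_(i < N) (z ^+ i) ^+ p.1 * ((z ^+ i) ^+ p'.1)^*) *
                (\sum_(i < N) (z ^+ i) ^+ p.2 * ((z ^+ i) ^+ p'.2)^*)).
    rewrite mulr_suml; apply: eq_bigr => i _; rewrite mulr_sumr; apply: eq_bigr => k _.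
    by rewrite /e /= rmorphM mulrACA.
  rewrite !(sum_roots zP)// -natrM; congr (_%:R).
  by rewrite mulnACA mulnb; case: p p' => [p1 p2] [p1' p2'].
have N0 : (N * N)%:R != 0 :> C.
  by rewrite pnatr_eq0 muln_eq0 orbb -lt0n (prim_order_gt0 zP).
rewrite /mean /rdot pair_big /=; apply: (mulIf N0); rewrite divfK//.
transitivity (\sum_(p : 'I_N * 'I_N) \sum_(p' : 'I_N * 'I_N) (x p.1 p.2 * (r ^+ (p.1 + p.2))%:C%C) *
    (y p'.1 p'.2 * (r ^+ (p'.1 + p'.2))%:C%C)^* * \sum_q e p q * (e p' q)^*).
  under eq_bigr => q _.
    rewrite !psE rmorph_sum mulr_suml.
    under eq_bigr do rewrite mulr_sumr.
    over.
  rewrite exchange_big /=; apply: eq_bigr => p _.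
  rewrite exchange_big /=; apply: eq_bigr => p' _.
  rewrite mulr_sumr; apply: eq_bigr => q _.
  rewrite rmorphM /=; ring.
rewrite mulr_suml; apply: eq_bigr => p _; rewrite (bigD1 p)//= [X in _ + X]big1 ?addr0.
  rewrite eE eqxx muln1 mul2n -addnn; move: (p.1 + p.2)%N => s.
  by rewrite rmorphM /= conj_real exprD rmorphM /=; ring.
by move=> p' /negPf pp'; rewrite eE eq_sym pp' muln0 mulr0.
Qed.

End Fixed.

Lemma power_series_bound x F (r : R) : power_series x F -> 0 <= r < 1 ->
  exists K, forall z, nm z.1 <= r -> nm z.2 <= r ->
  nm (F z) <= K /\ forall n, nm (psum x n z) <= K.
Proof.
move=> hF /[dup] r01 /andP[r0 r1].
have [/poly_growth_ge0[B [d [B0 hB]]] _] := hF.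
have [S hS] := geom_sum_bounded d r01.
have S0 : 0 <= S by rewrite (le_trans _ (hS 0%N))// geom_sum_ge0.
have [n0 hn0] := power_series_unif hF r01 ltr01.
exists (B * S ^+ 2 + 1) => z z1 z2.
have hp n : nm (psum x n z) <= B * S ^+ 2.
  have [] := @tail_le R (trunc x n) 0 B d r z r0 z1 z2 => //.
    by move=> j k; rewrite coef_trunc nm_if.
  move=> M [_]; rewrite -eval2_trunc => /le_trans; apply.
  rewrite ler_wpM2l// /geom_sum big_ord0 expr0n subr0 -/(geom_sum _ _ _).
  by rewrite lerXn2r ?nnegrE ?geom_sum_ge0.
split; last by move=> n; rewrite (le_trans (hp n))// lerDl.
rewrite -[F z](subrK (psum x n0 z)) addrC (le_trans (nmD _ _))// lerD//.
exact: hn0.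
Qed.

(** On the grid both functions are uniformly close to their [N]-th partial sums, for which the mean
    is exact. *)
Lemma mean_dot_approx x y F G (r e : R) : power_series x F -> power_series y G ->
  0 <= r < 1 -> 0 < e ->
  exists N0, forall N z, (N0 <= N)%N -> N.-primitive_root z ->
  nm (mean (fun q : 'I_N * 'I_N => F (tor r z q) * (G (tor r z q))^*) - rdot r x y N) <= e.
Proof.
move=> hF hG /[dup] r01 /andP[r0 r1] e0.
have [K1 hK1] := power_series_bound hF r01; have [K2 hK2] := power_series_bound hG r01.
pose K := Num.max 1 (Num.max K1 K2).
have K0 : 0 < K by rewrite lt_max ltr01.
have e20 : 0 < e / 2 / K by rewrite !divr_gt0.
have [n1 h1] := power_series_unif hF r01 e20; have [n2 h2] := power_series_unif hG r01 e20.
exists (maxn n1 n2) => N z; rewrite geq_max => /andP[N1 N2] zP.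
rewrite -(mean_dot_exact zP) -meanB; apply: nm_mean_le; first exact: prim_order_gt0 zP.
move=> q; have [t1 t2] := nm_tor zP q r0; set w := tor r z q in t1 t2 *.
have {}h1 := h1 N w N1 _ _; have {}h2 := h2 N w N2 _ _.
rewrite t1 t2 lexx in h1 h2; have {}h1 := h1 isT isT; have {}h2 := h2 isT isT.
have := hK1 w; have := hK2 w; rewrite t1 t2 lexx => /(_ isT isT)[G1 G2] /(_ isT isT)[F1 F2].
set f := F w; set g := G w; set f' := psum x N w; set g' := psum y N w.
have -> : f * g^* - f' * g'^* = (f - f') * g^* + f' * (g - g')^* by rewrite rmorphB; ring.
apply: le_trans (nmD _ _) _; rewrite !nmM !nmJ [e]splitr.
have eK : e / 2 = e / 2 / K * K by rewrite divfK ?gt_eqF.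
rewrite lerD// eK; last rewrite mulrC; apply: ler_pM; rewrite ?nm_ge0//.
  by rewrite (le_trans G1)// /K !le_max lexx !orbT.
by rewrite (le_trans (F2 _))// /K !le_max lexx !orbT.
Qed.

Lemma coef_le_torus Q K : (forall z : C * C, nm z.1 = 1 -> nm z.2 = 1 -> nm (eval2 Q z) <= K) ->
  forall j k, nm Q`_j`_k <= K.
Proof.
move=> hK j k; have [M hM] := eval2_widen Q.
pose N := maxn M (maxn j k).+1.
have N0 : (0 < N)%N by rewrite leq_max orbT.
have [z zP] := prim_root_exists R N0.
have jN : (j < N)%N by rewrite /N leq_max ltnS leq_maxl orbT.
have kN : (k < N)%N by rewrite /N leq_max ltnS leq_maxr orbT.
(* The coefficient array of the monomial $z_1^jz_2^k$: the coefficient of [Q] is the mean of [Q]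
   against its conjugate, a Cauchy estimate on the grid. *)
pose y (a b : nat) : C := ((a == j) && (b == k))%:R.
have ytor (q : 'I_N * 'I_N) : psum y N (tor 1 z q) = (z ^+ q.1) ^+ j * (z ^+ q.2) ^+ k.
  rewrite /psum (bigD1 (Ordinal jN))//= [X in _ + X]big1 ?addr0; last first.
    move=> a aj; apply: big1 => b _; rewrite /y.
    by move: aj; rewrite -val_eqE /= => /negPf ->; rewrite !mul0r.
  rewrite (bigD1 (Ordinal kN))//= [X in _ + X]big1 ?addr0; last first.
    move=> b bk; rewrite /y.
    by move: bk; rewrite -val_eqE /= => /negPf ->; rewrite andbF !mul0r.
  by rewrite /y !eqxx !mul1r.
have := mean_dot_exact zP 1 (fun a b => Q`_a`_b) y.
have -> : rdot 1 (fun a b => Q`_a`_b) y N = Q`_j`_k.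
  rewrite /rdot (bigD1 (Ordinal jN))//= [X in _ + X]big1 ?addr0; last first.
    move=> a aj; apply: big1 => b _; rewrite /y.
    by move: aj; rewrite -val_eqE /= => /negPf ->; rewrite rmorph0 mulr0 mul0r.
  rewrite (bigD1 (Ordinal kN))//= [X in _ + X]big1 ?addr0; last first.
    move=> b bk; rewrite /y.
    by move: bk; rewrite -val_eqE /= => /negPf ->; rewrite andbF rmorph0 mulr0 mul0r.
  by rewrite /y !eqxx rmorph1 expr1n !mulr1.
move=> <-; apply: nm_mean_le => // q; rewrite nmM nmJ ytor nmM -!exprM !(nm_root zP).
rewrite !mulr1 /psum -hM ?leq_maxl// hK//.
  by have [] := nm_tor zP q ler01.
by have [] := nm_tor zP q ler01.
Qed.

End TorusMeans.

(** * Formal division of power series, with control of growth *)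

Section FormalQuotient.

(** The recursion for the quotient needs all earlier terms, so a list of them is carried along. The
    coefficients lie in a ring because the terms will be homogeneous parts of polynomials. *)
Lemma series_quotient (A : comNzRingType) (a b : nat -> A) (u : A) : u * a 0%N = 1 ->
  exists G : nat -> A, forall k, \sum_(i < k.+1) a i * G (k - i)%N = b k.
Proof.
move=> ua.
pose g := fix g n : seq A := if n is n'.+1 then
  rcons (g n') (u * (b n' - \sum_(i < n') a i.+1 * nth 0 (g n') (n' - i.+1))) else [::].
have sg n : size (g n) = n by elim: n => //= n IH; rewrite size_rcons IH.
have gn n k : (k < n)%N -> nth 0 (g n) k = nth 0 (g k.+1) k.
  elim: n => // n IH; rewrite ltnS leq_eqVlt => /predU1P[->//|kn].
  by rewrite -IH//= nth_rcons sg kn.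
exists (fun k => nth 0 (g k.+1) k) => k; rewrite big_ord_recl subn0 /=.
rewrite [X in _ * X]nth_rcons sg ltnn eqxx mulrA [a 0%N * u]mulrC ua mul1r.
rewrite -[RHS](subrK (\sum_(i < k) a i.+1 * nth 0 (g k) (k - i.+1))); congr (_ + _).
apply: eq_bigr => i _; rewrite /bump /= add1n; congr (_ * _).
by rewrite [RHS]gn// ltn_subrL (leq_ltn_trans (leq0n i) (ltn_ord i)).
Qed.

Lemma poly2_mulVf (F : fieldType) (c : F) : c != 0 ->
  (c^-1)%:P%:P * c%:P%:P = 1 :> {poly {poly F}}.
Proof. by move=> c0; rewrite -!polyCM mulVf// !polyC1. Qed.

Variable R : realType.
Local Notation C := R[i].

(* Dividing by [1 - b X] with [|b| <= 1] costs one degree of polynomial growth. *)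
Lemma series_quotient_bound (s : seq C) (W : R) d (y : nat -> C) :
  {in s, forall b, nm b <= 1} -> 0 <= W ->
  (forall k, nm (\sum_(i < k.+1) (\prod_(b <- s) (1 - b *: 'X))`_i * y (k - i)%N)
     <= W * k.+1%:R ^+ d) ->
  forall k, nm (y k) <= W * k.+1%:R ^+ (d + size s).
Proof.
elim: s d => [|b s IH] d hs W0 h k.
  have := h k; rewrite addn0 big_nil big_ord_recl subn0 coef1 mul1r.
  by rewrite big1 ?addr0// => i _; rewrite coef1 mul0r.
rewrite /= addnS -addSn; apply: IH => //.
  by move=> c cs; apply: hs; rewrite inE cs orbT.
have b1 : nm b <= 1 by apply: hs; rewrite inE eqxx.
move: h; rewrite big_cons; set Q := \prod_(_ <- s) _ => h {k}.
(* The coefficients of $Qy$. Those of $(1-bX)Qy$ are $u_k-bu_{k-1}$, so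
   $|u_k|\le|u_{k-1}|+W(k+1)^d$, and summation raises the exponent by one. *)
pose u k := \sum_(i < k.+1) Q`_i * y (k - i)%N.
have uE k : \sum_(i < k.+1) ((1 - b *: 'X) * Q)`_i * y (k - i)%N =
    u k - (if k is k'.+1 then b * u k' else 0).
  under eq_bigr do rewrite mulrBl mul1r -scalerAl coefB coefZ coefXM mulrBl.
  rewrite sumrB; congr (_ - _); rewrite big_ord_recl /= mulr0 mul0r add0r.
  case: k => [|k]; first by rewrite big_ord0.
  by rewrite /u mulr_sumr; apply: eq_bigr => i _; rewrite /bump /= add1n subSS mulrA.
elim => [|k IHk].
  by have := h 0%N; rewrite uE subr0 !expr1n.
have := h k.+1; rewrite uE => hk; rewrite -/(u _).
rewrite -[u k.+1](subrK (b * u k)) (le_trans (nmD _ _))//.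
have : nm (b * u k) <= W * (k.+1%:R * k.+1%:R ^+ d).
  by rewrite nmM -exprS (le_trans _ IHk)// ler_piMl ?nm_ge0.
move/(lerD hk)/le_trans; apply.
rewrite -mulrDr ler_wpM2l//.
have -> : k.+2%:R = 1 + k.+1%:R :> R by rewrite -natr1 addrC.
rewrite exprS mulrDl mul1r lerD2l ler_wpM2l// lerXn2r ?nnegrE ?addr_ge0//.
by rewrite lerDr.
Qed.

End FormalQuotient.

(** * Homogeneous parts and the Taylor coefficients of rational functions *)

Section Homogeneous.
Variable R : realType.
Local Notation C := R[i].
Implicit Types Q : {poly {poly C}}.

Lemma eval2_0 (z : C * C) : eval2 0 z = 0.
Proof. by rewrite /eval2 !horner0. Qed.

Definition homogeneous k Q : Prop := forall j l, (j + l != k)%N -> Q`_j`_l = 0.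

Definition hpart k Q : {poly {poly C}} :=
  trunc (fun j l => if (j + l == k)%N then Q`_j`_l else 0) (maxn (size Q) (sizeY Q)).

Lemma coef_out Q j l M : (maxn (size Q) (sizeY Q) <= M)%N ->
  ~~ ((j < M)%N && (l < M)%N) -> Q`_j`_l = 0.
Proof.
rewrite geq_max => /andP[h1 h2]; rewrite negb_and -!leqNgt => /orP[h|h].
  by rewrite (nth_default 0 (leq_trans h1 h)) coef0.
by rewrite nth_default// (leq_trans (max_size_coefXY _ _))// (leq_trans h2).
Qed.

Lemma coef_hpart k Q j l : (hpart k Q)`_j`_l = if (j + l == k)%N then Q`_j`_l else 0.
Proof.
rewrite coef_trunc; case: ifPn => // /(coef_out (leqnn _)) ->.
by rewrite if_same.
Qed.

Lemma homogeneous_hpart k Q : homogeneous k (hpart k Q).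
Proof. by move=> j l /negPf jl; rewrite coef_hpart jl. Qed.

Lemma homogeneousM a b P Q : homogeneous a P -> homogeneous b Q -> homogeneous (a + b) (P * Q).
Proof.
move=> hP hQ j l jl; rewrite coefMM /conv big1// => i _; rewrite big1// => e _.
have [h1|h1] := eqVneq (i + e)%N a; last by rewrite hP ?mul0r.
have [h2|h2] := eqVneq (j - i + (l - e))%N b; last by rewrite hQ ?mulr0.
move/eqP: jl; case; rewrite -h1 -h2.
have ij : (i <= j)%N by rewrite -ltnS.
have el : (e <= l)%N by rewrite -ltnS.
lia.
Qed.

Lemma homogeneousB a P Q : homogeneous a P -> homogeneous a Q -> homogeneous a (P - Q).
Proof. by move=> hP hQ j l jl; rewrite !coefB hP// hQ// subr0. Qed.

Lemma homogeneous_sum a I (s : seq I) (P : pred I) (Q : I -> {poly {poly C}}) :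
  (forall i, P i -> homogeneous a (Q i)) -> homogeneous a (\sum_(i <- s | P i) Q i).
Proof.
move=> h j l jl; rewrite !coef_sum big1// => i Pi; exact: h.
Qed.

Lemma eval2_homogeneous k Q (t : C) (z : C * C) : homogeneous k Q ->
  eval2 Q (t * z.1, t * z.2) = t ^+ k * eval2 Q z.
Proof.
move=> hQ; have [M hM] := eval2_widen Q; rewrite !(hM M)// mulr_sumr.
apply: eq_bigr => j _; rewrite mulr_sumr; apply: eq_bigr => l _ /=.
have [<-|jl] := eqVneq (j + l)%N k; last by rewrite hQ// !mul0r mulr0.
rewrite !exprMn exprD; ring.
Qed.

Lemma sum_hpart Q M : ((maxn (size Q) (sizeY Q)).*2 <= M)%N -> \sum_(k < M) hpart k Q = Q.
Proof.
move=> hM; apply/polyP => j; apply/polyP => l; rewrite !coef_sum.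
under eq_bigr do rewrite coef_hpart.
rewrite -big_mkcond /=; have [jl|jl] := ltnP (j + l) M.
  by rewrite (big_pred1 (Ordinal jl))// => i; rewrite -val_eqE eq_sym.
rewrite big1 => [|i /eqP iE]; last by have := ltn_ord i; rewrite -iE ltnNge jl.
rewrite (coef_out (leqnn _))// negb_and -!leqNgt; apply/orP.
have [|h] := leqP (maxn (size Q) (sizeY Q)) j; [by left|right; lia].
Qed.

Lemma nm_hpart Q k (z : C * C) : nm z.1 = 1 -> nm z.2 = 1 ->
  nm (eval2 (hpart k Q) z) <=
  \sum_(j < maxn (size Q) (sizeY Q)) \sum_(l < maxn (size Q) (sizeY Q)) nm (Q`_j`_l).
Proof.
move=> z1 z2; rewrite eval2_trunc /psum.
apply: le_trans (nm_sum _ _ _) _; apply: ler_sum => j _.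
apply: le_trans (nm_sum _ _ _) _; apply: ler_sum => l _.
by rewrite !nmM !nmX z1 z2 !expr1n !mulr1 nm_if.
Qed.

(* A rational function without poles in the bidisk: along each slice
   [t |-> p (t z)] with [z] in the torus, [p] has no zero in the disk, which
   bounds the homogeneous parts of the quotient on the torus, hence its
   coefficients. *)
Lemma rational_power_series (p f : {poly {poly C}}) :
  (forall z : C * C, nm z.1 < 1 -> nm z.2 < 1 -> eval2 p z != 0) ->
  exists c, power_series c (fun z => eval2 f z / eval2 p z).
Proof.
move=> hp.
have p00 : p`_0`_0 != 0.
  have := hp (0, 0); rewrite nm0 => /(_ ltr01 ltr01).
  by rewrite /eval2 !horner_coef0.
pose u : {poly {poly C}} := (p`_0`_0)^-1%:P%:P.
have hu : homogeneous 0 u.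
  by case=> [|j] [|l]//= _; rewrite /u !(coefC, coef0).
have hp0 : hpart 0 p = (p`_0`_0)%:P%:P.
  apply/polyP => -[|j]; apply/polyP => -[|l]; rewrite coef_hpart !(coefC, coef0)//.
have up : u * hpart 0 p = 1 by rewrite hp0; exact: poly2_mulVf.
(* Division graded by total degree: the leading term [hpart 0 p] is the nonzero constant $p(0,0)$,
   and [G k] turns out to be homogeneous of degree [k]. *)
have [G hG] := @series_quotient _ (fun i => hpart i p) (fun i => hpart i f) u up.
have homG k : homogeneous k (G k).
  elim/ltn_ind: k => k IH.
  have -> : G k = u * (hpart k f - \sum_(i < k) hpart i.+1 p * G (k - i.+1)%N).
    by rewrite -hG big_ord_recl subn0 /= addrK mulrA up mul1r.
  rewrite -[k]add0n; apply: homogeneousM => //; apply: homogeneousB.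
    exact: homogeneous_hpart.
  apply: homogeneous_sum => i _; rewrite -[in X in homogeneous X](@subnKC i.+1 k)//.
  apply: homogeneousM; first exact: homogeneous_hpart.
  by apply: IH; rewrite ltn_subrL (leq_ltn_trans (leq0n i) (ltn_ord i)).
pose c j l := (G (j + l)%N)`_j`_l.
have pc j l : conv (fun a b => p`_a`_b) c j l = f`_j`_l.
  transitivity ((hpart (j + l) f)`_j`_l); last by rewrite coef_hpart eqxx.
  rewrite -hG !coef_sum /conv.
  transitivity (\sum_(i < (j + l).+1) \sum_(a < j.+1) \sum_(b < l.+1)
      (hpart i p)`_a`_b * (G (j + l - i)%N)`_(j - a)`_(l - b)); last first.
    by apply: eq_bigr => i _; rewrite coefMM.
  rewrite [RHS]exchange_big; apply: eq_bigr => a _.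
  rewrite [RHS]exchange_big; apply: eq_bigr => b _ /=.
  have ab : (a + b < (j + l).+1)%N by rewrite ltnS leq_add// -ltnS.
  rewrite [RHS](bigD1 (Ordinal ab))//= [X in _ + X]big1 ?addr0; last first.
    by move=> i; rewrite -val_eqE eq_sym /= coef_hpart => /negPf ->; rewrite mul0r.
  rewrite coef_hpart eqxx /c; congr (_ * (G _)`__`__).
  have aj : (a <= j)%N by rewrite -ltnS.
  have bl : (b <= l)%N by rewrite -ltnS.
  lia.
(* [D] exceeds the total degree of [p], so it bounds the number of linear factors on every slice
   uniformly in the slice. *)
pose D := (maxn (size p) (sizeY p)).*2.
pose W : R := \sum_(j < maxn (size f) (sizeY f)) \sum_(l < maxn (size f) (sizeY f)) nm (f`_j`_l).
have W0 : 0 <= W by apply: sumr_ge0 => j _; apply: sumr_ge0 => l _; exact: nm_ge0.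
have p00n : 0 < nm p`_0`_0 by rewrite nm_gt0.
pose B := W / nm p`_0`_0.
have B0 : 0 <= B by rewrite divr_ge0// nm_ge0.
have Gb (z : C * C) k : nm z.1 = 1 -> nm z.2 = 1 -> nm (eval2 (G k) z) <= B * k.+1%:R ^+ D.
  move=> z1 z2.
  pose P : {poly C} := \poly_(i < D) eval2 (hpart i p) z.
  have PE t : P.[t] = eval2 p (t * z.1, t * z.2).
    rewrite horner_poly -[in RHS](@sum_hpart p D)// eval2_sum.
    apply: eq_bigr => i _; by rewrite mulrC (eval2_homogeneous _ _ (@homogeneous_hpart i p)).
  have [|s [ss hs defP]] := @zero_free_factor R P.
    by move=> t t1; rewrite PE hp//= nmM ?z1 ?z2 mulr1.
  have P0 : P.[0] = p`_0`_0.
    by rewrite PE !mul0r /eval2 !horner_coef0.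
  have Pi i : P`_i = eval2 (hpart i p) z.
    rewrite coef_poly; case: ltnP => // Di.
    have -> : hpart i p = 0; last by rewrite eval2_0.
    apply/polyP => a; apply/polyP => b; rewrite coef_hpart !coef0.
    case: eqP => // abi; apply: (coef_out (leqnn _)).
    rewrite negb_and -!leqNgt; apply/orP; move: Di; rewrite /D -abi.
    by have [?|?] := leqP (maxn (size p) (sizeY p)) a; [left|right; lia].
  have sD : (size s <= D)%N.
    by rewrite (leq_trans ss)// (leq_trans (leq_pred _))// size_poly.
  have hc l : nm (\sum_(i < l.+1) (\prod_(b <- s) (1 - b *: 'X))`_i *
      eval2 (G (l - i)%N) z) <= B * l.+1%:R ^+ 0.
    rewrite expr0 mulr1 ler_pdivlMr// mulrC -P0 -nmM mulr_sumr.
    have PG (i : 'I_l.+1) : P.[0] * ((\prod_(b <- s) (1 - b *: 'X))`_i *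
        eval2 (G (l - i)%N) z) = eval2 (hpart i p * G (l - i)%N) z.
      by rewrite eval2M -Pi [in RHS]defP coefZ mulrA.
    by rewrite (eq_bigr _ (fun i _ => PG i)) -eval2_sum hG nm_hpart.
  have /= := @series_quotient_bound R s B 0 (fun k => eval2 (G k) z) hs B0 hc k.
  move/le_trans; apply; rewrite add0n.
  by rewrite ler_wpM2l// ler_weXn2l// ler1n.
have cb j l : nm (c j l) <= B * (j.+1%:R * l.+1%:R) ^+ D.
  rewrite (le_trans (coef_le_torus (fun z z1 z2 => Gb z _ z1 z2) _ _))//.
  rewrite ler_wpM2l// lerXn2r ?nnegrE ?mulr_ge0// -natrM ler_nat; nia.
exists c; split; first by exists B, D.
move=> z z1 z2 e e0; set pz := eval2 p z.
have pz0 : 0 < nm pz by rewrite nm_gt0 hp.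
pose r := Num.max (nm z.1) (nm z.2).
have r01 : 0 <= r < 1 by rewrite le_max nm_ge0 /= gt_max z1 z2.
pose B1 : R := \sum_(j < maxn (size p) (sizeY p)) \sum_(l < maxn (size p) (sizeY p)) nm (p`_j`_l).
have coef_le_sum (Q : {poly {poly C}}) j l : nm Q`_j`_l <=
    \sum_(j < maxn (size Q) (sizeY Q)) \sum_(l < maxn (size Q) (sizeY Q)) nm (Q`_j`_l).
  have S0 a : 0 <= \sum_(l < maxn (size Q) (sizeY Q)) nm (Q`_a`_l).
    by apply: sumr_ge0 => b _; exact: nm_ge0.
  have [/andP[jM lM]|/(coef_out (leqnn _)) ->] :=
    boolP ((j < maxn (size Q) (sizeY Q)) && (l < maxn (size Q) (sizeY Q)))%N; last first.
    by rewrite nm0 sumr_ge0.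
  rewrite (bigD1 (Ordinal jM))//= (bigD1 (Ordinal lM))//= -addrA lerDl addr_ge0//.
    by apply: sumr_ge0 => b _; exact: nm_ge0.
  by apply: sumr_ge0 => b _; exact: S0.
have B10 : 0 <= B1 by apply: le_trans (coef_le_sum p 0 0); exact: nm_ge0.
have [|n0 hn0] := tail_small (B1 * B + W) (0 + D).+1 r01 (e := e * nm pz).
  by rewrite mulr_gt0.
exists n0 => n n0n.
(* Multiplied by $p(z)$, the error becomes the value of the polynomial [p * trunc c n - f], which
   has no coefficient in the [n]-square. *)
rewrite -(ler_pM2r pz0) -nmM mulrBl divfK -?nm_gt0// mulrC -eval2_trunc -eval2M -eval2B.
have cb' (j l : nat) : nm (conv (fun a b => p`_a`_b) (fun a b => (trunc c n)`_a`_b) j l) <=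
    B1 * B * (j.+1%:R * l.+1%:R) ^+ (0 + D).+1.
  apply: conv_bound => // {}j {}l; first by rewrite expr0 mulr1 coef_le_sum.
  by rewrite coef_trunc nm_if.
apply: (hn0 n) => //.
- by rewrite le_max lexx.
- by rewrite le_max lexx orbT.
- move=> j l; rewrite !coefB coefMM (le_trans (nmB _ _))// mulrDl lerD//.
  rewrite (le_trans (coef_le_sum f j l))// -/W ler_peMr//.
  by rewrite exprn_ege1// -natrM ler1n.
move=> j l jn ln; rewrite !coefB coefMM -pc; apply/eqP; rewrite subr_eq0; apply/eqP.
apply: eq_bigr => a _; apply: eq_bigr => b _; rewrite coef_trunc.
by rewrite (leq_ltn_trans (leq_subr _ _) jn) (leq_ltn_trans (leq_subr _ _) ln).
Qed.

End Homogeneous.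

(** * Estimates for rational inner functions *)

Section PolynomialEstimates.
Variable R : realType.
Local Notation C := R[i].
Implicit Types (Q : {poly {poly C}}) (z w : C * C).

Lemma expr_small (r e : R) : 0 <= r < 1 -> 0 < e ->
  exists N0, forall N, (N0 <= N)%N -> r ^+ N <= e.
Proof.
case/andP=> r0 r1 e0; have := @cvg_expr R r; rewrite ger0_norm// => /(_ r1).
move=> /cvgrPdist_le/(_ _ e0)[N0 _ h]; exists N0 => N /h /=.
by rewrite sub0r normrN ger0_norm// exprn_ge0.
Qed.

Lemma nm_monomialB (a b c d : C) j k : nm a <= 1 -> nm b <= 1 -> nm c <= 1 -> nm d <= 1 ->
  nm (a ^+ j * b ^+ k - c ^+ j * d ^+ k) <= j%:R * nm (a - c) + k%:R * nm (b - d).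
Proof.
move=> a1 b1 c1 d1.
have pw (x y : C) n : nm x <= 1 -> nm y <= 1 -> nm (x ^+ n - y ^+ n) <= n%:R * nm (x - y).
  move=> x1 y1; elim: n => [|n IH]; first by rewrite !expr0 subrr nm0 mul0r.
  have -> : x ^+ n.+1 - y ^+ n.+1 = x * (x ^+ n - y ^+ n) + (x - y) * y ^+ n.
    by rewrite !exprS; ring.
  have -> : n.+1%:R * nm (x - y) = n%:R * nm (x - y) + nm (x - y) by rewrite -natr1; ring.
  rewrite (le_trans (nmD _ _))// !nmM lerD//.
    by rewrite (le_trans _ IH)// ler_piMl ?nm_ge0.
  by rewrite ler_piMr ?nm_ge0// nmX exprn_ile1 ?nm_ge0.
have -> : a ^+ j * b ^+ k - c ^+ j * d ^+ k =
  (a ^+ j - c ^+ j) * b ^+ k + c ^+ j * (b ^+ k - d ^+ k) by ring.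
apply: le_trans (nmD _ _) _; rewrite !nmM lerD//.
  by rewrite (le_trans _ (pw _ _ _ a1 c1))// ler_piMr ?nm_ge0// nmX exprn_ile1 ?nm_ge0.
by rewrite (le_trans _ (pw _ _ _ b1 d1))// ler_piMl ?nm_ge0// nmX exprn_ile1 ?nm_ge0.
Qed.

Definition closed_bidisk z : Prop := nm z.1 <= 1 /\ nm z.2 <= 1.

Lemma eval2_lipschitz Q : exists L, 0 <= L /\ forall z w, closed_bidisk z -> closed_bidisk w ->
  nm (eval2 Q z - eval2 Q w) <= L * (nm (z.1 - w.1) + nm (z.2 - w.2)).
Proof.
have [N hN] := eval2_widen Q.
exists (\sum_(j < N) \sum_(k < N) nm Q`_j`_k * N%:R); split.
  by apply: sumr_ge0 => j _; apply: sumr_ge0 => k _; rewrite mulr_ge0 ?nm_ge0.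
move=> z w [z1 z2] [w1 w2]; rewrite !(hN N)// -sumrB mulr_suml.
apply: le_trans (nm_sum _ _ _) _; apply: ler_sum => j _; rewrite -sumrB mulr_suml.
apply: le_trans (nm_sum _ _ _) _; apply: ler_sum => k _.
rewrite -!mulrA -mulrBr nmM ler_wpM2l ?nm_ge0//.
apply: le_trans (nm_monomialB _ _ z1 z2 w1 w2) _.
by rewrite mulrDr lerD// ler_wpM2r ?nm_ge0// ler_nat ltnW.
Qed.

Lemma eval2_bounded Q : exists M, 0 <= M /\ forall z, closed_bidisk z -> nm (eval2 Q z) <= M.
Proof.
have [N hN] := eval2_widen Q.
exists (\sum_(j < N) \sum_(k < N) nm Q`_j`_k); split.
  by apply: sumr_ge0 => j _; apply: sumr_ge0 => k _; rewrite nm_ge0.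
move=> z [z1 z2]; rewrite (hN N)//.
apply: le_trans (nm_sum _ _ _) _; apply: ler_sum => j _.
apply: le_trans (nm_sum _ _ _) _; apply: ler_sum => k _.
by rewrite !nmM !nmX -mulrA ler_piMr ?nm_ge0// mulr_ile1 ?exprn_ge0 ?nm_ge0// exprn_ile1 ?nm_ge0.
Qed.

Definition dilate (r : R) z : C * C := (r%:C%C * z.1, r%:C%C * z.2).

Definition in_torus z : Prop := nm z.1 = 1 /\ nm z.2 = 1.

Lemma nm_dilate r z : 0 <= r -> in_torus z -> nm (dilate r z).1 = r /\ nm (dilate r z).2 = r.
Proof. by move=> r0 [z1 z2]; rewrite /= !nmM z1 z2 !mulr1 !nm_real ger0_norm. Qed.

Lemma nm_sub_dilate r (x : C) : r <= 1 -> nm x = 1 -> nm (x - r%:C%C * x) = 1 - r.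
Proof.
move=> r1 x1; rewrite -{1}[x]mul1r -mulrBl nmM x1 mulr1.
have -> : 1 - r%:C%C = (1 - r)%:C%C :> C by rewrite rmorphB rmorph1.
by rewrite nm_real ger0_norm// subr_ge0.
Qed.

Lemma torus_closed z : in_torus z -> closed_bidisk z.
Proof. by move=> [z1 z2]; split; rewrite ?z1 ?z2. Qed.

Lemma dilate_closed r z : 0 <= r <= 1 -> in_torus z -> closed_bidisk (dilate r z).
Proof. by case/andP=> r0 r1 /(nm_dilate r0)[z1 z2]; split; rewrite ?z1 ?z2. Qed.

Lemma sqr_nm_dilate Q : exists K, 0 <= K /\ forall r z, 0 <= r <= 1 -> in_torus z ->
  `|nm (eval2 Q z) ^+ 2 - nm (eval2 Q (dilate r z)) ^+ 2| <= K * (1 - r).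
Proof.
have [L [L0 hL]] := eval2_lipschitz Q; have [M [M0 hM]] := eval2_bounded Q.
exists (L * 2 * (2 * M)); split; first by rewrite !mulr_ge0.
move=> r z /[dup] r01 /andP[r0 r1] tz.
have cz := torus_closed tz; have cdz := dilate_closed r01 tz.
have := hL _ _ cz cdz; have [z1 z2] := tz.
rewrite /= !nm_sub_dilate// => hd.
rewrite subr_sqr normrM (_ : _ * 2 * _ * _ = L * (1 - r + (1 - r)) * (2 * M)); last by ring.
apply: ler_pM => //.
  apply: le_trans hd; rewrite ler_norml nm_subr andbT.
  by rewrite lerNl opprB nm_distC nm_subr.
rewrite ger0_norm ?addr_ge0 ?nm_ge0// mulr_natl mulr2n lerD//; exact: hM.
Qed.

(** By [prod_roots], the factor $1-bX$ contributes $|1-(br)^N|\ge 1-r^N\ge 1/2$ to the product over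
    the grid. Hence the geometric mean of $|P|$ is at least $|P(0)|$ up to the factor $2^{-d/N}$. *)
Lemma jensen1 (P : {poly C}) d (r : R) N (z : C) : (forall x, nm x < 1 -> P.[x] != 0) ->
  ((size P).-1 <= d)%N -> 0 <= r -> r ^+ N <= 1 / 2 -> N.-primitive_root z ->
  nm P.[0] ^+ N * (1 / 2) ^+ d <= \prod_(i < N) nm P.[r%:C%C * z ^+ i].
Proof.
move=> /zero_free_factor[s [ss hs defP]] sd r0 rN zP.
have -> : \prod_(i < N) nm P.[r%:C%C * z ^+ i] =
    nm P.[0] ^+ N * \prod_(b <- s) nm (1 - (b * r%:C%C) ^+ N).
  rewrite -[N in nm _ ^+ N]card_ord -prodr_const.
  under [X in _ = _ * X]eq_bigr do rewrite -(prod_roots zP) nm_prod.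
  rewrite exchange_big /= -big_split /=; apply: eq_bigr => i _.
  rewrite {1}defP hornerZ horner_prod nmM nm_prod; congr (_ * _).
  by apply: eq_bigr => b _; rewrite !hornerE ?mulrA.
rewrite ler_wpM2l ?exprn_ge0 ?nm_ge0//.
apply: (@le_trans _ _ ((1 / 2) ^+ size s)).
  by rewrite ler_wiXn2l ?(leq_trans ss)//; lra.
elim: s hs {ss defP} => [|b s IH] hs; first by rewrite big_nil expr0.
rewrite big_cons exprS; apply: ler_pM; rewrite ?exprn_ge0//.
  have /hs b1 : b \in b :: s by rewrite inE eqxx.
  apply: le_trans (nm_subr _ _); rewrite nm1 nmX nmM nm_real exprMn (ger0_norm r0).
  have : nm b ^+ N * r ^+ N <= 1 / 2.
    by rewrite (le_trans _ rN)// ler_piMl ?exprn_ge0// exprn_ile1// nm_ge0.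
  lra.
by apply: IH => y ys; apply: hs; rewrite inE ys orbT.
Qed.

Lemma eval2_horner_map Q x y : (map_poly (horner_eval y) Q).[x] = eval2 Q (x, y).
Proof. by rewrite /eval2 -[in LHS](hornerC x y) -[_.[y]]/(horner_eval y _) horner_map. Qed.

Lemma jensen2 Q : (forall z, nm z.1 < 1 -> nm z.2 < 1 -> eval2 Q z != 0) ->
  exists c0, 0 < c0 /\ forall (r : R) N (z : C), 0 <= r < 1 -> r ^+ N <= 1 / 2 ->
  N.-primitive_root z -> c0 ^+ (N * N) <= \prod_(q : 'I_N * 'I_N) nm (eval2 Q (tor r z q)).
Proof.
move=> hQ; pose m := (size Q).-1; pose n := sizeY Q.
have q0 : 0 < nm (eval2 Q (0, 0)) by rewrite nm_gt0 hQ ?nm0.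
(* Jensen in the first variable on each grid slice, then on $Q(0,\cdot)$, loses $(1/2)^{(m+n)N}$,
   which is absorbed since $N\le N^2$. *)
exists (nm (eval2 Q (0, 0)) * (1 / 2) ^+ (m + n)); split.
  by rewrite mulr_gt0// exprn_gt0//; lra.
move=> r N z /[dup] r01 /andP[r0 r1] rN zP.
have N0 : (0 < N)%N := prim_order_gt0 zP.
have nmr k : nm (r%:C%C * z ^+ k) < 1 by rewrite nmM (nm_root zP) mulr1 nm_real ger0_norm.
rewrite -(pair_big xpredT xpredT (fun i k => nm (eval2 Q (tor r z (i, k))))) /=.
rewrite exchange_big /=.
apply: (@le_trans _ _ (\prod_(k < N) (nm (eval2 Q (0, r%:C%C * z ^+ k)) ^+ N * (1 / 2) ^+ m))).
  rewrite big_split /= prodr_const card_ord prodrXl.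
  apply: (@le_trans _ _ ((nm (eval2 Q (0, 0)) ^+ N * (1 / 2) ^+ n) ^+ N * ((1 / 2) ^+ m) ^+ N)).
    have aux (A h : R) : 0 <= A -> 0 <= h -> h <= 1 ->
        (A * h ^+ (m + n)) ^+ (N * N) <= (A ^+ N * h ^+ n) ^+ N * h ^+ m ^+ N.
      move=> A0 hh0 h1; rewrite !exprMn -!exprM -mulrA -exprD.
      by rewrite ler_wpM2l ?exprn_ge0// ler_wiXn2l//; nia.
    by apply: aux; rewrite ?nm_ge0//; lra.
  have h0 : 0 <= 1 / 2 :> R by lra.
  rewrite ler_wpM2r ?exprn_ge0// lerXn2r ?nnegrE ?prodr_ge0 ?mulr_ge0 ?exprn_ge0 ?nm_ge0//.
    by move=> i _; exact: nm_ge0.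
  apply: (@jensen1 Q.[0%:P] n r N z _ _ r0 rN zP).
  - by move=> x x1; have := hQ (0, x); rewrite nm0; apply.
  - by rewrite (leq_trans (leq_pred _))// horner_coef0 max_size_coefXY.
apply: ler_prod => k _; apply/andP; split; first by rewrite mulr_ge0 ?exprn_ge0 ?nm_ge0.
set P := map_poly (horner_eval (r%:C%C * z ^+ k)) Q.
have PE x : P.[x] = eval2 Q (x, r%:C%C * z ^+ k) by rewrite eval2_horner_map.
rewrite -PE; under eq_bigr do rewrite -PE.
apply: (jensen1 _ _ r0 rN zP).
- by move=> x x1; rewrite PE; apply: hQ; [exact: x1|exact: nmr].
- by rewrite /m -!subn1 leq_sub2r// size_poly.
Qed.

End PolynomialEstimates.

Section RationalInnerEstimates.
Variable R : realType.
Local Notation C := R[i].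
Variables (m n : nat) (p : {poly {poly C}}).
Hypothesis hp : rif_denominator m n p.
Local Notation rp := (reflect_poly m n p).
Local Notation phi := (rif m n p).

Lemma rif_den_neq0 (z : C * C) : nm z.1 < 1 -> nm z.2 < 1 -> eval2 p z != 0.
Proof. by case: hp => _ h _ z1 z2; apply: h; split; rewrite norm_lt1. Qed.

Lemma nm_reflect_torus (z : C * C) : in_torus z -> nm (eval2 rp z) = nm (eval2 p z).
Proof.
case: hp => bp _ _ [z1 z2].
have z10 : z.1 != 0 by rewrite -nm_gt0 z1.
have z20 : z.2 != 0 by rewrite -nm_gt0 z2.
rewrite (eval2_reflect bp z10 z20) !nmM !nmX z1 z2 !expr1n !mul1r nmJ.
by rewrite !conj_unit// !invrK -surjective_pairing.
Qed.

(** On the torus $|p|=|\tilde p|$, and both squared moduli change by $O(1-r)$ under dilation. *)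
Lemma rif_defect : exists K, 0 <= K /\ forall r z, 0 <= r <= 1 -> in_torus z ->
  nm (eval2 p (dilate r z)) ^+ 2 - nm (eval2 rp (dilate r z)) ^+ 2 <= K * (1 - r).
Proof.
have [K1 [K10 h1]] := sqr_nm_dilate p; have [K2 [K20 h2]] := sqr_nm_dilate rp.
exists (K1 + K2); split; first exact: addr_ge0.
move=> r z r01 tz; have := h1 _ _ r01 tz; have := h2 _ _ r01 tz.
rewrite nm_reflect_torus// !ler_norml => /andP[a b] /andP[c d].
lra.
Qed.

(* By Jensen's formula [p] is small on few points of the torus of radius [r];
   elsewhere [1 - |phi|^2 = (|p|^2 - |rp|^2) / |p|^2] is small. *)
Lemma rif_mean_defect (e : R) : 0 < e -> exists r0, 0 <= r0 < 1 /\
  forall r, r0 <= r < 1 -> exists N0, forall N (z : C), (N0 <= N)%N -> N.-primitive_root z ->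
  mean (fun q : 'I_N * 'I_N => 1 - nm (phi (tor r z q)) ^+ 2) <= e.
Proof.
move=> e0.
have [c0 [c00 hc0]] := jensen2 rif_den_neq0.
have [M [M0 hM]] := eval2_bounded p.
have [K [K0 hK]] := rif_defect.
pose M1 := 1 + M + c0.
have M10 : 0 < M1 by rewrite /M1; lra.
pose rho := c0 / M1.
have rho0 : 0 < rho by rewrite divr_gt0.
have rho1 : rho < 1 by rewrite ltr_pdivrMr// mul1r /M1; lra.
have e2 : 0 <= 2 / e by rewrite divr_ge0// ltW.
pose L := Num.bound (2 / e).
have hL : 2 / e < L%:R by exact: archi_boundP.
have L0 : (0 < L)%N by rewrite -(ltr0n R); exact: le_lt_trans hL.
have L0' : 0 < L%:R :> R by rewrite ltr0n.
(* Each grid point with $|p|<t$ brings an extra factor $\rho^L$ into a product that is otherwise at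
   most $M_1^{N^2}$. As the product is at least $c_0^{N^2}=(M_1\rho)^{N^2}$, at most $N^2/L$ points
   are that small, and $1/L<e/2$. *)
pose t := M1 * rho ^+ L.
have t0 : 0 < t by rewrite mulr_gt0// exprn_gt0.
(* Chosen so that $K(1-r)/t^2\le e/2$ at the points where $|p|\ge t$. *)
pose d := e / 2 * t ^+ 2 / (K + 1).
have K10 : 0 < K + 1 by rewrite ltr_wpDl.
have d0 : 0 < d by rewrite !divr_gt0// mulr_gt0 ?exprn_gt0// divr_gt0.
exists (Num.max 0 (1 - d)); split.
  by rewrite le_max lexx gt_max ltr01 /= gtrBl.
move=> r /andP[]; rewrite ge_max => /andP[r0 dr] r1.
have r01 : 0 <= r < 1 by rewrite r0.
have r01' : 0 <= r <= 1 by rewrite r0 ltW.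
have [|N0 hN0] := expr_small (e := 1 / 2) r01; first by lra.
exists N0 => N z N0N zP.
have Ngt0 : (0 < N)%N := prim_order_gt0 zP.
have NN0 : 0 < (N * N)%:R :> R by rewrite ltr0n muln_gt0 Ngt0.
pose f (q : 'I_N * 'I_N) := nm (eval2 p (tor r z q)).
pose A := [set q | f q < t]%SET.
have tq (q : 'I_N * 'I_N) : in_torus (z ^+ q.1, z ^+ q.2) by split; rewrite (nm_root zP).
have prodA : \prod_q f q <= M1 ^+ (N * N) * rho ^+ (L * #|A|).
  have -> : M1 ^+ (N * N) * rho ^+ (L * #|A|) =
      \prod_q (M1 * (if q \in A then rho ^+ L else 1)).
    rewrite big_split /= prodr_const card_prod !card_ord; congr (_ * _).
    by rewrite -big_mkcond prodr_const exprM.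
  apply: ler_prod => q _; rewrite nm_ge0 /=; case: ifPn.
    by rewrite inE => /ltW.
  by move=> _; rewrite mulr1 (le_trans (hM _ (dilate_closed r01' (tq q))))// /M1; lra.
have cardA : (L * #|A| <= N * N)%N.
  rewrite -(ler_iXn2l rho0 rho1).
  have := le_trans (hc0 _ _ _ r01 (hN0 _ N0N) zP) prodA.
  by rewrite -ler_pdivrMl ?exprn_gt0// mulrC -exprVn -exprMn.
have defq q : 1 - nm (phi (tor r z q)) ^+ 2 <= (q \in A)%:R + e / 2.
  have [nt1 nt2] := nm_tor zP q r0.
  case: (boolP (q \in A)) => [_|]; last rewrite inE -leNgt => tf.
    by rewrite mulr1n lerBlDr -addrA lerDl addr_ge0 ?sqr_ge0// divr_ge0// ltW.
  rewrite add0r.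
  have fq0 : 0 < f q by exact: lt_le_trans t0 tf.
  have fq20 : 0 < f q ^+ 2 by rewrite exprn_gt0.
  rewrite /rif nmM nmV exprMn exprVn -/(f q).
  rewrite -(ler_pM2r fq20) mulrBl mul1r divfK ?gt_eqF//.
  apply: le_trans (hK _ _ r01' (tq q)) _.
  apply: (@le_trans _ _ (e / 2 * t ^+ 2)); last first.
    by rewrite ler_wpM2l ?divr_ge0 ?(ltW e0)// lerXn2r ?nnegrE ?(ltW t0) ?(ltW fq0).
  have : K * (1 - r) <= (K + 1) * d.
    by rewrite ler_pM ?subr_ge0 ?(ltW r1) ?lerDl// lerBlDr -lerBlDl.
  by rewrite /d mulrC [X in _ <= X]mulrC divfK// gt_eqF.
apply: (@le_trans _ _ (mean (fun q => (q \in A)%:R + e / 2))); first exact: le_mean.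
rewrite meanD mean_cst// [leRHS]splitr lerD2r /mean ler_pdivrMr//.
rewrite -natr_sum -big_mkcond /= sum1_card.
have : #|A|%:R * L%:R <= (N * N)%:R :> R by rewrite -natrM ler_nat mulnC.
rewrite -ler_pdivlMr// => /le_trans; apply.
rewrite mulrC ler_wpM2r ?(ltW NN0)//.
rewrite -[leRHS]invrK lef_pV2 ?posrE ?invr_gt0 ?divr_gt0//.
by rewrite invf_div ltW.
Qed.

End RationalInnerEstimates.

(** * The Hardy space and the model space *)

Section SquareSummable.
Variable R : realType.
Local Notation C := R[i].
Implicit Types (a b x y : nat -> nat -> C) (f g : C * C -> C).

Definition sqsum a N : R := \sum_(j < N) \sum_(k < N) nm (a j k) ^+ 2.

Definition l2seq a : Prop := exists B, forall N, sqsum a N <= B.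

Definition dot a b N : C := \sum_(j < N) \sum_(k < N) a j k * (b j k)^*.

Lemma sum_square_widen (V : zmodType) (F : nat -> nat -> V) n N : (n <= N)%N ->
  \sum_(j < n) \sum_(k < n) F j k =
  \sum_(j < N) \sum_(k < N) (if (j < n)%N && (k < n)%N then F j k else 0).
Proof.
move=> nN; rewrite (big_ord_widen N (fun j => \sum_(k < n) F j k) nN) big_mkcond.
apply: eq_bigr => j _; case: ifP => jn /=; last by rewrite big1.
by rewrite (big_ord_widen N (fun k => F j k) nN) big_mkcond.
Qed.

Lemma sum_square_nd (F : nat -> nat -> R) : (forall j k, 0 <= F j k) ->
  nondecreasing_seq (fun N => \sum_(j < N) \sum_(k < N) F j k).
Proof.
move=> F0 n N nN; rewrite (sum_square_widen F nN).
apply: ler_sum => j _; apply: ler_sum => k _; case: ifP => _ //.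
Qed.

Lemma sqsum_nd a : nondecreasing_seq (sqsum a).
Proof.
apply: (@sum_square_nd (fun j k => nm (a j k) ^+ 2)) => j k.
by rewrite exprn_ge0 ?nm_ge0.
Qed.

Lemma sqsum_ge0 a N : 0 <= sqsum a N.
Proof. by apply: sumr_ge0 => j _; apply: sumr_ge0 => k _; rewrite exprn_ge0 ?nm_ge0. Qed.

Lemma coef_le_sqsum a j k N : (j < N)%N -> (k < N)%N -> nm (a j k) ^+ 2 <= sqsum a N.
Proof.
move=> jN kN; rewrite /sqsum (bigD1 (Ordinal jN))//= (bigD1 (Ordinal kN))//=.
rewrite -addrA lerDl addr_ge0//.
  by apply: sumr_ge0 => i _; rewrite exprn_ge0 ?nm_ge0.
by apply: sumr_ge0 => i _; apply: sumr_ge0 => l _; rewrite exprn_ge0 ?nm_ge0.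
Qed.

Lemma sqsumD a b N : sqsum (fun j k => a j k + b j k) N <= 2 * sqsum a N + 2 * sqsum b N.
Proof.
rewrite /sqsum !mulr_sumr -big_split /=; apply: ler_sum => j _.
rewrite !mulr_sumr -big_split /=; apply: ler_sum => k _; exact: sqr_nmD.
Qed.

Lemma sqsumZ (c : C) a N : sqsum (fun j k => c * a j k) N = nm c ^+ 2 * sqsum a N.
Proof.
rewrite /sqsum mulr_sumr; apply: eq_bigr => j _; rewrite mulr_sumr.
by apply: eq_bigr => k _; rewrite nmM exprMn.
Qed.

Lemma l2seq_lin (c : C) a b : l2seq a -> l2seq b -> l2seq (fun j k => c * a j k + b j k).
Proof.
move=> [A hA] [B hB]; exists (2 * (nm c ^+ 2 * A) + 2 * B) => N.
apply: le_trans (sqsumD _ _ _) _; rewrite sqsumZ lerD ?ler_wpM2l//.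
by rewrite exprn_ge0 ?nm_ge0.
Qed.

Lemma nm_mul_le (u v : C) : nm (u * v^*) <= nm u ^+ 2 + nm v ^+ 2.
Proof.
rewrite nmM nmJ; have := sqr_ge0 (nm u - nm v); have := sqr_ge0 (nm u).
have := sqr_ge0 (nm v); rewrite sqrrB => h1 h2 h3.
nra.
Qed.

(** Termwise $|u\bar v|\le|u|^2+|v|^2$ reduces the tail of an inner product to the tails of two
    convergent nonnegative sums. *)
Lemma dot_tail a b n N : (n <= N)%N ->
  nm (dot a b N - dot a b n) <= (sqsum a N - sqsum a n) + (sqsum b N - sqsum b n).
Proof.
move=> nN; rewrite /dot /sqsum (sum_square_widen (fun j k => a j k * (b j k)^*) nN).
rewrite (sum_square_widen (fun j k => nm (a j k) ^+ 2) nN).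
rewrite (sum_square_widen (fun j k => nm (b j k) ^+ 2) nN) -!sumrB -big_split /=.
apply: le_trans (nm_sum _ _ _) _; apply: ler_sum => j _; rewrite -!sumrB -big_split /=.
apply: le_trans (nm_sum _ _ _) _; apply: ler_sum => k _.
by case: ifP => _; rewrite ?subrr ?nm0 ?addr0// !subr0 nm_mul_le.
Qed.

Lemma cauchyC (u : nat -> C) :
  (forall e, 0 < e -> exists n0, forall n m, (n0 <= n)%N -> (n0 <= m)%N -> nm (u n - u m) <= e) ->
  exists l, cvgC u l.
Proof.
move=> h.
have cR (v : nat -> R) : (forall n m, `|v n - v m| <= nm (u n - u m)) -> cvgn v.
  move=> hv; apply/cauchy_cvgP/cauchy_exP => e e0.
  have [|n0 hn0] := h (e / 2); first by rewrite divr_gt0.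
  exists (v n0); exists n0 => // n /= n0n; rewrite /ball /=.
  rewrite (le_lt_trans (hv _ _))// (le_lt_trans (hn0 _ _ _ n0n))//.
  by rewrite ltr_pdivrMr// ltr_pMr// ltr1n.
have /cR cRe n k : `|complex.Re (u n) - complex.Re (u k)| <= nm (u n - u k).
  by rewrite -raddfB nm_Re.
have /cR cIm n k : `|complex.Im (u n) - complex.Im (u k)| <= nm (u n - u k).
  by rewrite -raddfB nm_Im.
exists (Complex (limn (fun n => complex.Re (u n))) (limn (fun n => complex.Im (u n)))) => e e0.
have e20 : 0 < e / 2 by rewrite divr_gt0.
have /cvgrPdist_le/(_ _ e20)[n1 _ h1] := cRe.
have /cvgrPdist_le/(_ _ e20)[n2 _ h2] := cIm.
exists (maxn n1 n2) => n; rewrite geq_max => /andP[/h1 /= {}h1 /h2 /= {}h2].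
apply: le_trans (nm_ReIm _) _; rewrite [e]splitr; case: (u n) h1 h2 => a b /= h1 h2.
by rewrite lerD// distrC.
Qed.

Lemma l2seq_tail a e : l2seq a -> 0 < e ->
  exists n0, forall n m, (n0 <= n)%N -> sqsum a m - sqsum a n <= e.
Proof. by move=> [B hB] e0; apply: nd_bounded_cauchy hB _ e0; exact: sqsum_nd. Qed.

Lemma dot_cvg a b : l2seq a -> l2seq b -> exists l, cvgC (dot a b) l.
Proof.
move=> ha hb; apply: cauchyC => e e0.
have e20 : 0 < e / 2 by rewrite divr_gt0.
have [n1 h1] := l2seq_tail ha e20; have [n2 h2] := l2seq_tail hb e20.
have main n m : (maxn n1 n2 <= n)%N -> (n <= m)%N -> nm (dot a b m - dot a b n) <= e.
  rewrite geq_max => /andP[l1 l2] nm'; apply: le_trans (dot_tail _ _ nm') _.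
  by rewrite [e]splitr lerD// ?h1// h2.
exists (maxn n1 n2) => n m l1 l2; have [nm'|/ltnW mn] := leqP n m.
  by rewrite nm_distC main.
exact: main.
Qed.

Lemma l2seq_poly_growth a : l2seq a -> poly_growth a.
Proof.
move=> [B hB]; exists (1 + B), 0%N => j k; rewrite expr0 mulr1.
have jm : (j < (maxn j k).+1)%N by rewrite ltnS leq_maxl.
have km : (k < (maxn j k).+1)%N by rewrite ltnS leq_maxr.
have := le_trans (coef_le_sqsum a jm km) (hB _).
have := sqr_ge0 (nm (a j k) - 1); have := nm_ge0 (a j k).
move: (nm _) => t t0 h1 h2; nra.
Qed.

Lemma esum_l2seq a :
  (\esum_(jk in [set: nat * nat]) (nm (a jk.1 jk.2) ^+ 2)%:E < +oo)%E <-> l2seq a.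
Proof.
pose F (jk : nat * nat) : \bar R := (nm (a jk.1 jk.2) ^+ 2)%:E.
have F0 jk : (0 <= F jk)%E by rewrite lee_fin exprn_ge0 ?nm_ge0.
pose box N := [seq (j, k) | j <- iota 0 N, k <- iota 0 N].
have ubox N : uniq (box N).
  by apply: allpairs_uniq; rewrite ?iota_uniq// => -[? ?] [? ?].
have inbox N (x : nat * nat) : (x \in box N) = ((x.1 < N) && (x.2 < N))%N.
  case: x => j k; apply/allpairsPdep/idP => /= [[j' [k' [+ + [-> ->]]]]|/andP[jN kN]].
    by rewrite !mem_iota => /= -> ->.
  by exists j, k; rewrite !mem_iota.
have boxE N : (\sum_(jk \in [set` box N]) F jk = (sqsum a N)%:E)%E.
  rewrite -fsbig_seq// big_allpairs /sqsum -sumEFin -(big_mkord xpredT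
    (fun j => (\sum_(k < N) nm (a j k) ^+ 2)%:E)) /index_iota subn0.
  apply: eq_bigr => j _; rewrite -sumEFin -(big_mkord xpredT
    (fun k => (nm (a j k) ^+ 2)%:E)) /index_iota subn0.
  by [].
split=> [h|[B hB]].
  exists (fine (\esum_(jk in [set: nat * nat]) F jk)%E) => N.
  rewrite -lee_fin fineK; last by rewrite ge0_fin_numE ?esum_ge0.
  rewrite -boxE; apply: ereal_sup_ubound; exists [set` box N] => //.
  by split => //; exact: finite_seq.
apply: (@le_lt_trans _ _ B%:E); last exact: ltry.
apply: ge_ereal_sup => _ [A [finA _] <-].
have /finite_seqP[s As] := finA.
(* A crude side length: every coordinate of a point of [s] is at most the sum of all of them, so the
   box contains the finite set. *)
pose N := (\sum_(x <- s) (x.1 + x.2)).+1.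
apply: (@le_trans _ _ (\sum_(jk \in [set` box N]) F jk)%E); last by rewrite boxE lee_fin.
apply: lee_fsum_nneg_subset => //.
- exact: finite_seq.
- move=> x; rewrite !inE => Ax; rewrite /= inbox !ltnS.
  have xs : x \in s by rewrite As in Ax.
  by rewrite (big_rem x xs) /=; move: (\sum_(_ <- _) _)%N => t; lia.
- by move=> x _; exact: F0.
Qed.

End SquareSummable.

Section HardySpace.
Variable R : realType.
Local Notation C := R[i].
Implicit Types (a b x y : nat -> nat -> C) (f g : C * C -> C).

Lemma nm_realB (x y : R) : nm (x%:C%C - y%:C%C : C) = `|x - y|.
Proof. by rewrite -nm_real rmorphB. Qed.

(** Square-summable coefficients are bounded, so the power series estimates apply to every element
    of the Hardy space. *)
Lemma hardy_coefP f a : hardy_coef f a <-> l2seq a /\ power_series a f.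
Proof.
split=> [[/esum_l2seq la ha]|[la [_ ha]]].
  split=> //; split; first exact: l2seq_poly_growth.
  move=> z z1 z2; apply/cvgCP; apply: ha.
  by split; rewrite norm_lt1.
split; first exact/esum_l2seq.
move=> z [z1 z2]; apply/cvgCP; apply: ha.
  by rewrite -norm_lt1.
by rewrite -norm_lt1.
Qed.

Lemma cvgC_lin (u v : nat -> C) c k l : cvgC u k -> cvgC v l ->
  cvgC (fun n => c * u n + v n) (c * k + l).
Proof.
move=> hu hv e e0; have c1 : 0 < nm c + 1 by rewrite ltr_wpDl// nm_ge0.
have [|n1 h1] := hu (e / 2 / (nm c + 1)); first by rewrite !divr_gt0.
have [|n2 h2] := hv (e / 2); first by rewrite divr_gt0.
exists (maxn n1 n2) => n; rewrite geq_max => /andP[/h1 {}h1 /h2 {}h2].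
have -> : c * u n + v n - (c * k + l) = c * (u n - k) + (v n - l) by ring.
apply: le_trans (nmD _ _) _; rewrite [e]splitr lerD// nmM.
apply: (@le_trans _ _ ((nm c + 1) * (e / 2 / (nm c + 1)))).
  by rewrite ler_pM ?nm_ge0// lerDl.
by rewrite mulrC divfK// gt_eqF.
Qed.

Lemma cvgC_unique (u : nat -> C) k l : cvgC u k -> cvgC u l -> k = l.
Proof.
move=> hk hl; apply/eqP; rewrite -subr_eq0 -nm_eq0 eq_le nm_ge0 andbT.
apply/ler_addgt0Pr => e e0; rewrite add0r.
have [|n1 h1] := hk (e / 2); first by rewrite divr_gt0.
have [|n2 h2] := hl (e / 2); first by rewrite divr_gt0.
have -> : k - l = (u (maxn n1 n2) - l) - (u (maxn n1 n2) - k) by ring.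
by rewrite (le_trans (nmB _ _))// [e]splitr lerD ?h1 ?h2 ?leq_maxl ?leq_maxr.
Qed.

Lemma psum_lin (c : C) a b N z :
  psum (fun j k => c * a j k + b j k) N z = c * psum a N z + psum b N z.
Proof.
rewrite /psum mulr_sumr -big_split /=; apply: eq_bigr => j _.
rewrite mulr_sumr -big_split /=; apply: eq_bigr => k _; ring.
Qed.

Lemma poly_growth_lin (c : C) a b : poly_growth a -> poly_growth b ->
  poly_growth (fun j k => c * a j k + b j k).
Proof.
move=> /poly_growth_ge0[A [d [A0 hA]]] /poly_growth_ge0[B [d' [B0 hB]]].
exists (nm c * A + B), (maxn d d') => j k.
rewrite (le_trans (nmD _ _))// mulrDl nmM -mulrA.
have h1 : 1 <= j.+1%:R * k.+1%:R :> R by rewrite -natrM ler1n.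
rewrite lerD ?ler_wpM2l ?nm_ge0//.
  by rewrite (le_trans (hA _ _))// ler_wpM2l// ler_weXn2l// leq_maxl.
by rewrite (le_trans (hB _ _))// ler_wpM2l// ler_weXn2l// leq_maxr.
Qed.

Lemma power_series_lin (c : C) a b f g : power_series a f -> power_series b g ->
  power_series (fun j k => c * a j k + b j k) (fun z => c * f z + g z).
Proof.
move=> [ga ha] [gb hb]; split; first exact: poly_growth_lin.
move=> z z1 z2 e e0; have [n0 h] := cvgC_lin c (ha z z1 z2) (hb z z1 z2) e0.
by exists n0 => n /h; rewrite psum_lin.
Qed.

Definition rsqsum (r : R) a N : R :=
  \sum_(j < N) \sum_(k < N) nm (a j k) ^+ 2 * r ^+ (2 * (j + k)).

Lemma rdot_rsqsum r a N : rdot r a a N = (rsqsum r a N)%:C%C.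
Proof.
rewrite /rdot /rsqsum rmorph_sum; apply: eq_bigr => j _.
by rewrite rmorph_sum; apply: eq_bigr => k _; rewrite rmorphM /= sqr_nm_conj.
Qed.

Lemma rsqsum_nd r a : 0 <= r -> nondecreasing_seq (rsqsum r a).
Proof.
move=> r0; apply: (@sum_square_nd _ (fun j k => nm (a j k) ^+ 2 * r ^+ (2 * (j + k)))) => j k.
by rewrite mulr_ge0 ?exprn_ge0 ?nm_ge0.
Qed.

Lemma rsqsum_le r a N : 0 <= r <= 1 -> rsqsum r a N <= sqsum a N.
Proof.
case/andP=> r0 r1; apply: ler_sum => j _; apply: ler_sum => k _.
by rewrite ler_piMr ?exprn_ge0 ?nm_ge0 ?exprn_ile1.
Qed.

Lemma coef_le_rsqsum r a j k N : 0 <= r -> (j < N)%N -> (k < N)%N ->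
  nm (a j k) ^+ 2 * r ^+ (2 * (j + k)) <= rsqsum r a N.
Proof.
move=> r0 jN kN; rewrite /rsqsum (bigD1 (Ordinal jN))//= (bigD1 (Ordinal kN))//=.
rewrite -addrA lerDl addr_ge0//.
  by apply: sumr_ge0 => i _; rewrite mulr_ge0 ?exprn_ge0 ?nm_ge0.
by apply: sumr_ge0 => i _; apply: sumr_ge0 => l _; rewrite mulr_ge0 ?exprn_ge0 ?nm_ge0.
Qed.

(* Letting the order of the roots of unity go to infinity in [mean_dot_approx] *)
Lemma rsqsum_le_mean a f r K : power_series a f -> 0 <= r < 1 ->
  (exists N0, forall N (z : C), (N0 <= N)%N -> N.-primitive_root z ->
    mean (fun q : 'I_N * 'I_N => nm (f (tor r z q)) ^+ 2) <= K) ->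
  forall M, rsqsum r a M <= K.
Proof.
move=> hf r01 [N0 hK] M; have /andP[r0 r1] := r01.
apply/ler_addgt0Pr => e e0.
have [N1 h1] := mean_dot_approx hf hf r01 e0.
pose N := maxn M.+1 (maxn N0 N1).
have N_gt0 : (0 < N)%N by rewrite leq_max.
have [z zP] := prim_root_exists R N_gt0.
have := h1 N z _ zP; rewrite !leq_max leqnn !orbT => /(_ isT).
rewrite rdot_rsqsum; under eq_mean do rewrite -sqr_nm_conj.
rewrite -mean_real nm_realB ler_norml => /andP[h _].
have /le_trans : rsqsum r a M <= rsqsum r a N.
  by apply: rsqsum_nd => //; rewrite leq_max leqW.
apply.
have := hK N z _ zP; rewrite !leq_max leqnn orbT /= => /(_ isT).
move: (mean _) (rsqsum r a N) h => u v h1' h2; lra.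
Qed.

(** Parseval on the torus of radius $1/2$: the grid means vanish, and they dominate each weighted
    $|a_{jk}|^2$. *)
Lemma power_series_eq0 a f : power_series a f ->
  (forall z, nm z.1 < 1 -> nm z.2 < 1 -> f z = 0) -> forall j k, a j k = 0.
Proof.
move=> hf f0 j k; pose r : R := 1 / 2.
have r01 : 0 <= r < 1 by rewrite /r; lra.
have /andP[r0 r1] := r01.
have h : rsqsum r a (maxn j k).+1 <= 0.
  apply: rsqsum_le_mean hf r01 _ _; exists 1%N => N z N0 zP.
  under eq_mean => q.
    have [t1 t2] := nm_tor zP q r0.
    rewrite f0 ?t1 ?t2// nm0 expr0n.
    over.
  by rewrite mean_cst.
have jm : (j < (maxn j k).+1)%N by rewrite ltnS leq_maxl.
have km : (k < (maxn j k).+1)%N by rewrite ltnS leq_maxr.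
have := le_trans (coef_le_rsqsum a r0 jm km) h.
have rp : 0 < r ^+ (2 * (j + k)) by rewrite exprn_gt0// /r; lra.
rewrite pmulr_lle0// => h2; apply/eqP; rewrite -nm_eq0 -sqrf_eq0 eq_le h2.
by rewrite exprn_ge0 ?nm_ge0.
Qed.

Lemma power_series_unique a b f : power_series a f -> power_series b f ->
  forall j k, a j k = b j k.
Proof.
move=> ha hb j k; have := power_series_lin (-1) ha hb.
move=> /power_series_eq0 h; have : -1 * a j k + b j k = 0.
  by apply: h => z _ _; rewrite mulN1r addNr.
by rewrite mulN1r addrC => /subr0_eq.
Qed.

(** Uniqueness of the coefficients makes the choice inside [taylor] return the given family. *)
Lemma taylor_coef f a : hardy_coef f a -> taylor f = a.
Proof.
move=> fa; rewrite /taylor; case: xgetP => [b -> /=|h]; last by have := h a fa.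
move=> fb; apply/funext => j; apply/funext => k.
have [_ h1] := (hardy_coefP _ _).1 fb; have [_ h2] := (hardy_coefP _ _).1 fa.
exact: power_series_unique h1 h2 j k.
Qed.

Lemma hardy_dotE f g a b : hardy_coef f a -> hardy_coef g b ->
  cvgC (dot a b) (hardy_dot f g).
Proof.
move=> /[dup] fa /hardy_coefP[la _] /[dup] gb /hardy_coefP[lb _].
rewrite /hardy_dot (taylor_coef fa) (taylor_coef gb).
have [l hl] := dot_cvg la lb.
suff -> : lim (dot a b n @[n --> \oo]) = l by [].
by apply: cvg_lim; [exact: norm_hausdorff|apply/cvgCP].
Qed.

Lemma dot_sqsum a N : dot a a N = (sqsum a N)%:C%C.
Proof.
rewrite /dot /sqsum rmorph_sum; apply: eq_bigr => j _.
by rewrite rmorph_sum; apply: eq_bigr => k _; rewrite -sqr_nm_conj.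
Qed.

(** The squared norm is the least upper bound of the square partial sums. This form avoids the limit
    in [hardy_dot] in all later comparisons. *)
Lemma hardy_normE f a : hardy_coef f a ->
  (forall N, sqsum a N <= hardy_norm f ^+ 2) /\
  (forall B, (forall N, sqsum a N <= B) -> hardy_norm f ^+ 2 <= B).
Proof.
move=> fa; have := hardy_dotE fa fa; set l := hardy_dot f f => hl.
have hR e : 0 < e -> exists n0, forall n, (n0 <= n)%N -> `|sqsum a n - complex.Re l| <= e.
  move=> e0; have [n0 h] := hl e e0; exists n0 => n /h; rewrite dot_sqsum.
  by apply: le_trans; apply: le_trans (nm_Re _); rewrite raddfB.
have le1 N : sqsum a N <= complex.Re l.
  apply/ler_addgt0Pr => e e0; have [n0 h] := hR e e0.
  have := h (maxn n0 N) (leq_maxl _ _); rewrite ler_norml => /andP[_].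
  rewrite lerBlDr addrC; apply: le_trans; apply: sqsum_nd; exact: leq_maxr.
have l0 : 0 <= complex.Re l by rewrite (le_trans _ (le1 0%N))// sqsum_ge0.
rewrite /hardy_norm sqr_sqrtr//; split=> // B hB.
apply/ler_addgt0Pr => e e0; have [n0 h] := hR e e0.
have := h n0 (leqnn _); rewrite ler_norml => /andP[+ _].
have := hB n0; move: (sqsum _ _) => s; lra.
Qed.

End HardySpace.

(** * Completeness of the space of square-summable double sequences *)

Section Completeness.
Variable R : realType.
Local Notation C := R[i].
Implicit Types (a b u v x y : nat -> nat -> C) (f g h : C * C -> C).

Lemma one_sub_expr_le (r : R) k : 0 <= r <= 1 -> 1 - r ^+ k <= k%:R * (1 - r).
Proof.
case/andP=> r0 r1; elim: k => [|k IH]; first by rewrite expr0 subrr mul0r.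
have -> : 1 - r ^+ k.+1 = (1 - r) + r * (1 - r ^+ k) by rewrite exprS; ring.
have -> : k.+1%:R * (1 - r) = (1 - r) + k%:R * (1 - r) by rewrite -natr1; ring.
by rewrite lerD2l (le_trans _ IH)// ler_piMl// subr_ge0 exprn_ile1.
Qed.

(** With [M] fixed the exponents $2(j+k)$ stay below $4M$, so dilation changes the sum by at most
    $4M(1-r)$ times itself, and $r$ tends to $1$. *)
Lemma sqsum_le_rsqsum a M K : (forall r, 0 <= r < 1 -> rsqsum r a M <= K) -> sqsum a M <= K.
Proof.
move=> h; apply/ler_addgt0Pr => e e0.
pose D : R := (4 * M)%:R * sqsum a M + 1.
have D1 : 1 <= D by rewrite lerDr mulr_ge0// sqsum_ge0.
pose r := Num.max 0 (1 - e / D).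
have D0 : 0 < D by rewrite (lt_le_trans ltr01).
have r01 : 0 <= r < 1 by rewrite le_max lexx gt_max ltr01 /= gtrBl divr_gt0.
have /andP[r0 r1] := r01.
have r01' : 0 <= r <= 1 by rewrite r0 ltW.
have rl : 1 - r <= e / D by rewrite lerBlDr -lerBlDl le_max lexx orbT.
apply: (@le_trans _ _ (rsqsum r a M + (4 * M)%:R * (1 - r) * sqsum a M)).
  rewrite /sqsum /rsqsum mulr_sumr -big_split /=; apply: ler_sum => j _.
  rewrite mulr_sumr -big_split /=; apply: ler_sum => k _.
  rewrite [X in _ + X]mulrC -mulrDr ler_peMr ?exprn_ge0 ?nm_ge0//.
  rewrite -lerBlDl (le_trans (one_sub_expr_le _ r01'))//.
  rewrite ler_wpM2r ?subr_ge0 ?(ltW r1)// ler_nat.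
  have := ltn_ord j; have := ltn_ord k; lia.
rewrite lerD ?h// mulrAC mulrC (le_trans (ler_wpM2r _ rl))//.
  by rewrite mulr_ge0// sqsum_ge0.
by rewrite mulrAC ler_pdivrMr// ler_wpM2l ?(ltW e0)// lerDl.
Qed.

(** Weighted arithmetic-geometric mean inequality. The free weight [s] replaces Cauchy-Schwarz when
    one factor is small and the other only bounded. *)
Lemma dot_le_scaled u v N s : 0 < s -> nm (dot u v N) <= s * sqsum u N + s^-1 * sqsum v N.
Proof.
move=> s0; rewrite /dot /sqsum !mulr_sumr -big_split /=.
apply: le_trans (nm_sum _ _ _) _; apply: ler_sum => j _.
rewrite !mulr_sumr -big_split /=.
apply: le_trans (nm_sum _ _ _) _; apply: ler_sum => k _.
rewrite nmM nmJ; move: (nm (u j k)) (nm (v j k)) (nm_ge0 (u j k)) (nm_ge0 (v j k)) => p q p0 q0.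
have : 0 <= s^-1 * (s * p - q) ^+ 2 by rewrite mulr_ge0 ?sqr_ge0// invr_ge0 ltW.
have -> : s^-1 * (s * p - q) ^+ 2 = s * p ^+ 2 + s^-1 * q ^+ 2 - p * q *+ 2.
  by field; rewrite gt_eqF.
rewrite subr_ge0 => /(le_trans _); apply; rewrite mulr2n lerDr.
exact: mulr_ge0.
Qed.

Lemma dot_lin (c : C) a b y N :
  dot (fun j k => c * a j k + b j k) y N = c * dot a y N + dot b y N.
Proof.
rewrite /dot mulr_sumr -big_split /=; apply: eq_bigr => j _.
rewrite mulr_sumr -big_split /=; apply: eq_bigr => k _; ring.
Qed.

Lemma sqsum_lim (x : nat -> nat -> nat -> C) a b N K :
  (forall j k, cvgC (fun m => x m j k) (a j k)) ->
  (exists m0, forall m, (m0 <= m)%N -> sqsum (fun j k => x m j k - b j k) N <= K) ->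
  sqsum (fun j k => a j k - b j k) N <= 2 * K.
Proof.
move=> hx [m0 hK]; apply/ler_addgt0Pr => e e0.
have [m [m0m hm]] : exists m, (m0 <= m)%N /\ sqsum (fun j k => a j k - x m j k) N <= e / 2.
  pose d := e / 2 / (N * N).+1%:R.
  have d0 : 0 < d by rewrite !divr_gt0.
  have hs : 0 < Num.sqrt d by rewrite sqrtr_gt0.
  have [M hM] := choice (fun jk : nat * nat => hx jk.1 jk.2 _ hs).
  (* The sum of the indices needed at the $N^2$ coordinates dominates each of them. *)
  exists (maxn m0 (\sum_(j < N) \sum_(k < N) M (nat_of_ord j, nat_of_ord k)))%N; split.
    exact: leq_maxl.
  set m := maxn _ _.
  apply: (@le_trans _ _ (\sum_(j < N) \sum_(k < N) d)).
    apply: ler_sum => j _; apply: ler_sum => k _.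
    rewrite -[leRHS]sqr_sqrtr ?(ltW d0)// lerXn2r ?nnegrE ?nm_ge0 ?sqrtr_ge0//.
    rewrite nm_distC; apply: (hM (nat_of_ord j, nat_of_ord k)).
    rewrite (leq_trans _ (leq_maxr _ _))//.
    rewrite (bigD1 j)//= (bigD1 k)//= -addnA leq_addr//.
  rewrite !sumr_const card_ord -mulrnA -[leLHS]mulr_natr /d mulrAC ler_pdivrMr//.
  by rewrite ler_wpM2l ?divr_ge0 ?(ltW e0)// ler_nat leqnSn.
have -> : (fun j k => a j k - b j k) = (fun j k => (x m j k - b j k) + (a j k - x m j k)).
  by apply/funext => j; apply/funext => k; ring.
apply: le_trans (sqsumD _ _ _) _; rewrite lerD//; first by rewrite ler_wpM2l// hK.
by rewrite -ler_pdivlMl// mulrC.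
Qed.

Lemma l2seq_complete (x : nat -> nat -> nat -> C) :
  (forall n, l2seq (x n)) ->
  (forall e, 0 < e -> exists n0, forall n m, (n0 <= n)%N -> (n0 <= m)%N ->
     forall N, sqsum (fun j k => x n j k - x m j k) N <= e) ->
  exists2 a, l2seq a & forall e, 0 < e -> exists n0, forall n, (n0 <= n)%N ->
     forall N, sqsum (fun j k => a j k - x n j k) N <= e.
Proof.
move=> lx cx.
have cp (jk : nat * nat) : exists l, cvgC (fun n => x n jk.1 jk.2) l.
  apply: cauchyC => e e0; have [|n0 h] := cx (e ^+ 2); first by rewrite exprn_gt0.
  exists n0 => n m n0n n0m; have := h n m n0n n0m (maxn jk.1 jk.2).+1.
  have jm : (jk.1 < (maxn jk.1 jk.2).+1)%N by rewrite ltnS leq_maxl.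
  have km : (jk.2 < (maxn jk.1 jk.2).+1)%N by rewrite ltnS leq_maxr.
  move/(le_trans (coef_le_sqsum (fun j k => x n j k - x m j k) jm km)).
  by rewrite ler_sqr ?nnegrE ?nm_ge0 ?(ltW e0).
have [l hl] := choice cp; pose a j k := l (j, k).
have ha j k : cvgC (fun n => x n j k) (a j k) by exact: (hl (j, k)).
have conva e : 0 < e -> exists n0, forall n, (n0 <= n)%N ->
     forall N, sqsum (fun j k => a j k - x n j k) N <= e.
  move=> e0; have [|n0 h] := cx (e / 2); first by rewrite divr_gt0.
  exists n0 => n n0n N; have -> : e = 2 * (e / 2) by rewrite mulrC divfK.
  by apply: (sqsum_lim ha); exists n0 => m n0m; exact: h.
exists a => //.
have [n0 h] := conva 1 ltr01; have [B hB] := lx n0.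
exists (2 * 1 + 2 * B) => N.
have -> : a = (fun j k => (a j k - x n0 j k) + x n0 j k).
  by apply/funext => j; apply/funext => k; rewrite subrK.
by apply: le_trans (sqsumD _ _ _) _; rewrite lerD// ler_wpM2l// h.
Qed.

Lemma power_series_exists a : poly_growth a -> exists f, power_series a f.
Proof.
move=> ga.
have h (z : C * C) : exists l, nm z.1 < 1 -> nm z.2 < 1 -> cvgC (fun n => psum a n z) l.
  have [/andP[z1 z2]|/negP nz] := boolP ((nm z.1 < 1) && (nm z.2 < 1)); last first.
    by exists 0 => z1 z2; case: nz; rewrite z1 z2.
  suff [l hl] : exists l, cvgC (fun n => psum a n z) l by exists l.
  apply: cauchyC => e e0.
  have /poly_growth_ge0[B [d [B0 hB]]] := ga.
  pose r := Num.max (nm z.1) (nm z.2).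
  have r01 : 0 <= r < 1 by rewrite le_max nm_ge0 /= gt_max z1 z2.
  have [n0 hn0] := tail_small (B + B) d r01 e0; exists n0 => n m n0n n0m.
  rewrite -!eval2_trunc -eval2B; apply: (hn0 n0) => //.
  - by rewrite le_max lexx.
  - by rewrite le_max lexx orbT.
  - move=> j k; rewrite !coefB !coef_trunc (le_trans (nmB _ _))// mulrDl.
    by rewrite lerD// nm_if.
  - move=> j k jn kn; rewrite !coefB !coef_trunc.
    by rewrite !(leq_trans jn) ?(leq_trans kn)// subrr.
by have [f hf] := choice h; exists f; split.
Qed.

End Completeness.

Section DilatedDot.
Variable R : realType.
Local Notation C := R[i].
Implicit Types (a b u v x y : nat -> nat -> C) (f g h : C * C -> C).

Lemma one_sub_sqr_nm (v : C) : (1 - nm v ^+ 2)%:C%C = 1 - v * v^*.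
Proof.
have -> : (1 - nm v ^+ 2)%:C%C = 1 - (nm v ^+ 2)%:C%C :> C by rewrite rmorphB rmorph1.
by rewrite sqr_nm_conj.
Qed.

Lemma rdot_tail a b (r : R) n N : 0 <= r <= 1 -> (n <= N)%N ->
  nm (rdot r a b N - rdot r a b n) <= (sqsum a N - sqsum a n) + (sqsum b N - sqsum b n).
Proof.
case/andP=> r0 r1 nN.
pose G j k := a j k * (b j k)^* * (r ^+ (2 * (j + k)))%:C%C.
have E M : rdot r a b M = \sum_(j < M) \sum_(k < M) G j k by [].
rewrite !E /sqsum (sum_square_widen G nN).
rewrite (sum_square_widen (fun j k => nm (a j k) ^+ 2) nN).
rewrite (sum_square_widen (fun j k => nm (b j k) ^+ 2) nN) -!sumrB -big_split /=.
apply: le_trans (nm_sum _ _ _) _; apply: ler_sum => j _; rewrite -!sumrB -big_split /=.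
apply: le_trans (nm_sum _ _ _) _; apply: ler_sum => k _.
case: ifP => _; rewrite ?subrr ?nm0 ?addr0// !subr0 /G nmM nm_real.
rewrite (le_trans _ (nm_mul_le _ _))// ler_piMr ?nm_ge0//.
by rewrite ger0_norm ?exprn_ge0// exprn_ile1.
Qed.

Lemma rdot_sub_dot a b (r : R) n : 0 <= r <= 1 ->
  nm (rdot r a b n - dot a b n) <= (4 * n)%:R * (1 - r) * (sqsum a n + sqsum b n).
Proof.
move=> /[dup] r01 /andP[r0 r1].
rewrite /rdot /dot /sqsum -sumrB -big_split mulr_sumr /=.
apply: le_trans (nm_sum _ _ _) _; apply: ler_sum => j _; rewrite -!sumrB -big_split mulr_sumr /=.
apply: le_trans (nm_sum _ _ _) _; apply: ler_sum => k _.
rewrite -[X in _ - X]mulr1 -mulrBr nmM mulrC.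
have -> : (r ^+ (2 * (j + k)))%:C%C - 1 = (r ^+ (2 * (j + k)) - 1)%:C%C :> C.
  by rewrite rmorphB rmorph1.
rewrite nm_real distrC ger0_norm ?subr_ge0 ?exprn_ile1//.
apply: ler_pM; rewrite ?nm_ge0 ?subr_ge0 ?exprn_ile1 ?nm_mul_le//.
rewrite (le_trans (one_sub_expr_le _ r01))// ler_wpM2r ?subr_ge0// ler_nat.
have := ltn_ord j; have := ltn_ord k; lia.
Qed.

(** The tail beyond the [n]-square is small uniformly in [r], and inside it dilation costs $O(1-r)$.
    Thus the thresholds for [r] and for [N] are independent, and several such approximations can be
    used at a common [r] and [N]. *)
Lemma rdot_approx a b l e : l2seq a -> l2seq b -> cvgC (dot a b) l -> 0 < e ->
  exists r0 N0, 0 <= r0 < 1 /\ forall r N, r0 <= r < 1 -> (N0 <= N)%N ->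
    nm (rdot r a b N - l) <= e.
Proof.
move=> la lb hl e0.
have e40 : 0 < e / 4 by rewrite divr_gt0.
have [n1 h1] := l2seq_tail la e40; have [n2 h2] := l2seq_tail lb e40.
have [n3 h3] := hl _ e40.
pose n := maxn n1 (maxn n2 n3).
pose D : R := (4 * n)%:R * (sqsum a n + sqsum b n) + 1.
have D1 : 1 <= D by rewrite lerDr mulr_ge0// addr_ge0// sqsum_ge0.
have D0 : 0 < D by rewrite (lt_le_trans ltr01).
exists (Num.max 0 (1 - e / 4 / D)), n; split.
  by rewrite le_max lexx gt_max ltr01 /= gtrBl divr_gt0.
move=> r N /andP[]; rewrite ge_max => /andP[r0 rD] r1 nN.
have r01 : 0 <= r <= 1 by rewrite r0 ltW.
have -> : rdot r a b N - l = (rdot r a b N - rdot r a b n) +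
  ((rdot r a b n - dot a b n) + (dot a b n - l)) by ring.
apply: le_trans (nmD _ _) _.
have -> : e = (e / 4 + e / 4) + (e / 4 + e / 4) by field.
apply: lerD.
  apply: le_trans (rdot_tail _ _ r01 nN) _.
  by rewrite lerD ?h1 ?h2// !leq_max leqnn ?orbT.
apply: le_trans (nmD _ _) _; apply: lerD; last by apply: h3; rewrite !leq_max leqnn !orbT.
apply: le_trans (rdot_sub_dot _ _ _ r01) _.
apply: (@le_trans _ _ ((1 - r) * D)).
  rewrite mulrAC mulrC ler_wpM2l ?subr_ge0 ?(ltW r1)// lerDl.
  exact: ler01.
by rewrite -ler_pdivlMr// lerBlDr -lerBlDl.
Qed.

Lemma mean_sq_le a f (r B e : R) : power_series a f -> (forall N, sqsum a N <= B) ->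
  0 <= r < 1 -> 0 < e -> exists N0, forall N (z : C), (N0 <= N)%N -> N.-primitive_root z ->
  mean (fun q : 'I_N * 'I_N => nm (f (tor r z q)) ^+ 2) <= B + e.
Proof.
move=> hf hB /[dup] r01 /andP[r0 r1] e0.
have [N0 h] := mean_dot_approx hf hf r01 e0; exists N0 => N z N0N zP.
have := h N z N0N zP; rewrite rdot_rsqsum; under eq_mean do rewrite -sqr_nm_conj.
rewrite -mean_real nm_realB ler_norml lerBlDl => /andP[_] /le_trans; apply.
rewrite lerD2r (le_trans _ (hB N))// rsqsum_le// r0.
exact: ltW.
Qed.

End DilatedDot.

(** * Multiplication by an inner function as an isometry *)

Section InnerMultiplier.
Variable R : realType.
Local Notation C := R[i].
Variables (m n : nat) (p : {poly {poly C}}).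
Hypothesis hp : rif_denominator m n p.
Local Notation phi := (rif m n p).
Hypothesis phi_le1 : forall z : C * C, nm z.1 < 1 -> nm z.2 < 1 -> nm (phi z) <= 1.
Variable c : nat -> nat -> C.
Hypothesis hc : power_series c phi.
Implicit Types (a b : nat -> nat -> C) (f g h : C * C -> C).

(** On each grid $|\phi h|\le|h|$, and grid means determine the dilated square sums up to an error
    that tends to zero. *)
Lemma inner_mul_l2 b h B : power_series b h -> (forall N, sqsum b N <= B) ->
  forall N, sqsum (conv c b) N <= B.
Proof.
move=> hb hB N; apply: sqsum_le_rsqsum => r r01; apply/ler_addgt0Pr => e e0.
apply: (rsqsum_le_mean (power_series_mul hc hb) r01).
have [N0 h0] := mean_sq_le hb hB r01 e0; exists N0 => M z MN zP.
apply: le_trans (h0 M z MN zP); apply: le_mean => q.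
have /andP[r0 r1] := r01; have [t1 t2] := nm_tor zP q r0.
rewrite nmM exprMn ler_piMl ?exprn_ge0 ?nm_ge0// exprn_ile1 ?nm_ge0// phi_le1 ?t1 ?t2//.
Qed.

(** The two grid means differ by the mean of $f(1-|\phi|^2)\bar h$. With [f] bounded, [h] of bounded
    mean square and $1-|\phi|^2$ of small mean, this tends to zero; in the application [f] is a
    Cauchy kernel, so the bound on [f] is available. *)
Lemma inner_mul_dot a f b h K l : l2seq a -> power_series a f -> l2seq b -> power_series b h ->
  (forall z, nm z.1 < 1 -> nm z.2 < 1 -> nm (f z) <= K) ->
  cvgC (dot a b) l -> cvgC (dot (conv c a) (conv c b)) l.
Proof.
move=> la hf lb hh fK hl.
have [A hA] := la; have [B hB] := lb.
have lx : l2seq (conv c a) by exists A; exact: inner_mul_l2 hf hA.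
have ly : l2seq (conv c b) by exists B; exact: inner_mul_l2 hh hB.
have hx := power_series_mul hc hf; have hy := power_series_mul hc hh.
have [l' hl'] := dot_cvg lx ly.
suff -> : l = l' by [].
apply/eqP; rewrite -subr_eq0 -nm_eq0 eq_le nm_ge0 andbT.
apply/ler_addgt0Pr => e e0; rewrite add0r.
have K0 : 0 <= K by apply: le_trans (fK (0, 0) _ _); rewrite ?nm_ge0 ?nm0.
have B0 : 0 <= B by apply: le_trans (hB 0%N); exact: sqsum_ge0.
have e50 : 0 < e / 5 by rewrite divr_gt0.
have [r1 [N1 [/andP[r1ge0 r1lt1] h1]]] := rdot_approx la lb hl e50.
have [r2 [N2 [/andP[r2ge0 r2lt1] h2]]] := rdot_approx lx ly hl' e50.
(* weighted AM-GM: [t |h| <= t / s + s |h|^2] for [0 <= t <= 1] *)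
pose s := e / 10 / (K + 1) / (B + 1).
have K10 : 0 < K + 1 by rewrite ltr_wpDl.
have B10 : 0 < B + 1 by rewrite ltr_wpDl.
have s0 : 0 < s by rewrite !divr_gt0.
have [r3 [/andP[r3ge0 r3lt1] h3]] := rif_mean_defect hp
  (e := s * (e / 10) / (K + 1)) (divr_gt0 (mulr_gt0 s0 (divr_gt0 e0 (ltr0n _ 10))) K10).
pose r := Num.max r1 (Num.max r2 r3).
have rlt1 : r < 1 by rewrite !gt_max r1lt1 r2lt1.
have rge0 : 0 <= r by rewrite le_max r1ge0.
have r01 : 0 <= r < 1 by rewrite rge0.
have r1r : r1 <= r by rewrite le_max lexx.
have r2r : r2 <= r by rewrite !le_max lexx orbT.
have r3r : r3 <= r by rewrite !le_max lexx !orbT.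
have [|N3 h3'] := h3 r; first by rewrite r3r.
have [N4 h4] := mean_dot_approx hf hh r01 e50.
have [N5 h5] := mean_dot_approx hx hy r01 e50.
have [N6 h6] := mean_sq_le hh hB r01 ltr01.
pose N := maxn 1 (maxn N1 (maxn N2 (maxn N3 (maxn N4 (maxn N5 N6))))).
have Ngt0 : (0 < N)%N by rewrite leq_max.
have [z zP] := prim_root_exists R Ngt0.
have := h1 r N; rewrite r1r rlt1 !leq_max leqnn !orbT => /(_ isT isT) {}h1.
have := h2 r N; rewrite r2r rlt1 !leq_max leqnn !orbT => /(_ isT isT) {}h2.
have := h3' N z; rewrite !leq_max leqnn !orbT => /(_ isT zP) {h3 h3'}h3.
have := h4 N z; rewrite !leq_max leqnn !orbT => /(_ isT zP) {}h4.
have := h5 N z; rewrite !leq_max leqnn !orbT => /(_ isT zP) {}h5.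
have := h6 N z; rewrite !leq_max leqnn !orbT => /(_ isT zP) {}h6.
set M1 := mean _ in h4; set M2 := mean _ in h5.
have h7 : nm (M1 - M2) <= e / 5.
  rewrite /M1 /M2 -meanB; apply: le_trans (nm_mean _) _.
  apply: (@le_trans _ _ (mean (fun q : 'I_N * 'I_N =>
      K * (s^-1 * (1 - nm (phi (tor r z q)) ^+ 2) + s * nm (h (tor r z q)) ^+ 2)))).
    apply: le_mean => q; have [t1 t2] := nm_tor zP q rge0.
    set w := tor r z q; rewrite -/w in t1 t2.
    have w1 : nm w.1 < 1 by rewrite t1.
    have w2 : nm w.2 < 1 by rewrite t2.
    have -> : f w * (h w)^* - phi w * f w * (phi w * h w)^* =
      f w * ((1 - nm (phi w) ^+ 2)%:C%C * (h w)^*).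
      by rewrite one_sub_sqr_nm rmorphM /=; ring.
    rewrite nmM; apply: ler_pM; rewrite ?nm_ge0 ?fK//.
    rewrite nmM nmJ nm_real.
    have t0 : 0 <= 1 - nm (phi w) ^+ 2 by rewrite subr_ge0 exprn_ile1 ?nm_ge0// phi_le1.
    have tle : 1 - nm (phi w) ^+ 2 <= 1 by rewrite gerBl sqr_ge0.
    rewrite ger0_norm//; move: (1 - _) (nm (h w)) (nm_ge0 (h w)) t0 tle => t q0 q00 t0 tle.
    have : 0 <= s^-1 * (t - s * q0) ^+ 2 by rewrite mulr_ge0 ?sqr_ge0// invr_ge0 ltW.
    have -> : s^-1 * (t - s * q0) ^+ 2 = s^-1 * t ^+ 2 + s * q0 ^+ 2 - t * q0 *+ 2.
      by field; rewrite gt_eqF.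
    rewrite subr_ge0 mulr2n => hh'.
    apply: (@le_trans _ _ (t * q0 + t * q0)); first by rewrite lerDl mulr_ge0.
    apply: le_trans hh' _; rewrite lerD2r ler_wpM2l ?invr_ge0 ?(ltW s0)//.
    by rewrite expr2 ler_piMl.
  rewrite meanZ meanD !meanZ.
  have : K * (s^-1 * mean (fun q : 'I_N * 'I_N => 1 - nm (phi (tor r z q)) ^+ 2) +
      s * mean (fun q : 'I_N * 'I_N => nm (h (tor r z q)) ^+ 2)) <=
      (K + 1) * (s^-1 * (s * (e / 10) / (K + 1)) + s * (B + 1)).
    apply: ler_pM => //; last by rewrite lerD// ler_wpM2l ?invr_ge0 ?(ltW s0).
      have s1 : 0 <= s^-1 by rewrite invr_ge0 ltW.
      apply: addr_ge0; apply: mulr_ge0 => //; [|exact: ltW|]; apply: mean_ge0 => q.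
        have [t1 t2] := nm_tor zP q rge0.
        by rewrite subr_ge0 exprn_ile1 ?nm_ge0// phi_le1 ?t1 ?t2.
      exact: sqr_ge0.
    by rewrite lerDl.
  move/le_trans; apply; rewrite le_eqVlt; apply/orP; left; apply/eqP.
  by rewrite /s; field; rewrite !gt_eqF.
have -> : l - l' = - (rdot r a b N - l) - (M1 - rdot r a b N) + (M1 - M2)
  + (M2 - rdot r (conv c a) (conv c b) N) + (rdot r (conv c a) (conv c b) N - l') by ring.
have -> : e = e / 5 + e / 5 + e / 5 + e / 5 + e / 5 by field.
apply: le_trans (nmD _ _) (lerD _ h2).
apply: le_trans (nmD _ _) (lerD _ h5).
apply: le_trans (nmD _ _) (lerD _ h7).
apply: le_trans (nmB _ _) (lerD _ h4).
by rewrite nmN.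
Qed.

End InnerMultiplier.

Section CauchyKernel.
Variable R : realType.
Local Notation C := R[i].
Implicit Types (a b : nat -> nat -> C) (f g h : C * C -> C) (w z : C * C).

Definition kernel_coef w : nat -> nat -> C := fun j k => (w.1^*) ^+ j * (w.2^*) ^+ k.

Lemma nm_lt1_neq1 (x : C) : nm x < 1 -> 1 - x != 0.
Proof.
move=> x1; apply/eqP => /subr0_eq/(congr1 nm); rewrite nm1 => h.
by rewrite -h ltxx in x1.
Qed.

Lemma geometric_cvg (x : C) : nm x < 1 -> cvgC (fun n => \sum_(j < n) x ^+ j) (1 - x)^-1.
Proof.
move=> x1 e e0; have x0 := nm_lt1_neq1 x1.
have nx0 : 0 < nm (1 - x) by rewrite nm_gt0.
have [||n0 h] := @expr_small R (nm x) (e * nm (1 - x)).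
- by rewrite nm_ge0.
- by rewrite mulr_gt0.
exists n0 => n /h {}h; rewrite -(ler_pM2r nx0) -nmM mulrBl mulVf//.
have -> : (\sum_(j < n) x ^+ j) * (1 - x) = 1 - x ^+ n.
  by rewrite mulrC -[X in X * _]opprB mulNr -subrX1 opprB.
by rewrite addrAC subrr sub0r nmN nmX.
Qed.

Lemma psum_prod (u v : nat -> C) (z : C * C) n :
  psum (fun j k => u j * v k) n z = (\sum_(j < n) u j * z.1 ^+ j) * (\sum_(k < n) v k * z.2 ^+ k).
Proof.
rewrite mulr_suml; apply: eq_bigr => j _; rewrite mulr_sumr; apply: eq_bigr => k _; ring.
Qed.

Lemma kernel_power_series w : nm w.1 < 1 -> nm w.2 < 1 ->
  power_series (kernel_coef w) (cauchy_kernel w).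
Proof.
move=> w1 w2; split.
  exists 1, 0%N => j k; rewrite expr0 mulr1 nmM !nmX !nmJ.
  by rewrite mulr_ile1 ?exprn_ge0 ?exprn_ile1 ?nm_ge0// ltW.
move=> z z1 z2.
have q1 : nm (z.1 * w.1^*) < 1 by rewrite nmM nmJ mulr_ilt1 ?nm_ge0.
have q2 : nm (z.2 * w.2^*) < 1 by rewrite nmM nmJ mulr_ilt1 ?nm_ge0.
have := cvgCM (geometric_cvg q1) (geometric_cvg q2).
rewrite /cauchy_kernel => h e e0; have [n0 hn] := h e e0; exists n0 => n /hn.
rewrite psum_prod.
have E (x y : C) : \sum_(j < n) (x * y^*) ^+ j = \sum_(j < n) (y^*) ^+ j * x ^+ j.
  by apply: eq_bigr => j _; rewrite exprMn mulrC.
by rewrite !E.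
Qed.

Lemma kernel_l2 w : nm w.1 < 1 -> nm w.2 < 1 -> l2seq (kernel_coef w).
Proof.
move=> w1 w2.
have r1 : 0 <= nm w.1 ^+ 2 < 1 by rewrite exprn_ge0 ?nm_ge0//= exprn_ilt1 ?nm_ge0.
have r2 : 0 <= nm w.2 ^+ 2 < 1 by rewrite exprn_ge0 ?nm_ge0//= exprn_ilt1 ?nm_ge0.
have [B1 h1] := geom_sum_bounded 0 r1; have [B2 h2] := geom_sum_bounded 0 r2.
exists (B1 * B2) => N.
have -> : sqsum (kernel_coef w) N = geom_sum 0 (nm w.1 ^+ 2) N * geom_sum 0 (nm w.2 ^+ 2) N.
  rewrite /geom_sum mulr_suml; apply: eq_bigr => j _; rewrite mulr_sumr; apply: eq_bigr => k _.
  rewrite /kernel_coef nmM !nmX !nmJ exprMn -!exprM ![(2 * _)%N]mulnC !expr0; ring.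
by apply: ler_pM => //; apply: geom_sum_ge0; [have /andP[] := r1|have /andP[] := r2].
Qed.

Lemma kernel_bounded w : nm w.1 < 1 -> nm w.2 < 1 ->
  exists K, forall z, nm z.1 <= 1 -> nm z.2 <= 1 -> nm (cauchy_kernel w z) <= K.
Proof.
move=> w1 w2; exists ((1 - nm w.1)^-1 * (1 - nm w.2)^-1) => z z1 z2.
have aux (x y : C) : nm x <= 1 -> nm y < 1 -> nm (1 - x * y^*)^-1 <= (1 - nm y)^-1.
  move=> x1 y1; rewrite nmV lef_pV2 ?posrE ?subr_gt0//; last first.
    rewrite nm_gt0 nm_lt1_neq1// nmM nmJ (le_lt_trans _ y1)//.
    by rewrite ler_piMl ?nm_ge0.
  apply: le_trans (nm_subr _ _); rewrite nm1 lerD2l lerN2 nmM nmJ.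
  by rewrite ler_piMl ?nm_ge0.
by rewrite nmM ler_pM ?nm_ge0// aux.
Qed.

Lemma dot_kernel b w N : dot (kernel_coef w) b N = (psum b N w)^*.
Proof.
rewrite rmorph_sum; apply: eq_bigr => j _; rewrite rmorph_sum; apply: eq_bigr => k _.
by rewrite !rmorphM !rmorphXn /= mulrC mulrA.
Qed.

Lemma cvgC_conj (u : nat -> C) l : cvgC u l -> cvgC (fun n => (u n)^*) (l^*).
Proof.
by move=> h e /h[n0 hn]; exists n0 => n /hn; rewrite -rmorphB /= nmJ.
Qed.

Lemma reproducing b h w : power_series b h -> nm w.1 < 1 -> nm w.2 < 1 ->
  cvgC (dot (kernel_coef w) b) ((h w)^*).
Proof.
move=> [_ hb] w1 w2 e e0; have [n0 hn] := cvgC_conj (hb w w1 w2) e0.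
by exists n0 => n /hn; rewrite dot_kernel.
Qed.

End CauchyKernel.

(** * Kernels, linearity and completeness of the model space *)

Section ModelSpace.
Variable R : realType.
Local Notation C := R[i].
Variables (m n : nat) (p : {poly {poly C}}).
Hypothesis hp : rif_denominator m n p.
Local Notation phi := (rif m n p).
Hypothesis phi_le1 : forall z : C * C, nm z.1 < 1 -> nm z.2 < 1 -> nm (phi z) <= 1.
Implicit Types (a b : nat -> nat -> C) (f g h : C * C -> C) (w z : C * C).

Lemma rif_power_series : exists c, power_series c phi.
Proof. exact: rational_power_series (rif_den_neq0 hp). Qed.

Lemma hardy_phi_mul h b c : power_series c phi -> hardy_coef h b ->
  hardy_coef (fun z => phi z * h z) (conv c b).
Proof.
move=> hc /hardy_coefP[[B hB] hb]; apply/hardy_coefP; split.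
  by exists B; exact: (inner_mul_l2 phi_le1 hc hb hB).
exact: power_series_mul.
Qed.

Lemma model_spaceP f a c : power_series c phi -> hardy_coef f a ->
  (forall h b, hardy_coef h b -> cvgC (dot a (conv c b)) 0) <-> model_space phi f.
Proof.
move=> hc fa; split=> [ha|[_ hf] h b hb].
  split; first by exists a.
  move=> h [b hb]; apply: cvgC_unique (ha h b hb).
  exact: hardy_dotE fa (hardy_phi_mul hc hb).
by rewrite -(hf h); [exact: hardy_dotE fa (hardy_phi_mul hc hb)|exists b].
Qed.

(** $\langle C_w,\phi h\rangle=\overline{\phi(w)h(w)}$ by the reproducing property, and $\langle\phi
    C_w,\phi h\rangle=\langle C_w,h\rangle=\overline{h(w)}$ by the isometry; the combination
    defining the model kernel cancels them. *)
Lemma model_kernel_in w : nm w.1 < 1 -> nm w.2 < 1 -> model_space phi (model_kernel phi w).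
Proof.
move=> w1 w2; have [c hc] := rif_power_series.
have kw := kernel_power_series w1 w2; have lk := kernel_l2 w1 w2.
have hk : hardy_coef (cauchy_kernel w) (kernel_coef w) by apply/hardy_coefP.
have /hardy_coefP[lck hck] := hardy_phi_mul hc hk.
pose a j k := - (phi w)^* * conv c (kernel_coef w) j k + kernel_coef w j k.
have ha : hardy_coef (model_kernel phi w) a.
  apply/hardy_coefP; split; first exact: l2seq_lin.
  have := power_series_lin (- (phi w)^*) hck kw.
  have -> // : (fun z => - (phi w)^* * (phi z * cauchy_kernel w z) + cauchy_kernel w z) =
    model_kernel phi w.
  by apply/funext => z; rewrite /model_kernel; ring.
apply/(model_spaceP hc ha) => h b hb.
have /hardy_coefP[lcb hcb] := hardy_phi_mul hc hb.
have /hardy_coefP[lb hhb] := hb.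
have [K hK] := kernel_bounded w1 w2.
have h1 := inner_mul_dot hp phi_le1 hc lk kw lb hhb
  (fun z lt1 lt2 => hK z (ltW lt1) (ltW lt2)) (reproducing hhb w1 w2).
have h2 := reproducing hcb w1 w2.
have := cvgC_lin (- (phi w)^*) h1 h2.
have -> : - (phi w)^* * (h w)^* + (phi w * h w)^* = 0.
  by move: (phi w) (h w) => s t; rewrite rmorphM /=; ring.
move=> h3 e e0; have [n0 hn] := h3 e e0.
by exists n0 => N /hn; rewrite dot_lin.
Qed.

Lemma model_space_lin (c0 : C) f g : model_space phi f -> model_space phi g ->
  model_space phi (fun z => c0 * f z + g z).
Proof.
move=> kf kg; have [c hc] := rif_power_series.
have [[a fa] _] := kf; have [[b gb] _] := kg.
have hf := (model_spaceP hc fa).2 kf; have hg := (model_spaceP hc gb).2 kg.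
have [la pa] := (hardy_coefP _ _).1 fa; have [lb pb] := (hardy_coefP _ _).1 gb.
have hab : hardy_coef (fun z => c0 * f z + g z) (fun j k => c0 * a j k + b j k).
  by apply/hardy_coefP; split; [exact: l2seq_lin|exact: power_series_lin].
apply/(model_spaceP hc hab) => h d hd e e0.
have := cvgC_lin c0 (hf h d hd) (hg h d hd); rewrite mulr0 addr0 => h1.
by have [n0 hn] := h1 e e0; exists n0 => N /hn; rewrite dot_lin.
Qed.

Lemma model_space_complete (F : nat -> C * C -> C) :
  (forall k, model_space phi (F k)) ->
  (forall e, 0 < e -> exists n0, forall k l, (n0 <= k)%N -> (n0 <= l)%N ->
    hardy_norm (fun z => -1 * F l z + F k z) ^+ 2 <= e) ->
  exists2 f, model_space phi f & forall e, 0 < e -> exists n0, forall k, (n0 <= k)%N ->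
    hardy_norm (fun z => -1 * F k z + f z) ^+ 2 <= e.
Proof.
move=> kF cF; have [c hc] := rif_power_series.
have [x hx] := choice (fun k => (kF k).1).
have lx k : l2seq (x k) by have [] := (hardy_coefP _ _).1 (hx k).
have px k : power_series (x k) (F k) by have [] := (hardy_coefP _ _).1 (hx k).
have subE (u v : nat -> nat -> C) :
    (fun j k => v j k - u j k) = (fun j k => -1 * u j k + v j k).
  by apply/funext => j; apply/funext => k; rewrite mulN1r addrC.
have [|a la ha] := l2seq_complete lx.
  move=> e e0; have [n0 h] := cF e e0; exists n0 => k l n0k n0l N.
  apply: le_trans (h k l n0k n0l); apply: (hardy_normE _).1.
  by rewrite subE; apply/hardy_coefP; split; [exact: l2seq_lin|exact: power_series_lin].
have [f hf] := power_series_exists (l2seq_poly_growth la).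
have fa : hardy_coef f a by apply/hardy_coefP.
exists f.
  apply/(model_spaceP hc fa) => h b hb.
  have /hardy_coefP[lcb hcb] := hardy_phi_mul hc hb.
  have [B hB] := lcb.
  have B0 : 0 <= B by apply: le_trans (hB 0%N); exact: sqsum_ge0.
  move=> e e0.
  (* With this weight $s^{-1}(B+1)=e/3$ bounds the term of the fixed factor, and the other term is
     at most $e/3$ once the distance to [x n0] is below $(e/3)/s$. *)
  pose s := (B + 1) / (e / 3).
  have s0 : 0 < s by rewrite !divr_gt0// ltr_wpDl.
  have e30 : 0 < e / 3 by rewrite divr_gt0.
  have [n0 hn0] := ha _ (divr_gt0 e30 s0).
  have [n1 hn1] := (model_spaceP hc (hx n0)).2 (kF n0) h b hb (e / 3) e30.
  exists n1 => N n1N; rewrite subr0.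
  have -> : dot a (conv c b) N =
      dot (fun j k => a j k - x n0 j k) (conv c b) N + dot (x n0) (conv c b) N.
    by rewrite subE dot_lin mulN1r addrAC addNr add0r.
  have -> : e = (e / 3 + e / 3) + e / 3 by field.
  apply: le_trans (nmD _ _) (lerD _ _); last by have := hn1 N n1N; rewrite subr0.
  apply: le_trans (dot_le_scaled _ _ _ s0) (lerD _ _).
    by rewrite mulrC -ler_pdivlMr// hn0.
  apply: (@le_trans _ _ (s^-1 * (B + 1))); last by rewrite /s invf_div mulrC mulrCA divff ?mulr1// gt_eqF// ltr_wpDl.
  by rewrite ler_wpM2l ?invr_ge0 ?(ltW s0)// (le_trans (hB N))// lerDl.
move=> e e0; have [n0 h] := ha e e0; exists n0 => k n0k.
have hk : hardy_coef (fun z => -1 * F k z + f z) (fun j l => a j l - x k j l).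
  by rewrite subE; apply/hardy_coefP; split; [exact: l2seq_lin|exact: power_series_lin].
by apply: (hardy_normE hk).2 => N; exact: h.
Qed.

End ModelSpace.

(** * Closed spans and multipliers in L^2 *)

Section ComplexL2.
Context d (T : measurableType d) (R : realType).
Variable mu : {measure set T -> \bar R}.
Local Notation C := R[i].
Implicit Types (u v w : T -> C).

Definition cmeas u : Prop := measurable_fun setT (fun x => complex.Re (u x)) /\
  measurable_fun setT (fun x => complex.Im (u x)).

(** The square of the $L^2$ norm, kept as an integral to avoid roots; [energyD], with its factor
    $2$, takes the place of Minkowski's inequality. *)
Definition energy u : \bar R := (\int[mu]_x (nm (u x) ^+ 2)%:E)%E.

Lemma cmeas_ext u v : u =1 v -> cmeas u -> cmeas v.
Proof. by move=> /funext ->. Qed.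

Lemma cmeas_cst (c : C) : cmeas (fun=> c).
Proof. by split; exact: measurable_cst. Qed.

Lemma cmeas_real (f : T -> R) : measurable_fun setT f -> cmeas (fun x => (f x)%:C%C).
Proof. by move=> mf; split => //=; exact: measurable_cst. Qed.

Lemma cmeasD u v : cmeas u -> cmeas v -> cmeas (fun x => u x + v x).
Proof.
move=> [u1 u2] [v1 v2]; split.
  by under eq_fun do rewrite raddfD; exact: measurable_funD.
by under eq_fun do rewrite raddfD; exact: measurable_funD.
Qed.

Lemma cmeasM u v : cmeas u -> cmeas v -> cmeas (fun x => u x * v x).
Proof.
move=> [u1 u2] [v1 v2].
have ReM (a b : C) : complex.Re (a * b) =
    complex.Re a * complex.Re b - complex.Im a * complex.Im b by case: a b => ? ? [].
have ImM (a b : C) : complex.Im (a * b) =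
    complex.Re a * complex.Im b + complex.Im a * complex.Re b by case: a b => ? ? [].
split.
  under eq_fun do rewrite ReM.
  by apply: measurable_funB; exact: measurable_funM.
under eq_fun do rewrite ImM.
by apply: measurable_funD; exact: measurable_funM.
Qed.

Lemma cmeasZ (c : C) u : cmeas u -> cmeas (fun x => c * u x).
Proof. by move=> mu'; apply: cmeasM => //; exact: cmeas_cst. Qed.

Lemma cmeasN u : cmeas u -> cmeas (fun x => - u x).
Proof. by move=> /(cmeasZ (-1)); apply: cmeas_ext => x; rewrite mulN1r. Qed.

Lemma cmeasB u v : cmeas u -> cmeas v -> cmeas (fun x => u x - v x).
Proof. by move=> mu1 /cmeasN; exact: cmeasD. Qed.

Lemma cmeas_conj u : cmeas u -> cmeas (fun x => (u x)^*).
Proof.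
move=> [u1 u2].
have E (a : C) : complex.Re (a^*) = complex.Re a /\ complex.Im (a^*) = - complex.Im a.
  by case: a.
split.
  by under eq_fun do rewrite (E _).1.
by under eq_fun do rewrite (E _).2; exact: measurable_funN.
Qed.

Lemma cmeas_sum I (s : seq I) (F : I -> T -> C) : (forall i, cmeas (F i)) ->
  cmeas (fun x => \sum_(i <- s) F i x).
Proof.
move=> mF; elim: s => [|i s IH].
  by apply: cmeas_ext (cmeas_cst 0) => x; rewrite big_nil.
by apply: cmeas_ext (cmeasD (mF i) IH) => x; rewrite big_cons.
Qed.

Lemma measurable_sqr_nm u : cmeas u -> measurable_fun setT (fun x => nm (u x) ^+ 2).
Proof.
move=> [u1 u2]; under eq_fun do rewrite sqr_nmE.
by apply: measurable_funD; apply: measurable_funX.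
Qed.

Lemma measurable_inv_ge0 (f : T -> R) : (forall x, 0 <= f x) -> measurable_fun setT f ->
  measurable_fun setT (fun x => (f x)^-1).
Proof.
move=> f0 mf; have -> : (fun x => (f x)^-1) = (fun x => powR (f x) (-1)).
  by apply/funext => x; rewrite powR_inv1.
by apply: (measurableT_comp (measurable_powR (-1))).
Qed.

(** $u^{-1}=\bar u/|u|^2$, which also holds at the zeros of [u] since the inverse of $0$ is $0$. *)
Lemma cmeasV u : cmeas u -> cmeas (fun x => (u x)^-1).
Proof.
move=> mu'; have h : cmeas (fun x => ((nm (u x) ^+ 2)^-1)%:C%C * (u x)^*).
  apply: cmeasM; last exact: cmeas_conj.
  apply: cmeas_real; apply: measurable_inv_ge0; last exact: measurable_sqr_nm.
  by move=> x; rewrite exprn_ge0 ?nm_ge0.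
apply: cmeas_ext h => x.
have [->|ux0] := eqVneq (u x) 0; first by rewrite rmorph0 mulr0 invr0.
have n0 : (nm (u x) ^+ 2)%:C%C != 0 :> C.
  by rewrite -nm_eq0 nm_real normr_eq0 sqrf_eq0 nm_eq0.
apply: (mulfI n0); rewrite mulrA.
have -> : (nm (u x) ^+ 2)%:C%C * ((nm (u x) ^+ 2)^-1)%:C%C = 1 :> C.
  by rewrite -rmorphM /= mulfV ?rmorph1// sqrf_eq0 nm_eq0.
by rewrite mul1r sqr_nm_conj [u x * _]mulrC mulfK.
Qed.

Lemma measurable_energy u : cmeas u -> measurable_fun setT (fun x => (nm (u x) ^+ 2)%:E).
Proof. by move=> mu'; apply/measurable_EFinP; exact: measurable_sqr_nm. Qed.

Lemma energy_ge0 u : (0 <= energy u)%E.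
Proof. by apply: integral_ge0 => x _; rewrite lee_fin sqr_ge0. Qed.

Lemma le_energy u v : cmeas u -> cmeas v -> (forall x, nm (u x) <= nm (v x)) ->
  (energy u <= energy v)%E.
Proof.
move=> mu1 mv h; apply: ge0_le_integral => //.
- by move=> x _; rewrite lee_fin sqr_ge0.
- exact: measurable_energy.
- exact: measurable_energy.
- by move=> x _; rewrite lee_fin ler_sqr ?nnegrE ?nm_ge0.
Qed.

Lemma energyD u v : cmeas u -> cmeas v ->
  (energy (fun x => (u x + v x)%R) <= 2%:E * energy u + 2%:E * energy v)%E.
Proof.
move=> mu1 mv; have m1 := measurable_energy mu1; have m2 := measurable_energy mv.
rewrite /energy -!ge0_integralZl_EFin// -?ge0_integralD//; do ?
  (by move=> x _; rewrite ?mule_ge0// lee_fin ?sqr_ge0);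
  do ? exact: measurable_funeM.
apply: ge0_le_integral => //.
- by move=> x _; rewrite lee_fin sqr_ge0.
- by apply: measurable_energy; exact: cmeasD.
- by apply: emeasurable_funD; exact: measurable_funeM.
- by move=> x _; rewrite lee_fin sqr_nmD.
Qed.

Lemma energyZ (c : C) u : cmeas u ->
  energy (fun x => c * u x) = ((nm c ^+ 2)%:E * energy u)%E.
Proof.
move=> mu1; rewrite /energy -ge0_integralZl_EFin ?sqr_ge0//.
- by apply: eq_integral => x _; rewrite nmM exprMn.
- by move=> x _; rewrite lee_fin sqr_ge0.
- exact: measurable_energy.
Qed.

Lemma energy_ae u v : cmeas u -> cmeas v -> {ae mu, forall x, u x = v x} ->
  energy u = energy v.
Proof.
move=> mu1 mv h; apply: ge0_ae_eq_integral => //.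
- exact: measurable_energy.
- exact: measurable_energy.
- by move=> x _; rewrite lee_fin sqr_ge0.
- by move=> x _; rewrite lee_fin sqr_ge0.
- by apply: filterS h => x -> _.
Qed.

Lemma energy_eq0 u : cmeas u -> energy u = 0%E -> {ae mu, forall x, u x = 0}.
Proof.
move=> mu1 h; have := ae_eq_integral_abs mu measurableT (measurable_energy mu1).
move=> [+ _]; have -> : (\int[mu]_x `|(nm (u x) ^+ 2)%:E| = 0)%E.
  rewrite -h; apply: eq_integral => x _.
  by rewrite gee0_abs// lee_fin sqr_ge0.
move=> /(_ erefl); apply: filterS => x /(_ I)[] /eqP.
by rewrite sqrf_eq0 nm_eq0 => /eqP.
Qed.

Lemma energy_eq0_le u : cmeas u -> (forall e : R, 0 < e -> (energy u <= e%:E)%E) ->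
  {ae mu, forall x, u x = 0}.
Proof.
move=> mu1 h; apply: energy_eq0 => //; apply/eqP; rewrite eq_le energy_ge0 andbT.
by apply/lee_addgt0Pr => e e0; rewrite add0e; exact: h.
Qed.

Definition L2fun u : Prop := cmeas u /\ (energy u < +oo)%E.

Lemma L2fun_lin (c : C) u v : L2fun u -> L2fun v -> L2fun (fun x => c * u x + v x).
Proof.
move=> [mu1 hu] [mv hv]; have mcu := cmeasZ c mu1; split; first exact: cmeasD.
apply: le_lt_trans (energyD mcu mv) _.
by rewrite energyZ// lte_add_pinfty// lte_mul_pinfty// lte_mul_pinfty// lee_fin sqr_ge0.
Qed.

Lemma L2fun_le (K : R) u v : cmeas u -> L2fun v -> (forall x, nm (u x) <= K * nm (v x)) -> L2fun u.
Proof.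
move=> mu1 [mv hv] h; split=> //.
apply: (@le_lt_trans _ _ (energy (fun x => K%:C%C * v x))).
  apply: le_energy => //; first exact: cmeasZ.
  move=> x; rewrite nmM nm_real (le_trans (h x))// ler_wpM2r ?nm_ge0//.
  exact: ler_norm.
by rewrite energyZ// lte_mul_pinfty// lee_fin sqr_ge0.
Qed.

(** Dominated convergence for $|w_n|^2$, with the integrable majorant $K^2|v|^2$. *)
Lemma dominated_energy (w : nat -> T -> C) v (K : R) : (forall n, cmeas (w n)) -> L2fun v ->
  (forall n x, nm (w n x) <= K * nm (v x)) ->
  {ae mu, forall x, cvgC (fun n => w n x) 0} ->
  forall e : R, 0 < e -> exists n0, forall n, (n0 <= n)%N -> (energy (w n) <= e%:E)%E.
Proof.
move=> mw [mv hv] hw w0 e e0.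
pose f_ n x := (nm (w n x) ^+ 2)%:E.
pose g x := ((K ^+ 2)%:E * (nm (v x) ^+ 2)%:E)%E.
have mf_ n : measurable_fun setT (f_ n) by exact: measurable_energy.
have ig : mu.-integrable setT g.
  apply: integrableZl => //; apply/integrableP; split; first exact: measurable_energy.
  under eq_integral do rewrite gee0_abs ?lee_fin ?sqr_ge0//.
  exact: hv.
have [] := @dominated_convergence _ _ _ mu setT measurableT f_ (cst 0%E) g mf_ _ _ ig.
- exact: measurable_cst.
- apply: filterS w0 => x hx _.
  apply/cvg_EFin; first exact: nearW.
  apply/cvgrPdist_le => r r0.
  have [|n0 hn0] := hx (Num.sqrt r); first by rewrite sqrtr_gt0.
  exists n0 => // n /= /hn0; rewrite subr0 sub0r normrN ger0_norm ?sqr_ge0// => h.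
  by rewrite -[leRHS]sqr_sqrtr ?(ltW r0)// ler_sqr ?nnegrE ?nm_ge0 ?sqrtr_ge0.
- apply: aeW => x n _; rewrite gee0_abs ?lee_fin ?sqr_ge0// -exprMn.
  rewrite ler_sqr ?nnegrE ?nm_ge0//.
  by rewrite (le_trans _ (hw n x))// nm_ge0.
move=> _ _; rewrite integral0 => /fine_cvgP[/= [n1 _ h1]] /cvgrPdist_le/(_ _ e0)[n2 _ h2].
exists (maxn n1 n2) => n; rewrite geq_max => /andP[/h1 /= f1 /h2 /=].
rewrite sub0r normrN ger0_norm ?fine_ge0 ?energy_ge0// => h.
by rewrite -[leLHS]fineK// lee_fin.
Qed.

End ComplexL2.

Section ClosedSpan.
Context d (T : measurableType d) (R : realType).
Variable mu : {measure set T -> \bar R}.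
Local Notation C := R[i].
Implicit Types (u v w g : T -> C).

(** The closed linear span as an inductive predicate: a property passes from the generators to the
    whole span by induction, as soon as it is stable under linear combinations and energy limits. A
    limit only asks for one good index per tolerance. *)
Inductive clspan (S : (T -> C) -> Prop) : (T -> C) -> Prop :=
| clspan_base v : S v -> clspan S v
| clspan_lin (c : C) u v : clspan S u -> clspan S v -> clspan S (fun x => c * u x + v x)
| clspan_lim (u : nat -> T -> C) v : (forall n, clspan S (u n)) -> cmeas v ->
    (forall e : R, 0 < e -> exists n, (energy mu (fun x => v x - u n x)%R <= e%:E)%E) ->
    clspan S v.

Variable S : (T -> C) -> Prop.
Hypothesis S_L2 : forall v, S v -> L2fun mu v.
Local Notation M := (clspan S).

Lemma clspan_L2 v : M v -> L2fun mu v.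
Proof.
elim=> [{}v /S_L2//|c u {}v _ hu _ hv|u {}v _ hu mv h]; first exact: L2fun_lin.
have [n hn] := h 1 ltr01; have [mun eun] := hu n; split=> //.
have E : v =1 (fun x => (v x - u n x) + u n x) by move=> x; rewrite subrK.
rewrite (funext E); apply: le_lt_trans (energyD _ (cmeasB mv mun) mun) _.
by rewrite lte_add_pinfty// lte_mul_pinfty//; apply: le_lt_trans hn _; rewrite ltry.
Qed.

Lemma clspan_ae u v : M u -> cmeas v -> {ae mu, forall x, v x = u x} -> M v.
Proof.
move=> Mu mv h; apply: (@clspan_lim S (fun=> u)) => // e e0; exists 0%N.
have [mu1 _] := clspan_L2 Mu.
rewrite (_ : energy _ _ = 0%E) ?lee_fin ?ltW//.
rewrite (@energy_ae _ _ _ _ _ (fun=> 0)).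
- by rewrite /energy integral0_eq// => x _; rewrite nm0 expr0n.
- exact: cmeasB.
- exact: cmeas_cst.
- by apply: filterS h => x ->; rewrite subrr.
Qed.

Lemma clspan_ext u v : u =1 v -> M u -> M v.
Proof. by move=> /funext ->. Qed.

Lemma clspan0 u : M u -> M (fun=> 0).
Proof.
by move=> Mu; apply: clspan_ext (clspan_lin (-1) Mu Mu) => x; rewrite mulN1r addNr.
Qed.

Lemma clspanZ (c : C) u : M u -> M (fun x => c * u x).
Proof.
by move=> Mu; apply: clspan_ext (clspan_lin c Mu (clspan0 Mu)) => x; rewrite addr0.
Qed.

Lemma clspanD u v : M u -> M v -> M (fun x => u x + v x).
Proof.
by move=> Mu Mv; apply: clspan_ext (clspan_lin 1 Mu Mv) => x; rewrite mul1r.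
Qed.

Lemma clspan_sum I (s : seq I) (F : I -> T -> C) u : M u -> (forall i, M (F i)) ->
  M (fun x => \sum_(i <- s) F i x).
Proof.
move=> Mu MF; elim: s => [|i s IH].
  by apply: clspan_ext (clspan0 Mu) => x; rewrite big_nil.
by apply: clspan_ext (clspanD (MF i) IH) => x; rewrite big_cons.
Qed.

Lemma clspan_dominated (u : nat -> T -> C) v w (K : R) : (forall n, M (u n)) -> cmeas v ->
  L2fun mu w -> (forall n x, nm (v x - u n x) <= K * nm (w x)) ->
  {ae mu, forall x, cvgC (fun n => u n x) (v x)} -> M v.
Proof.
move=> Mu mv Lw hK huv; apply: (clspan_lim Mu mv) => e e0.
have [||n0 h] := @dominated_energy _ _ _ mu (fun n x => v x - u n x) w K _ Lw hK _ e e0.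
- by move=> n; apply: cmeasB => //; have [] := clspan_L2 (Mu n).
- apply: filterS huv => x hx r r0; have [n0 hn] := hx r r0; exists n0 => n /hn.
  by rewrite subr0 nm_distC.
by exists n0; exact: h.
Qed.

(** Boundedness makes multiplication by [g] continuous for the energy, so that multipliers respect
    limits in the span. *)
Definition multiplier g : Prop := [/\ cmeas g, exists K, forall x, nm (g x) <= K &
  forall v, M v -> M (fun x => g x * v x)].

(** Induction over the span, the limit case by continuity. The constant [1 + |K|] is positive
    whatever the sign of [K], so one may divide by it. *)
Lemma multiplier_base g K : cmeas g -> (forall x, nm (g x) <= K) ->
  (forall v, S v -> M (fun x => g x * v x)) -> multiplier g.
Proof.
move=> mg gK hS; split=> //; first by exists K.
move=> v; elim=> [{}v /hS//|c u {}v _ hu _ hv|u {}v Mu hu mv h].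
  by apply: clspan_ext (clspan_lin c hu hv) => x; ring.
apply: (clspan_lim hu); first exact: cmeasM.
move=> e e0; have K1 : 0 < (1 + `|K|) ^+ 2 by rewrite exprn_gt0// ltr_pwDl.
have [|n hn] := h (e / (1 + `|K|) ^+ 2); first by rewrite divr_gt0.
exists n; have mun : cmeas (u n) by have [] := clspan_L2 (Mu n).
have mvu := cmeasB mv mun.
apply: (@le_trans _ _ (energy mu (fun x => (1 + `|K|)%:C%C * (v x - u n x)))).
  apply: le_energy; first exact: (cmeasB (cmeasM mg mv) (cmeasM mg mun)).
    exact: cmeasZ.
  move=> x; rewrite -mulrBr !nmM ler_wpM2r ?nm_ge0// nm_real.
  rewrite ger0_norm ?addr_ge0// (le_trans (gK x))// (le_trans (ler_norm K))// lerDr.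
  exact: ler01.
rewrite energyZ// nm_real ger0_norm ?addr_ge0//.
have : (((1 + `|K|) ^+ 2)%:E * energy mu (fun x => v x - u n x)%R <=
    ((1 + `|K|) ^+ 2)%:E * (e / (1 + `|K|) ^+ 2)%:E)%E.
  by rewrite lee_pmul2l// lte_fin.
by move/le_trans; apply; rewrite -EFinM lee_fin mulrC divfK// gt_eqF.
Qed.

Lemma multiplierM g h : multiplier g -> multiplier h -> multiplier (fun x => g x * h x).
Proof.
move=> [mg [K gK] Mg] [mh [L hL] Mh]; split; first exact: cmeasM.
  by exists (K * L) => x; rewrite nmM ler_pM ?nm_ge0.
by move=> v Mv; apply: clspan_ext (Mg _ (Mh _ Mv)) => x; rewrite mulrA.
Qed.

Lemma multiplier_lin (c : C) g h : multiplier g -> multiplier h ->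
  multiplier (fun x => c * g x + h x).
Proof.
move=> [mg [K gK] Mg] [mh [L hL] Mh]; split.
- by apply: cmeasD => //; exact: cmeasZ.
- exists (nm c * K + L) => x; rewrite (le_trans (nmD _ _))// lerD// nmM.
  by rewrite ler_wpM2l ?nm_ge0.
by move=> v Mv; apply: clspan_ext (clspan_lin c (Mg _ Mv) (Mh _ Mv)) => x; ring.
Qed.

Lemma multiplier1 : multiplier (fun=> 1).
Proof.
split; first exact: cmeas_cst.
  by exists 1 => x; rewrite nm1.
by move=> v; apply: clspan_ext => x; rewrite mul1r.
Qed.

Lemma multiplier_ext g h : g =1 h -> multiplier g -> multiplier h.
Proof. by move=> /funext ->. Qed.

Lemma multiplier_cst (c : C) : multiplier (fun=> c).
Proof.
by apply: multiplier_ext (multiplier_lin (c - 1) multiplier1 multiplier1) => x; ring.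
Qed.

Lemma multiplierZ (c : C) g : multiplier g -> multiplier (fun x => c * g x).
Proof. by move=> Mg; apply: multiplierM => //; exact: multiplier_cst. Qed.

Lemma multiplierD g h : multiplier g -> multiplier h -> multiplier (fun x => g x + h x).
Proof.
by move=> Mg Mh; apply: multiplier_ext (multiplier_lin 1 Mg Mh) => x; rewrite mul1r.
Qed.

Lemma multiplierX g n : multiplier g -> multiplier (fun x => g x ^+ n).
Proof.
move=> Mg; elim: n => [|n IH]; first exact: multiplier1.
by apply: multiplier_ext (multiplierM Mg IH) => x; rewrite exprS.
Qed.

Lemma multiplier_sum I (s : seq I) (F : I -> T -> C) : (forall i, multiplier (F i)) ->
  multiplier (fun x => \sum_(i <- s) F i x).
Proof.
move=> MF; elim: s => [|i s IH].
  by apply: multiplier_ext (multiplier_cst 0) => x; rewrite big_nil.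
by apply: multiplier_ext (multiplierD (MF i) IH) => x; rewrite big_cons.
Qed.

Lemma cmeas_cvg (g : nat -> T -> C) h : (forall n, cmeas (g n)) ->
  (forall x, cvgC (fun n => g n x) (h x)) -> cmeas h.
Proof.
move=> mg gh; split.
  apply: (@measurable_fun_cvg _ _ _ _ (fun n x => complex.Re (g n x))).
    by move=> n; have [] := mg n.
  move=> x _; apply/cvgrPdist_le => e e0; have [n0 h0] := gh x e e0.
  by exists n0 => // n /= /h0; apply: le_trans; rewrite distrC -raddfB nm_Re.
apply: (@measurable_fun_cvg _ _ _ _ (fun n x => complex.Im (g n x))).
  by move=> n; have [] := mg n.
move=> x _; apply/cvgrPdist_le => e e0; have [n0 h0] := gh x e e0.
by exists n0 => // n /= /h0; apply: le_trans; rewrite distrC -raddfB nm_Im.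
Qed.

Lemma nm_cvg_le (u : nat -> C) l K : cvgC u l -> (forall n, nm (u n) <= K) -> nm l <= K.
Proof.
move=> ul uK; apply/ler_addgt0Pr => e e0; have [n0 h] := ul e e0.
have := h n0 (leqnn _); rewrite nm_distC => h0.
rewrite -[l](subrK (u n0)) addrC (le_trans (nmD _ _))// lerD//.
Qed.

(** For each [v] in the span the products converge pointwise and are dominated by a multiple of
    $|v|$. *)
Lemma multiplier_cvg (g : nat -> T -> C) h K : (forall n, multiplier (g n)) ->
  (forall n x, nm (g n x) <= K) -> (forall x, cvgC (fun n => g n x) (h x)) -> multiplier h.
Proof.
move=> Mg gK gh.
have mh : cmeas h by apply: cmeas_cvg gh => n; have [] := Mg n.
have hK x : nm (h x) <= K by apply: nm_cvg_le (gh x) _.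
split=> //; first by exists K.
move=> v Mv; have Lv := clspan_L2 Mv; have [mv _] := Lv.
apply: (@clspan_dominated (fun n x => g n x * v x) _ v (2 * K)) => //.
- by move=> n; have [_ _] := Mg n; apply.
- exact: cmeasM.
- move=> n x; rewrite -mulrBl nmM ler_wpM2r ?nm_ge0// (le_trans (nmB _ _))//.
  by rewrite mulr_natl mulr2n lerD.
- apply: aeW => x e e0; have v1 : 0 < nm (v x) + 1 by rewrite ltr_wpDl ?nm_ge0.
  have [|n0 h0] := gh x (e / (nm (v x) + 1)); first by rewrite divr_gt0.
  exists n0 => n /h0 hn; rewrite -mulrBl nmM.
  apply: (@le_trans _ _ (e / (nm (v x) + 1) * (nm (v x) + 1))).
    by rewrite ler_pM ?nm_ge0// lerDl.
  by rewrite divfK// gt_eqF.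
Qed.

(* Iterating [s |-> (3 s - s^3) / 2] from [t] in [[-1, 1]] converges to the sign of [t]. *)
Definition sign_step (s : R) : R := (3 * s - s ^+ 3) / 2.

(** The step increases points of $(0,1]$, so the iterates stay above $t$; the identity
    $1-\mathrm{step}(s)=(1-s)\cdot(1-s)(2+s)/2$ then contracts the distance to $1$ by a factor at
    most $1-t/2$. *)
Lemma sign_iter (t : R) : 0 < t -> t <= 1 -> forall n,
  t <= iter n sign_step t <= 1 /\ 1 - iter n sign_step t <= (1 - t / 2) ^+ n.
Proof.
move=> t0 t1; elim=> [|n [/andP[lo hi] ih]] /=.
  by rewrite lexx t1 expr0; split=> //; lra.
set s := iter n _ _ in lo hi ih *.
have s0 : 0 < s by exact: lt_le_trans lo.
have E1 : sign_step s - s = s * (1 - s) * (1 + s) / 2 by rewrite /sign_step; field.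
have E2 : 1 - sign_step s = (1 - s) * ((1 - s) * (2 + s) / 2) by rewrite /sign_step; field.
have h1 : 0 <= sign_step s - s.
  by rewrite E1 !mulr_ge0 ?subr_ge0 ?(ltW s0)// addr_ge0 ?(ltW s0).
have h2 : 0 <= 1 - sign_step s.
  by rewrite E2 !mulr_ge0 ?subr_ge0// addr_ge0 ?(ltW s0).
have h3 : (1 - s) * (2 + s) / 2 <= 1 - t / 2 by nra.
have h4 : 0 <= (1 - s) * (2 + s) / 2 by rewrite !mulr_ge0 ?subr_ge0// addr_ge0 ?(ltW s0).
split; first by apply/andP; split; lra.
rewrite E2 mulrC exprS; apply: ler_pM => //.
by rewrite subr_ge0.
Qed.

Lemma sign_stepN s : sign_step (- s) = - sign_step s.
Proof. by rewrite /sign_step; field. Qed.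

Lemma sign_iterN n t : iter n sign_step (- t) = - iter n sign_step t.
Proof. by elim: n => //= n ->; rewrite sign_stepN. Qed.

Lemma sign_iter_cvg (t : R) : `|t| <= 1 ->
  forall e : R, 0 < e -> exists n0, forall n, (n0 <= n)%N ->
  `|iter n sign_step t - Num.sg t| <= e.
Proof.
have pos (s e : R) : 0 < s -> s <= 1 -> 0 < e -> exists n0, forall n, (n0 <= n)%N ->
    `|iter n sign_step s - 1| <= e.
  move=> s0 s1 e0; have [||n0 h] := @expr_small R (1 - s / 2) e; [lra|by []|].
  exists n0 => n /h hn; have [/andP[_ hi] h2] := sign_iter s0 s1 n.
  by rewrite distrC ger0_norm ?subr_ge0// (le_trans h2).
move=> t1 e e0; have [t0|t0|->] := ltrgt0P t.
- by rewrite gtr0_sg//; apply: pos => //; rewrite (le_trans (ler_norm t)).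
- rewrite ltr0_sg//; have [||n0 h] := pos (- t) e _ _ e0; first by rewrite oppr_gt0.
    by rewrite (le_trans _ t1)// -normrN ler_norm.
  by exists n0 => n /h; rewrite sign_iterN -opprD normrN opprK.
- exists 0%N => n _; rewrite sgr0 subr0.
  have -> : iter n sign_step 0 = 0; last by rewrite normr0 ltW.
  by elim: n => //= n ->; rewrite /sign_step; field.
Qed.

Lemma sign_iter_le1 (t : R) n : `|t| <= 1 -> `|iter n sign_step t| <= 1.
Proof.
move=> t1; have [t0|t0|->] := ltrgt0P t.
- have [/andP[lo hi] _] := sign_iter t0 (le_trans (ler_norm t) t1) n.
  by rewrite ger0_norm// (le_trans (ltW t0)).
- have nt0 : 0 < - t by rewrite oppr_gt0.
  have nt1 : - t <= 1 by rewrite (le_trans _ t1)// -normrN ler_norm.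
  have [/andP[lo hi] _] := sign_iter nt0 nt1 n.
  by rewrite -normrN -sign_iterN ger0_norm// (le_trans (ltW nt0)).
- have -> : iter n sign_step 0 = 0; last by rewrite normr0.
  by elim: n => //= n' ->; rewrite /sign_step; field.
Qed.

(** The iterates are polynomials in [f], hence multipliers, bounded by $1$ and convergent to the
    sign everywhere. *)
Lemma multiplier_sg (f : T -> R) : (forall x, `|f x| <= 1) ->
  multiplier (fun x => (f x)%:C%C) -> multiplier (fun x => (Num.sg (f x))%:C%C).
Proof.
move=> f1 Mf.
have h n : multiplier (fun x => (iter n sign_step (f x))%:C%C).
  elim: n => //= n IH.
  apply: multiplier_ext (multiplier_lin (3 / 2) IH (multiplierZ (- 2^-1) (multiplierX 3 IH))).
  move=> x; rewrite /sign_step rmorphM rmorphB rmorphM rmorphXn fmorphV /= !rmorph_nat.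
  by field.
apply: (multiplier_cvg (K := 1) h).
- by move=> n x; rewrite nm_real sign_iter_le1.
- move=> x e e0; have [n0 hn] := sign_iter_cvg (f1 x) e0.
  by exists n0 => n /hn; rewrite nm_realB.
Qed.

Definition good_set (E : set T) : Prop := measurable E /\ multiplier (fun x => (\1_E x)%:C%C).

Lemma good_set_gt0 (f : T -> R) : (forall x, `|f x| <= 1) ->
  multiplier (fun x => (f x)%:C%C) -> measurable [set x | 0 < f x] -> good_set [set x | 0 < f x].
Proof.
move=> f1 Mf mE; split=> //.
have Ms := multiplier_sg f1 Mf.
(* The indicator of $\{f>0\}$ is $(\mathrm{sg}^2+\mathrm{sg})/2$, which also gives $0$ where
   $f=0$. *)
apply: multiplier_ext (multiplierZ (2^-1) (multiplierD (multiplierM Ms Ms) Ms)) => x.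
rewrite indicE; case: (ltrgt0P (f x)) => h.
- by rewrite mem_set// gtr0_sg// rmorph1; field.
- rewrite memNset//=; last by move=> /(lt_trans h); rewrite ltxx.
  by rewrite ltr0_sg// rmorphN rmorph1 rmorph0; field.
- by rewrite memNset//= h ?ltxx// sgr0 rmorph0; field.
Qed.

Lemma good_setC E : good_set E -> good_set (~` E).
Proof.
move=> [mE ME]; split; first exact: measurableC.
apply: multiplier_ext (multiplier_lin (-1) ME multiplier1) => x.
rewrite !indicE in_setC; case: (x \in E); rewrite ?rmorph1 ?rmorph0; ring.
Qed.

Lemma good_setI E F : good_set E -> good_set F -> good_set (E `&` F).
Proof.
move=> [mE ME] [mF MF]; split; first exact: measurableI.
apply: multiplier_ext (multiplierM ME MF) => x.
by rewrite !indicE in_setI -rmorphM /= -natrM mulnb.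
Qed.

Lemma good_set0 : good_set set0.
Proof.
split; first exact: measurable0.
by apply: multiplier_ext (multiplier_cst 0) => x; rewrite indic0 rmorph0.
Qed.

Lemma good_setU E F : good_set E -> good_set F -> good_set (E `|` F).
Proof.
by move=> gE gF; rewrite -[_ `|` _]setCK setCU; apply/good_setC/good_setI; exact: good_setC.
Qed.

(** The indicators of the finite unions converge pointwise and are bounded by $1$. *)
Lemma good_bigcup (F : (set T)^nat) : (forall n, good_set (F n)) -> good_set (\bigcup_n F n).
Proof.
move=> gF; pose G n := \big[setU/set0]_(i < n) F i.
have gG n : good_set (G n).
  by rewrite /G; elim/big_ind : _ => // [|A B]; [exact: good_set0|exact: good_setU].
split; first by apply: bigcup_measurable => n _; have [] := gF n.
apply: (@multiplier_cvg (fun n x => (\1_(G n) x)%:C%C) _ 1).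
- by move=> n; have [] := gG n.
- by move=> n x; rewrite nm_real indicE normr_nat; case: (_ \in _).
move=> x e e0; have GE n : G n = \bigcup_(i in `I_n) F i by rewrite bigcup_mkord.
have [[n _ Fx]|nx] := pselect ((\bigcup_n F n) x).
  exists n.+1 => k nk; rewrite !indicE !mem_set ?subrr ?nm0 ?(ltW e0)//.
    by exists n.
  by rewrite GE; exists n.
exists 0%N => k _; rewrite !indicE !memNset ?subrr ?nm0 ?(ltW e0)//.
by rewrite GE => -[i _ Fx]; apply: nx; exists i.
Qed.

Import HBNNSimple.

(** Indicators applied to the constant $1$ give simple functions; dominated increasing approximation
    gives nonnegative functions, and the positive and negative parts of the real and imaginary parts
    give the rest. *)
Lemma clspan_dense : (forall E, measurable E -> good_set E) -> M (fun=> 1) ->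
  forall v, L2fun mu v -> M v.
Proof.
move=> gE M1.
have Mnn (h : {nnsfun T >-> R}) : M (fun x => (h x)%:C%C).
  have E : (fun x => (h x)%:C%C) = (fun x => \sum_(y <- finmap.enum_fset (fset_set (range h)))
      y%:C%C * ((\1_(h @^-1` [set y]) x)%:C%C * 1)).
    apply/funext => x; rewrite {1}(fimfunE h x) fsbig_finite//= rmorph_sum.
    by apply: eq_bigr => y _; rewrite rmorphM mulr1.
  rewrite E; apply: (clspan_sum _ M1) => y; apply: clspanZ.
  have [|_ [_ _]] := gE (h @^-1` [set y]); last by apply.
  exact: measurable_sfunP.
have Mpos (f : T -> R) : measurable_fun setT f -> (forall x, 0 <= f x) ->
    (energy mu (fun x => (f x)%:C%C) < +oo)%E -> M (fun x => (f x)%:C%C).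
  move=> mf f0 ef.
  have mf' : measurable_fun setT (EFin \o f) by exact/measurable_EFinP.
  pose h n := nnsfun_approx measurableT mf' n.
  have hf x : (fun n => h n x) @ \oo --> f x.
    have := @cvg_nnsfun_approx _ _ _ _ measurableT _ mf' (fun x _ => f0 x) x Logic.I.
    by move/fine_cvgP => [].
  have hle n x : h n x <= f x.
    have /nondecreasing_cvgn_le : nondecreasing_seq (fun n => h n x).
      by move=> a b ab; have /lefP := nd_nnsfun_approx measurableT mf' ab; apply.
    move=> /(_ _ n); rewrite (cvg_lim _ (hf x))//; apply.
    exact: hf.
  have Lf : L2fun mu (fun x => (f x)%:C%C) by split; [exact: cmeas_real|].
  apply: (@clspan_dominated (fun n x => (h n x)%:C%C) _ (fun x => (f x)%:C%C) 1) => //.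
  - move=> n x; rewrite mul1r nm_realB nm_real ger0_norm ?subr_ge0//.
    by rewrite (ger0_norm (f0 x)) gerBl.
  - apply: aeW => x e e0; have /cvgrPdist_le/(_ _ e0)[n0 _ hn] := hf x.
    by exists n0 => n n0n; rewrite nm_realB distrC; exact: hn.
move=> v [[mRe mIm] ev].
have part (f : T -> R) : measurable_fun setT f -> (forall x, `|f x| <= nm (v x)) ->
    M (fun x => (f x)%:C%C).
  move=> mf fv.
  have Mp (g : T -> R) : measurable_fun setT g -> (forall x, 0 <= g x) ->
      (forall x, g x <= `|f x|) -> M (fun x => (g x)%:C%C).
    move=> mg g0 gf; apply: Mpos => //.
    apply: le_lt_trans ev; apply: le_energy => //.
    by move=> x; rewrite nm_real ger0_norm// (le_trans (gf x)).
  have m0 : measurable_fun setT (fun _ : T => 0 : R) by exact: measurable_cst.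
  have h1 := Mp (fun x => Num.max (f x) 0) (measurable_maxr mf m0).
  have h2 := Mp (fun x => Num.max (- f x) 0) (measurable_maxr (measurable_funN mf) m0).
  apply: clspan_ext (clspan_lin (-1) (h2 _ _) (h1 _ _)) => x.
  - have -> : Num.max (- f x) 0 = Num.max (f x) 0 - f x.
      have [h|/ltW h] := leP 0 (f x).
        by rewrite max_r ?oppr_le0// subrr.
      by rewrite max_l ?oppr_ge0// sub0r.
    by rewrite rmorphB mulN1r opprB subrK.
  - by rewrite le_max lexx orbT.
  - by rewrite ge_max normr_ge0 -normrN ler_norm.
  - by rewrite le_max lexx orbT.
  - by rewrite ge_max normr_ge0 ler_norm.
have h1 := part _ mRe (fun x => nm_Re (v x)).
have h2 := part _ mIm (fun x => nm_Im (v x)).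
by apply: clspan_ext (clspan_lin 'i%C h2 h1) => x; rewrite [RHS]complexE addrC.
Qed.

End ClosedSpan.

(** * Density of the Cauchy kernels *)

Section TorusBorel.
Variable R : realType.
Local Notation C := R[i].
Local Notation T := (borel_torus R).

(** The four real coordinates of $\mathbb{C}^2$ indexed by two booleans, so that half-spaces and
    boxes are treated uniformly. *)
Definition coord (a b : bool) (z : C * C) : R :=
  let x := if a then z.1 else z.2 in if b then complex.Re x else complex.Im x.

Lemma nbhs_complexP (x : C) (P : set C) :
  nbhs x P <-> exists2 e : R, 0 < e & forall y, nm (x - y) < e -> P y.
Proof.
split=> [[e /= e0 h]|[e e0 h]].
  have eR : (complex.Re e)%:C%C = e by apply: RRe_real; exact: gtr0_real.
  exists (complex.Re e); first by rewrite -ltcR eR.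
  by move=> y xy; apply: h; rewrite /ball_ /= normE -eR ltcR.
exists (e%:C%C); first by rewrite /= ltcR.
by move=> y /=; rewrite normE ltcR => /h.
Qed.

Lemma continuous_Re : continuous (@complex.Re R : C -> R).
Proof.
move=> x A /nbhs_ballP[e /= e0 hA]; apply/nbhs_complexP; exists e => // y xy.
by apply: hA; rewrite /ball /= (le_lt_trans _ xy)// -raddfB nm_Re.
Qed.

Lemma continuous_Im : continuous (@complex.Im R : C -> R).
Proof.
move=> x A /nbhs_ballP[e /= e0 hA]; apply/nbhs_complexP; exists e => // y xy.
by apply: hA; rewrite /ball /= (le_lt_trans _ xy)// -raddfB nm_Im.
Qed.

Lemma continuous_coord a b : continuous (coord a b : C * C -> R).
Proof.
move=> z; case: a; case: b.
- by apply: (continuous_comp (f := fst)); [exact: cvg_fst|exact: continuous_Re].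
- by apply: (continuous_comp (f := fst)); [exact: cvg_fst|exact: continuous_Im].
- by apply: (continuous_comp (f := snd)); [exact: cvg_snd|exact: continuous_Re].
- by apply: (continuous_comp (f := snd)); [exact: cvg_snd|exact: continuous_Im].
Qed.

Lemma torus_open_preimage (V : set (C * C)) : open V -> open ((@pt R : torus R -> C * C) @^-1` V).
Proof. by move=> oV; apply: open_comp => // z _; exact: initial_continuous. Qed.

Lemma measurable_coord a b : measurable_fun setT (fun t : T => coord a b (pt t)).
Proof.
apply: (measurability _ (RGenOInfty.measurableE R)) => // _ [_ [x ->] <-].
rewrite setTI; apply: sub_sigma_algebra.
have -> : (fun t : T => coord a b (pt t)) @^-1` `]x, +oo[%classic =
    (@pt R : torus R -> C * C) @^-1` [set z | x < coord a b z].
  by apply/seteqP; split => t /=; rewrite in_itv /= andbT.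
apply: torus_open_preimage.
have -> : [set z | x < coord a b z] = coord a b @^-1` [set y | x < y] by [].
by apply: open_comp; [move=> z _; exact: continuous_coord|exact: open_gt].
Qed.

Definition box (c : C * C) (h : R) : set T :=
  [set t | forall a b, `|coord a b (pt t) - coord a b c| < h].

Lemma open_torus_box (U : set T) : @open (torus R) U -> forall t, U t ->
  exists2 h : R, 0 < h & box (pt t) h `<=` U.
Proof.
move=> [V oV <-] t Vt.
have : nbhs (pt t) V by exact: open_nbhs_nbhs.
move=> [[A B] /= [/nbhs_complexP[e1 e10 h1] /nbhs_complexP[e2 e20 h2]] AB].
have m0 : 0 < Num.min e1 e2 / 2 by rewrite divr_gt0// lt_min e10.
exists (Num.min e1 e2 / 2) => // s hs; apply: AB; split => /=.
  apply: h1; apply: le_lt_trans (nm_ReIm _) _; rewrite !raddfB.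
  have := hs true true; have := hs true false; rewrite /coord /= distrC => i1.
  rewrite distrC => i2; apply: (@lt_le_trans _ _ (Num.min e1 e2)).
    by rewrite [ltRHS]splitr ltrD.
  by rewrite ge_min lexx.
apply: h2; apply: le_lt_trans (nm_ReIm _) _; rewrite !raddfB.
have := hs false true; have := hs false false; rewrite /coord /= distrC => i1.
rewrite distrC => i2; apply: (@lt_le_trans _ _ (Num.min e1 e2)).
  by rewrite [ltRHS]splitr ltrD.
by rewrite ge_min lexx orbT.
Qed.

Definition rat_box (q : (rat * rat) * (rat * rat) * nat) : set T :=
  [set t | forall a b, `|coord a b (pt t) -
     ratr (let p := if a then q.1.1 else q.1.2 in if b then p.1 else p.2)| < q.2.+1%:R^-1].

Lemma open_torus_bigcup (U : set T) : @open (torus R) U ->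
  U = \bigcup_k (if @unpickle ((rat * rat) * (rat * rat) * nat)%type k is Some q then
    if `[< rat_box q `<=` U >] then rat_box q else set0 else set0).
Proof.
move=> oU; apply/seteqP; split=> [t Ut|t [k _]]; last first.
  case: (unpickle k) => // q; case: ifP => // /asboolP qU qt; exact: qU.
have [h h0 hU] := open_torus_box oU Ut.
(* Half of [h], because two points of one rational box are compared through its centre. *)
have [n hn] : exists n : nat, n.+1%:R^-1 < h / 2.
  have h20 : 0 <= 2 / h by rewrite divr_ge0// ltW.
  exists (Num.bound (2 / h)); rewrite -[ltRHS]invf_div ltf_pV2 ?posrE ?divr_gt0//.
  by rewrite (lt_trans (archi_boundP h20))// ltr_nat.
have dense a b : exists q : rat, `|coord a b (pt t) - ratr q| < n.+1%:R^-1.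
  have [|q] := @rat_in_itvoo R (coord a b (pt t)) (coord a b (pt t) + n.+1%:R^-1).
    by rewrite ltrDl.
  rewrite in_itv /= => /andP[q1 q2]; exists q.
  by rewrite distrC gtr0_norm ?subr_gt0// ltrBlDl.
have [q11 h11] := dense true true; have [q12 h12] := dense true false.
have [q21 h21] := dense false true; have [q22 h22] := dense false false.
pose q : (rat * rat) * (rat * rat) * nat := ((q11, q12), (q21, q22), n).
have qt : rat_box q t by case; case.
have := pickleK q; move: (pickle q) => k kq; exists k; first exact: I.
rewrite kq asboolT; first exact: qt.
move=> s qs; apply: hU => a b.
have := qs a b; have := qt a b; set r := ratr _ => i1 i2.
rewrite -(subrK r (coord a b (pt s))) -addrA (le_lt_trans (ler_normD _ _))//.
rewrite [ltRHS]splitr ltrD ?(lt_trans i2)// distrC (lt_trans i1)//.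
Qed.

Lemma norm_lt_split (u v k : R) : (`|u - v| < k) = (0 < u - (v - k)) && (0 < v + k - u).
Proof. by rewrite ltr_distlC !subr_gt0 ltrBlDr ltrBlDr andbC. Qed.

(** Rational boxes are finite intersections of half-spaces, and an open set is the countable union
    of the rational boxes it contains. The form [0 < _] of the half-spaces is the one produced by
    [good_set_gt0]. *)
Lemma borel_torus_ind (G : set T -> Prop) :
  (forall E, G E -> G (~` E)) -> (forall E F, G E -> G F -> G (E `&` F)) -> G set0 ->
  (forall F : (set T)^nat, (forall n, G (F n)) -> G (\bigcup_n F n)) ->
  (forall a b c, G [set t | 0 < coord a b (pt t) - c]) ->
  (forall a b c, G [set t | 0 < c - coord a b (pt t)]) ->
  forall E, measurable E -> G E.
Proof.
move=> GC GI G0 GU Gl Gr.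
have Gbox q : G (rat_box q).
  pose c a b : R := ratr (let p := if a then q.1.1 else q.1.2 in if b then p.1 else p.2).
  pose h : R := q.2.+1%:R^-1.
  pose B a b := [set t : T | 0 < coord a b (pt t) - (c a b - h)] `&`
    [set t | 0 < (c a b + h) - coord a b (pt t)].
  have -> : rat_box q = (B true true `&` B true false) `&` (B false true `&` B false false).
    apply/seteqP; split=> t.
      move=> qt; have hB a b : B a b t.
        by have : `|coord a b (pt t) - c a b| < h := qt a b; rewrite norm_lt_split => /andP.
      by split; split; exact: hB.
    move=> [[h1 h2] [h3 h4]] a b.
    have [i1 i2] : B a b t by case: a b => [] [].
    by rewrite -[_ < _]/(`|coord a b (pt t) - c a b| < h) norm_lt_split; apply/andP.
  have GB a b : G (B a b) by apply: GI; [exact: Gl|exact: Gr].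
  by apply: (GI _ _ (GI _ _ (GB _ _) (GB _ _)) (GI _ _ (GB _ _) (GB _ _))).
have Gopen U : @open (torus R) U -> G U.
  move=> oU; rewrite (open_torus_bigcup oU); apply: GU => k.
  by case: unpickle => // q; case: ifP.
have sG : sigma_algebra setT (G : set (set T)).
  split => //; first by move=> A GA; rewrite setTD; exact: GC.
move=> E mE; exact: (smallest_sub sG Gopen mE).
Qed.

End TorusBorel.

(** * Shifting, dividing and conjugating inside a closed span *)

Section SpanTools.
Context d (T : measurableType d) (R : realType).
Variable mu : {measure set T -> \bar R}.
Hypothesis mu_fin : (mu setT < +oo)%E.
Local Notation C := R[i].
Variable S : (T -> C) -> Prop.
Hypothesis S_L2 : forall v, S v -> L2fun mu v.
Local Notation M := (clspan mu S).
Local Notation mult := (multiplier mu S).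

Lemma L2fun_bounded (u : T -> C) (K : R) : cmeas u -> (forall t, nm (u t) <= K) -> L2fun mu u.
Proof.
move=> mu1 uK; apply: (@L2fun_le _ _ _ _ K _ (fun=> 1)) => //; last first.
  by move=> t; rewrite nm1 mulr1.
split; first exact: cmeas_cst.
by rewrite /energy nm1 expr1n integral_cst// mul1e.
Qed.

Lemma inv_expn_cvg (K : R) e : 0 < e -> exists n0, forall n, (n0 <= n)%N -> K / n.+1%:R <= e.
Proof.
move=> e0; exists (Num.bound (`|K| / e)) => n hn.
rewrite ler_pdivrMr// mulrC -ler_pdivrMr//.
apply: (@le_trans _ _ (`|K| / e)); first by rewrite ler_pM2r ?invr_gt0// ler_norm.
have h0 : 0 <= `|K| / e by rewrite divr_ge0// ltW.
by rewrite (le_trans (ltW (archi_boundP h0)))// ler_nat (leq_trans hn).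
Qed.

(** For $a\ne 0$, $x/(1-x\bar a)=\bar a^{-1}\bigl((1-x\bar a)^{-1}-1\bigr)$, and [h] itself is the
    member $a=0$ of the family. The case $a=0$ is then a limit of the others. *)
Lemma clspan_shift (x h : T -> C) K : cmeas x -> (forall t, nm (x t) = 1) -> cmeas h ->
  (forall t, nm (h t) <= K) ->
  (forall a, nm a < 1 -> M (fun t => (1 - x t * a^*)^-1 * h t)) ->
  forall a, nm a < 1 -> M (fun t => x t * ((1 - x t * a^*)^-1 * h t)).
Proof.
move=> mx x1 mh hK Mk.
have nz (a : C) t : nm a < 1 -> 1 - x t * a^* != 0.
  by move=> a1; rewrite nm_lt1_neq1// nmM nmJ x1 mul1r.
have Mh : M h.
  apply: clspan_ext (Mk 0 _) => [t|]; last by rewrite nm0.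
  by rewrite rmorph0 mulr0 subr0 invr1 mul1r.
have nonzero a : nm a < 1 -> a != 0 -> M (fun t => x t * ((1 - x t * a^*)^-1 * h t)).
  move=> a1 a0; apply: clspan_ext (clspanZ ((a^*)^-1) (clspan_lin (-1) Mh (Mk a a1))) => t.
  have nz' := nz a t a1; have ca0 : a^* != 0 by rewrite conjC_eq0.
  by field; rewrite ca0 nz'.
move=> a a1; have [->|] := eqVneq a 0; last exact: nonzero.
(* Nonzero, inside the disk, and with $b/(1-b)=1/(n+1)$, which gives the bound in [diff]. *)
pose b n : R := n.+2%:R^-1.
have b1 n : nm ((b n)%:C%C : C) < 1.
  by rewrite nm_real ger0_norm ?invr_ge0// invf_lt1 ?ltr1n.
have b0 n : (b n)%:C%C != 0 :> C by rewrite -nm_gt0 nm_real normr_gt0 invr_eq0 pnatr_eq0.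
have diff n t : nm (x t * ((1 - x t * 0^*)^-1 * h t) -
    x t * ((1 - x t * (b n)%:C%C^*)^-1 * h t)) <= K / n.+1%:R.
  have nz' := nz _ t (b1 n); rewrite rmorph0 mulr0 subr0 invr1 mul1r.
  have -> : x t * h t - x t * ((1 - x t * (b n)%:C%C^*)^-1 * h t) =
    h t * (- (x t) ^+ 2 * ((b n)%:C%C^* / (1 - x t * (b n)%:C%C^*))) by field.
  rewrite nmM ler_pM ?nm_ge0// !nmM nmN nmX x1 expr1n mul1r nmJ nm_real nmV.
  rewrite ger0_norm ?invr_ge0//.
  apply: (@le_trans _ _ (b n / (1 - b n))).
    rewrite ler_pM2l ?invr_gt0// lef_pV2 ?posrE ?nm_gt0//; last first.
      by rewrite subr_gt0 invf_lt1 ?ltr1n.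
    apply: le_trans (nm_subr _ _).
    by rewrite nm1 nmM nmJ x1 mul1r nm_real ger0_norm ?invr_ge0.
  rewrite /b -[n.+2%:R]natr1; have s0 : 0 < n.+1%:R :> R by [].
  move: (n.+1%:R) s0 => s s0; have s1 : s + 1 != 0 by rewrite gt_eqF// addr_gt0.
  have -> : 1 - (s + 1)^-1 = s / (s + 1).
    by rewrite -{1}(mulfV s1) -[X in _ - X]mul1r -mulrBl addrK.
  by rewrite invf_div mulrA mulVf// mul1r.
have K0 (t : T) : 0 <= K by rewrite (le_trans (nm_ge0 _) (hK t)).
apply: (clspan_dominated S_L2 (u := fun n t => x t * ((1 - x t * (b n)%:C%C^*)^-1 * h t))
    (w := fun=> 1) (K := K)).
- by move=> n; exact: nonzero.
- apply: (cmeasM mx); apply: (cmeasM _ mh); apply: cmeasV; apply: cmeasB.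
    exact: cmeas_cst.
  by apply: (cmeasM mx); exact: cmeas_cst.
- by apply: (@L2fun_bounded _ 1) => [|t]; [exact: cmeas_cst|rewrite nm1].
- move=> n t; rewrite nm1 mulr1 (le_trans (diff n t))// ler_pdivrMr// ler_peMr ?K0//.
  by rewrite ler1n.
apply: aeW => t e e0; have [n0 hn] := @inv_expn_cvg K e e0.
by exists n0 => n /hn; apply: le_trans; rewrite nm_distC.
Qed.

Lemma geom_partial_le (y : C) n : nm y <= 1 -> y != 1 ->
  nm (\sum_(k < n) y ^+ k) <= 2 / nm (1 - y).
Proof.
move=> y1 yn1; have d0 : 0 < nm (1 - y) by rewrite nm_gt0 subr_eq0 eq_sym.
rewrite ler_pdivlMr// -nmM.
have -> : (\sum_(k < n) y ^+ k) * (1 - y) = 1 - y ^+ n.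
  by rewrite mulrC -[X in X * _]opprB mulNr -subrX1 opprB.
by rewrite (le_trans (nmB _ _))// nm1 nmX -[2]/(1 + 1) lerD2l exprn_ile1 ?nm_ge0.
Qed.

(** The partial geometric sums are polynomials in [x], uniformly bounded because $|x\bar
    a|=|a|<1$. *)
Lemma multiplier_resolvent (x : T -> C) (a : C) : mult x -> (forall t, nm (x t) = 1) ->
  nm a < 1 -> mult (fun t => (1 - x t * a^*)^-1).
Proof.
move=> Mx x1 a1.
have xa t : nm (x t * a^*) = nm a by rewrite nmM nmJ x1 mul1r.
apply: (multiplier_cvg S_L2 (g := fun n t => \sum_(k < n) (x t * a^*) ^+ k)
  (K := 2 / (1 - nm a))).
- move=> n; apply: multiplier_sum => k; apply: multiplierX.
  by apply: multiplierM => //; exact: multiplier_cst.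
- move=> n t; apply: le_trans (geom_partial_le _ _ _) _; first by rewrite xa ltW.
    by rewrite eq_sym -subr_eq0 nm_lt1_neq1// xa.
  rewrite ler_pM2l// lef_pV2 ?posrE ?subr_gt0//; last first.
    by rewrite nm_gt0 nm_lt1_neq1// xa.
  by apply: le_trans (nm_subr _ _); rewrite nm1 xa.
- by move=> t; apply: geometric_cvg; rewrite xa.
Qed.

(* If [(1 - y) v] is in the span then so are the [(1 - y^k) v], whose Cesaro means
   tend to [v]. *)
Lemma clspan_divide (y v : T -> C) : mult y -> (forall t, nm (y t) <= 1) -> L2fun mu v ->
  {ae mu, forall t, y t <> 1} -> M (fun t => (1 - y t) * v t) -> M v.
Proof.
move=> My y1 Lv yn1 Mv; have [mv _] := Lv; have [my _ _] := My.
pose avg n t := (n.+1%:R)^-1 * \sum_(k < n.+1) y t ^+ k.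
(* Telescoping gives $(1-y)g_n=1-\mathrm{avg}_n$, so the multiplier [g n] sends $(1-y)v$ to $v$
   minus its Cesaro mean. *)
pose g n t := (n.+1%:R)^-1 * \sum_(k < n.+1) \sum_(i < k) y t ^+ i.
have gE n t : (g n t) * ((1 - y t) * v t) = v t - avg n t * v t.
  have h : (\sum_(k < n.+1) \sum_(i < k) y t ^+ i) * (1 - y t) =
      n.+1%:R - \sum_(k < n.+1) y t ^+ k.
    have -> : n.+1%:R = \sum_(k < n.+1) 1 :> C by rewrite sumr_const card_ord.
    rewrite mulr_suml -sumrB.
    by apply: eq_bigr => k _; rewrite mulrC -[X in X * _]opprB mulNr -subrX1 opprB.
  have nz : n.+1%:R != 0 :> C by rewrite pnatr_eq0.
  rewrite /g /avg; move: h nz; move: (\sum_(k < n.+1) _) (\sum_(k < n.+1) _) (n.+1%:R) => A B c h nz.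
  by rewrite [LHS]mulrA -[_ * B * _]mulrA h mulrBr mulVf// mulrBl mul1r.
have Mg n : mult (g n).
  apply: multiplierZ; apply: multiplier_sum => k; apply: multiplier_sum => i.
  exact: multiplierX.
have avg1 n t : nm (avg n t) <= 1.
  rewrite nmM nmV nm_nat mulrC ler_pdivrMr// mul1r (le_trans (nm_sum _ _ _))//.
  have -> : n.+1%:R = \sum_(k < n.+1) 1 :> R by rewrite sumr_const card_ord.
  apply: ler_sum => k _.
  by rewrite nmX exprn_ile1 ?nm_ge0.
apply: (clspan_dominated S_L2 (u := fun n t => v t - avg n t * v t) (w := v) (K := 1)) => //.
- by move=> n; have [_ _ /(_ _ Mv)] := Mg n; apply: clspan_ext => t; rewrite gE.
- move=> n t; rewrite opprB addrC subrK nmM ler_wpM2r ?nm_ge0//.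
apply: filterS yn1 => t /eqP yt e e0.
have [n0 hn] := inv_expn_cvg (2 / nm (1 - y t) * nm (v t)) e0.
exists n0 => n /hn; apply: le_trans.
rewrite addrAC subrr sub0r nmN !nmM nmV nm_nat [leRHS]mulrC -mulrA.
rewrite ler_wpM2l ?invr_ge0// ler_wpM2r ?nm_ge0//.
exact: geom_partial_le.
Qed.

(** One factor is removed at a time; the product of the remaining ones is a bounded multiplier,
    which keeps the intermediate functions in $L^2$. *)
Lemma clspan_divide_seq (s : seq C) (y v : T -> C) : mult y -> (forall t, nm (y t) = 1) ->
  {in s, forall b, nm b <= 1} -> L2fun mu v ->
  (forall b, b \in s -> {ae mu, forall t, b * y t <> 1}) ->
  M (fun t => (\prod_(b <- s) (1 - b * y t)) * v t) -> M v.
Proof.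
move=> My y1; elim: s => [|b s IH] hs Lv hb.
  by apply: clspan_ext => t; rewrite big_nil mul1r.
move=> Mv; have b1 : nm b <= 1 by apply: hs; rewrite inE eqxx.
have by1 t : nm (b * y t) <= 1 by rewrite nmM y1 mulr1.
apply: IH => //.
- by move=> c cs; apply: hs; rewrite inE cs orbT.
- by move=> c cs; apply: hb; rewrite inE cs orbT.
have Mby : mult (fun t => b * y t) by exact: multiplierZ.
have Mp : mult (fun t => \prod_(c <- s) (1 - c * y t)).
  elim: s {hs hb Mv} => [|c s IHs].
    by apply: multiplier_ext (multiplier1 mu S) => t; rewrite big_nil.
  apply: multiplier_ext (multiplierM (multiplier_lin (- c) My (multiplier1 mu S)) IHs) => t.
  by rewrite big_cons mulNr addrC.
have [mp [K pK] _] := Mp; have [mv _] := Lv.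
apply: (clspan_divide Mby by1).
- apply: (@L2fun_le _ _ _ _ K _ v) => //; first exact: cmeasM.
  by move=> t; rewrite nmM ler_wpM2r ?nm_ge0.
- by apply: hb; rewrite inE eqxx.
- by apply: clspan_ext Mv => t; rewrite big_cons mulrA.
Qed.

(* On the zero set of [q], [conj x * q0 y] is a polynomial in [x] and [y], where [q0] is
   the constant coefficient of [q]; and [q0] can be divided out. *)
Lemma clspan_conj (x y : T -> C) (q : {poly {poly C}}) : mult x -> mult y ->
  (forall t, nm (x t) = 1) -> (forall t, nm (y t) = 1) -> M (fun=> 1) ->
  {ae mu, forall t, eval2 q (x t, y t) = 0} ->
  (forall z, nm z < 1 -> (q`_0).[z] != 0) ->
  (forall tau, nm tau = 1 -> {ae mu, forall t, y t <> tau}) ->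
  M (fun t => (x t)^*).
Proof.
move=> Mx My x1 y1 M1 q0 qz yt.
have [mx _ _] := Mx.
have mcx : cmeas (fun t => (x t)^*) by exact: cmeas_conj.
have Lcx : L2fun mu (fun t => (x t)^*).
  by apply: (@L2fun_bounded _ 1) => // t; rewrite nmJ x1.
have [s [_ hs defq]] := zero_free_factor qz.
have q00 : (q`_0).[0] != 0 by apply: qz; rewrite nm0.
have Mpoly (r : {poly C}) : mult (fun t => r.[y t]).
  apply: multiplier_ext (multiplier_sum (index_enum 'I_(size r)) (fun k : 'I_(size r) =>
    multiplierZ (r`_k) (multiplierX k My))) => t.
  by rewrite horner_coef.
apply: (clspan_divide_seq My y1 hs Lcx).
  (* A factor with $|b|<1$ never vanishes on the circle; one with $|b|=1$ vanishes only on the slice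
     $y=b^{-1}$, which is null by hypothesis. *)
  move=> b bs; have b1 := hs b bs.
  have [bl|bl] := ltP (nm b) 1.
    apply: aeW => t h; have := congr1 nm h.
    by rewrite nm1 nmM y1 mulr1 => h'; rewrite h' ltxx in bl.
  have nb : nm b = 1 by apply/eqP; rewrite eq_le b1 bl.
  have b0 : b != 0 by rewrite -nm_gt0 nb.
  apply: filterS (yt b^-1 _); last by rewrite nmV nb invr1.
  by move=> t h h'; apply: h; apply: (mulfI b0); rewrite h' mulfV.
(* The function $-q_1/q_0(0)$, where $q=q_0+xq_1$. On $\{q=0\}$ it equals $\bar x\prod(1-by)$,
   because $q_0=q_0(0)\prod(1-by)$. *)
have Mr : M (fun t => (- ((q`_0).[0])^-1) *
    ((\sum_(j < (size q).-1) x t ^+ j * (q`_j.+1).[y t]) * 1)).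
  apply: clspanZ.
  have [_ _ /(_ _ M1)] := multiplier_sum (index_enum 'I_(size q).-1)
    (fun j : 'I_(size q).-1 => multiplierM (multiplierX j Mx) (Mpoly q`_j.+1)).
  by [].
apply: (clspan_ae S_L2 Mr).
  apply: cmeasM => //; elim: s {hs defq} => [|c s IHs].
    by apply: (cmeas_ext (u := fun=> 1)) => [t|]; [rewrite big_nil|exact: cmeas_cst].
  have [my _ _] := My.
  apply: (cmeas_ext (u := fun t => (1 - c * y t) * \prod_(b <- s) (1 - b * y t))).
    by move=> t; rewrite big_cons.
  apply: cmeasM IHs; apply: cmeasB; first exact: cmeas_cst.
  exact: cmeasZ.
apply: filterS q0 => t qt.
have x0 : x t != 0 by rewrite -nm_gt0 x1.
have e1 : (q`_0).[y t] + x t * (\sum_(j < (size q).-1) x t ^+ j * (q`_j.+1).[y t]) = 0.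
  apply: etrans qt; rewrite /eval2 /= (horner_coef q) horner_sum.
  have sq0 : (0 < size q)%N.
    by rewrite lt0n size_poly_eq0; apply: contra_neq q00 => ->; rewrite coef0 horner0.
  rewrite -[in RHS](prednK sq0) big_ord_recl /= expr0 mulr1 mulr_sumr; congr (_ + _).
  apply: eq_bigr => j _; rewrite /bump /= add1n hornerM -polyC_exp hornerC exprS; ring.
have e2 : (q`_0).[y t] = (q`_0).[0] * \prod_(b <- s) (1 - b * y t).
  rewrite {1}defq hornerZ horner_prod; congr (_ * _).
  by apply: eq_bigr => b _; rewrite !hornerE.
rewrite mulr1; apply: (mulfI q00); rewrite mulrA -e2 conj_unit//.
have -> : (q`_0).[y t] = - (x t * \sum_(j < (size q).-1) x t ^+ j * (q`_j.+1).[y t]).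
  by apply/eqP; rewrite -addr_eq0 e1.
by rewrite mulrA mulrN mulfV// mulN1r mulNr mulrAC mulfV// mul1r.
Qed.

End SpanTools.

Section TorusDensity.
Variable R : realType.
Local Notation C := R[i].
Local Notation T := (borel_torus R).

Definition kernel_set (v : T -> C) : Prop :=
  exists w : C * C, [/\ nm w.1 < 1, nm w.2 < 1 & v = fun t => cauchy_kernel w (pt t)].

Lemma pt_torus (t : T) : nm (pt t).1 = 1 /\ nm (pt t).2 = 1.
Proof. by have [/norm_eq1 ? /norm_eq1 ?] := set_valP (t : torus R). Qed.

Lemma cmeas_pt1 : cmeas (fun t : T => (pt t).1).
Proof. by split; [exact: (measurable_coord true true)|exact: (measurable_coord true false)]. Qed.

Lemma cmeas_pt2 : cmeas (fun t : T => (pt t).2).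
Proof. by split; [exact: (measurable_coord false true)|exact: (measurable_coord false false)]. Qed.

Lemma cmeas_resolvent (e : T -> C) (a : C) : cmeas e -> cmeas (fun t => (1 - e t * a^*)^-1).
Proof.
move=> me; apply: cmeasV; apply: cmeasB; first exact: cmeas_cst.
by apply: (cmeasM me); exact: cmeas_cst.
Qed.

Lemma resolvent_bounded (e : T -> C) (a : C) : (forall t, nm (e t) = 1) -> nm a < 1 ->
  forall t, nm (1 - e t * a^*)^-1 <= (1 - nm a)^-1.
Proof.
move=> e1 a1 t; have ea : nm (e t * a^*) = nm a by rewrite nmM nmJ e1 mul1r.
rewrite nmV lef_pV2 ?posrE ?subr_gt0//; last by rewrite nm_gt0 nm_lt1_neq1// ea.
by apply: le_trans (nm_subr _ _); rewrite nm1 ea.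
Qed.

Variable mu : {measure set T -> \bar R}.
Hypothesis mu_fin : (mu setT < +oo)%E.
Local Notation M := (clspan mu kernel_set).
Local Notation mult := (multiplier mu kernel_set).

Lemma kernel_set_L2 v : kernel_set v -> L2fun mu v.
Proof.
move=> [w [w1 w2 ->]]; have [K hK] := kernel_bounded w1 w2.
apply: (L2fun_bounded mu_fin (K := K)).
  by apply: cmeasM; apply: cmeas_resolvent; [exact: cmeas_pt1|exact: cmeas_pt2].
by move=> t; have [h1 h2] := pt_torus t; apply: hK; rewrite ?h1 ?h2.
Qed.

Lemma clspan_kernel1 : M (fun=> 1).
Proof.
apply: clspan_base; exists (0, 0).
have n0 : nm (0 : C) < 1 by rewrite nm0.
split; [exact: n0|exact: n0|].
by apply/funext => t; rewrite /cauchy_kernel/= rmorph0 !mulr0 subr0 invr1 mulr1.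
Qed.

Lemma multiplier_pt1 : mult (fun t => (pt t).1).
Proof.
apply: (multiplier_base kernel_set_L2 (K := 1)); first exact: cmeas_pt1.
  by move=> t; have [-> _] := pt_torus t.
move=> v [w [w1 w2 ->]].
apply: (clspan_shift mu_fin kernel_set_L2 (h := fun t : T => (1 - (pt t).2 * w.2^*)^-1)
   (K := (1 - nm w.2)^-1) cmeas_pt1) w1.
- by move=> t; have [] := pt_torus t.
- exact: (cmeas_resolvent _ cmeas_pt2).
- by apply: resolvent_bounded => // t; have [] := pt_torus t.
- by move=> a a1; apply: clspan_base; exists (a, w.2).
Qed.

Lemma multiplier_pt2 : mult (fun t => (pt t).2).
Proof.
apply: (multiplier_base kernel_set_L2 (K := 1)); first exact: cmeas_pt2.
  by move=> t; have [_ ->] := pt_torus t.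
move=> v [w [w1 w2 ->]].
apply: (clspan_ext (u := fun t : T => (pt t).2 *
  ((1 - (pt t).2 * w.2^*)^-1 * (1 - (pt t).1 * w.1^*)^-1))).
  by move=> t; rewrite /cauchy_kernel [X in _ * X]mulrC.
apply: (clspan_shift mu_fin kernel_set_L2 (h := fun t : T => (1 - (pt t).1 * w.1^*)^-1)
   (K := (1 - nm w.1)^-1) cmeas_pt2) w2.
- by move=> t; have [] := pt_torus t.
- exact: (cmeas_resolvent _ cmeas_pt1).
- by apply: resolvent_bounded => // t; have [] := pt_torus t.
- move=> a a1; apply: clspan_base; exists (w.1, a); split => //.
  by apply/funext => t; rewrite /cauchy_kernel mulrC.
Qed.

Lemma multiplier_kernel w : nm w.1 < 1 -> nm w.2 < 1 -> mult (fun t => cauchy_kernel w (pt t)).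
Proof.
move=> w1 w2; apply: multiplierM.
  by apply: (multiplier_resolvent kernel_set_L2 multiplier_pt1) => // t; have [] := pt_torus t.
by apply: (multiplier_resolvent kernel_set_L2 multiplier_pt2) => // t; have [] := pt_torus t.
Qed.

(** The kernels are multipliers, so $gC_w$ lies in the span as soon as [g] does; this is what
    upgrades membership of $\bar\zeta_j$ in the span to stability under it. *)
Lemma multiplier_of_clspan g K : (forall t, nm (g t) <= K) -> M g -> mult g.
Proof.
move=> gK Mg; have [mg _] := clspan_L2 kernel_set_L2 Mg.
apply: (multiplier_base kernel_set_L2 mg gK) => v [w [w1 w2 ->]].
have [_ _ /(_ _ Mg)] := multiplier_kernel w1 w2.
by apply: clspan_ext => t; rewrite mulrC.
Qed.

Lemma kernel_span_dense (q : {poly {poly C}}) :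
  {ae mu, forall t, eval2 q (pt t) = 0} ->
  (forall z, nm z < 1 -> (q`_0).[z] != 0) ->
  (forall z, nm z < 1 -> ((swapXY q)`_0).[z] != 0) ->
  (forall tau, nm tau = 1 -> {ae mu, forall t, (pt t).1 <> tau}) ->
  (forall tau, nm tau = 1 -> {ae mu, forall t, (pt t).2 <> tau}) ->
  forall v, L2fun mu v -> M v.
Proof.
move=> q0 q1 q2 h1 h2.
have e1 t : nm (pt t).1 = 1 := (pt_torus t).1.
have e2 t : nm (pt t).2 = 1 := (pt_torus t).2.
have Mc1 : mult (fun t => ((pt t).1)^*).
  apply: (multiplier_of_clspan (K := 1)) => [t|]; first by rewrite nmJ e1.
  apply: (clspan_conj mu_fin kernel_set_L2 (y := fun t => (pt t).2) (q := q)) => //.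
  - exact: multiplier_pt1.
  - exact: multiplier_pt2.
  - exact: clspan_kernel1.
have Mc2 : mult (fun t => ((pt t).2)^*).
  apply: (multiplier_of_clspan (K := 1)) => [t|]; first by rewrite nmJ e2.
  apply: (clspan_conj mu_fin kernel_set_L2 (y := fun t => (pt t).1) (q := swapXY q)) => //.
  - exact: multiplier_pt2.
  - exact: multiplier_pt1.
  - exact: clspan_kernel1.
  - by apply: filterS q0 => t; rewrite /eval2 horner2_swapXY.
have Mcoord a b : mult (fun t => (coord a b (pt t))%:C%C).
  have aux (x : T -> C) : mult x -> mult (fun t => (x t)^*) ->
      mult (fun t => (if b then complex.Re (x t) else complex.Im (x t))%:C%C).
    move=> Mx Mcx; case: b.
      apply: multiplier_ext (multiplierZ (2^-1) (multiplierD Mx Mcx)) => t.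
      rewrite /GRing.mul/=; case: (x t) => u v /=.
      by apply/eqP; rewrite eq_complex /=; apply/andP; split; apply/eqP; field.
    apply: multiplier_ext (multiplierZ ((2 * 'i%C)^-1) (multiplier_lin (-1) Mcx Mx)) => t.
    have i0 : 'i%C != 0 :> C by rewrite -nm_gt0 /= expr0n/= add0r expr1n sqrtr1.
    rewrite -[LHS]mulrC; apply: (mulIf (x := 2 * 'i%C)); first by rewrite mulf_neq0 ?pnatr_eq0.
    rewrite mulfVK ?mulf_neq0 ?pnatr_eq0//.
    by case: (x t) => u v; apply/eqP; rewrite eq_complex /=; apply/andP; split; apply/eqP; ring.
  by rewrite /coord; case: a; apply: aux => //; [exact: multiplier_pt1|exact: multiplier_pt2].
have cle1 a b (t : T) : `|coord a b (pt t)| <= 1.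
  rewrite /coord; case: a; case: b.
  - by rewrite (le_trans (nm_Re _))// e1.
  - by rewrite (le_trans (nm_Im _))// e1.
  - by rewrite (le_trans (nm_Re _))// e2.
  - by rewrite (le_trans (nm_Im _))// e2.
apply: (clspan_dense kernel_set_L2) => //; last exact: clspan_kernel1.
(* The factor $(1+|c|)^{-1}$ brings the affine function into $[-1,1]$, where the sign iteration
   converges; $s=\pm1$ selects the side of the half-space. *)
have half (s c : R) a b : `|s| = 1 -> good_set mu kernel_set [set t | 0 < s * (coord a b (pt t) - c)].
  move=> s1; have d0 : 0 < 1 + `|c| by rewrite ltr_pwDl.
  have -> : [set t | 0 < s * (coord a b (pt t) - c)] =
      [set t : T | 0 < (1 + `|c|)^-1 * (s * (coord a b (pt t) - c))].
    have k0 : 0 < (1 + `|c|)^-1 by rewrite invr_gt0.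
    by apply/seteqP; split=> t /=; rewrite (pmulr_rgt0 _ k0).
  apply: (good_set_gt0 kernel_set_L2).
  - move=> t; rewrite normrM normfV (gtr0_norm d0) normrM s1 mul1r mulrC ler_pdivrMr// mul1r.
    by rewrite (le_trans (ler_normB _ _))// lerD2r.
  - apply: multiplier_ext (multiplierZ ((1 + `|c|)^-1 * s)%:C%C
      (multiplierD (Mcoord a b) (multiplier_cst _ _ (- c)%:C%C))) => t.
    by rewrite -rmorphD -rmorphM mulrA.
  - have mf : measurable_fun setT (fun t : T => (1 + `|c|)^-1 * (s * (coord a b (pt t) - c))).
      apply: measurable_funM => //; apply: measurable_funM => //; apply: measurable_funB => //.
      exact: measurable_coord.
    rewrite -[X in measurable X]setTI.
    have := measurable_fun_ltr (measurable_cst (0 : R)) mf.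
    by move=> /(_ measurableT [set true]) ; apply.
apply: borel_torus_ind.
- exact: good_setC.
- exact: good_setI.
- exact: good_set0.
- exact: (good_bigcup kernel_set_L2).
- move=> a b c; have := half 1 c a b; rewrite normr1 => /(_ erefl).
  by under eq_set do rewrite mul1r.
- move=> a b c; have := half (-1) c a b; rewrite normrN1 => /(_ erefl).
  by under eq_set do rewrite mulN1r opprB.
Qed.

End TorusDensity.

(** * The Clark measure *)

Lemma swapXY_unit (F : idomainType) (d : {poly {poly F}}) :
  swapXY d \is a GRing.unit -> d \is a GRing.unit.
Proof.
move=> h; have := mulrV h => /(congr1 (@swapXY F)).
have [hM h1] := swapXY_is_multiplicative F.
rewrite hM h1 swapXYK => E; apply/unitrPr; exists (swapXY (swapXY d)^-1).
exact: E.
Qed.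

Section Slices.
Variable R : realType.
Local Notation C := R[i].

(** Each factor satisfies $|1-bx|\ge 1-|x|$. The constant depends on the degree and on $|x|$ only,
    so it survives a limit of zero-free polynomials of bounded degree. *)
Lemma harnack_ge (P : {poly C}) n x : (forall z, nm z < 1 -> P.[z] != 0) ->
  ((size P).-1 <= n)%N -> nm x <= 1 -> nm P.[0] * (1 - nm x) ^+ n <= nm P.[x].
Proof.
move=> /zero_free_factor[s [ss hs defP]] sn x1.
rewrite [in leRHS]defP hornerZ horner_prod nmM nm_prod ler_wpM2l ?nm_ge0//.
have c0 : 0 <= 1 - nm x by rewrite subr_ge0.
have c1 : 1 - nm x <= 1 by rewrite gerBl nm_ge0.
apply: (@le_trans _ _ ((1 - nm x) ^+ size s)).
  by rewrite ler_wiXn2l// (leq_trans ss).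
elim: s hs {ss defP} => [|b s IH] hs; first by rewrite big_nil expr0.
rewrite big_cons exprS ler_pM ?exprn_ge0//.
  have /hs b1 : b \in b :: s by rewrite inE eqxx.
  rewrite !hornerE (le_trans _ (nm_subr _ _))// nm1 nmM lerD2l lerN2.
  by rewrite ler_piMl ?nm_ge0.
by apply: IH => y ys; apply: hs; rewrite inE ys orbT.
Qed.

Lemma le0_linear (A K : R) : (forall r, 0 <= r < 1 -> A <= K * (1 - r)) -> A <= 0.
Proof.
move=> h; apply/ler_addgt0Pr => e e0; rewrite add0r.
have k0 : 0 < 1 + `|K| by rewrite ltr_pwDl.
pose d := Num.min 1 (e / (1 + `|K|)).
have d0 : 0 < d by rewrite lt_min ltr01 divr_gt0.
have d1 : d <= 1 by rewrite ge_min lexx.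
have de : d <= e / (1 + `|K|) by rewrite ge_min lexx orbT.
have := h (1 - d); rewrite subr_ge0 d1 gtrBl d0 => /(_ isT).
have -> : 1 - (1 - d) = d by rewrite opprB addrC subrK.
move=> h1; apply: (le_trans h1); apply: (@le_trans _ _ ((1 + `|K|) * d)).
  by rewrite ler_pM2r// (le_trans (ler_norm K))// lerDr.
by rewrite -ler_pdivlMl// mulrC.
Qed.

(* Harnack's inequality on the slices [Q(., r tau)], uniformly in [r]. *)
Lemma slice_eq0 (Q : {poly {poly C}}) (tau x0 : C) :
  (forall z, nm z.1 < 1 -> nm z.2 < 1 -> eval2 Q z != 0) ->
  nm tau = 1 -> nm x0 < 1 -> eval2 Q (x0, tau) = 0 ->
  forall x, nm x <= 1 -> eval2 Q (x, tau) = 0.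
Proof.
move=> hQ tau1 x01 Q0 x x1.
have [L [L0 hL]] := eval2_lipschitz Q.
pose d := (size Q).-1.
have c0 : 0 < (1 - nm x0) ^+ d by rewrite exprn_gt0// subr_gt0.
suff : nm (eval2 Q (x, tau)) * (1 - nm x0) ^+ d <= 0.
  by rewrite pmulr_lle0// => h; apply/eqP; rewrite -nm_eq0 eq_le h nm_ge0.
apply: (@le0_linear _ (L * 2 ^+ d + L * (1 - nm x0) ^+ d)) => r /andP[r0 r1].
pose y := r%:C%C * tau; pose P := map_poly (horner_eval y) Q.
have y1 : nm y = r by rewrite nmM tau1 mulr1 nm_real ger0_norm.
have hP z : nm z < 1 -> P.[z] != 0.
  by move=> z1; rewrite eval2_horner_map hQ//= y1.
have sP : ((size P).-1 <= d)%N by rewrite /d -2!subn1; apply: leq_sub2r; exact: size_poly.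
have lo := harnack_ge hP sP (ltW x01).
have hi := harnack_le hP sP x1.
have dist (u : C) : nm u <= 1 -> nm (eval2 Q (u, tau) - P.[u]) <= L * (1 - r).
  move=> u1; rewrite eval2_horner_map.
  have h1 : closed_bidisk (u, tau) by split; rewrite //= tau1.
  have h2 : closed_bidisk (u, y) by split; rewrite //= y1 ltW.
  apply: le_trans (hL _ _ h1 h2) _.
  by rewrite ler_wpM2l//= subrr nm0 add0r nm_sub_dilate// ltW.
have dx := dist _ x1; have d0 := dist _ (ltW x01); rewrite Q0 sub0r nmN in d0.
have up : nm (eval2 Q (x, tau)) <= nm P.[x] + L * (1 - r).
  by rewrite -[X in nm X](subrK P.[x]) addrC (le_trans (nmD _ _))// lerD2l.
have key : nm P.[x] * (1 - nm x0) ^+ d <= L * (1 - r) * 2 ^+ d.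
  apply: (@le_trans _ _ (nm P.[0] * (1 - nm x0) ^+ d * 2 ^+ d)).
    by rewrite mulrAC ler_pM2r.
  by rewrite ler_pM2r ?exprn_gt0// (le_trans lo).
have := ler_wpM2r (ltW c0) up; rewrite mulrDl => h; apply: (le_trans h).
rewrite mulrDl; apply: lerD; first by rewrite (le_trans key)// mulrAC.
by rewrite mulrAC.
Qed.

(** The points $1/(k+2)$ of the disk already provide more distinct roots than the degree allows. *)
Lemma poly_eq0_disk (P : {poly C}) : (forall x, nm x < 1 -> P.[x] = 0) -> P = 0.
Proof.
move=> h; apply/eqP; rewrite -[_ == _]negbK; apply/negP => P0.
pose s : seq C := [seq (k.+2%:R)^-1 | k <- iota 0 (size P)].
have us : uniq s.
  rewrite map_inj_uniq ?iota_uniq// => j k /invr_inj/eqP.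
  by rewrite eqr_nat => /eqP[].
have rs : all (root P) s.
  apply/allP => _ /mapP[k _ ->]; apply/eqP/h.
  by rewrite nmV nm_nat invf_lt1 ?ltr1n.
by have := max_poly_roots P0 rs us; rewrite size_map size_iota ltnn.
Qed.

(** All coefficients in $z_1$ vanish at $z_2=\tau$, so each is divisible by $z_2-\tau$. The inner
    variable being $z_2$, that factor is the constant polynomial [('X - tau%:P)%:P]. *)
Lemma slice_factor (Q : {poly {poly C}}) (tau : C) :
  (forall x, nm x < 1 -> eval2 Q (x, tau) = 0) ->
  exists u, Q = ('X - tau%:P)%:P * u.
Proof.
move=> h; have E : map_poly (horner_eval tau) Q = 0.
  by apply: poly_eq0_disk => x x1; rewrite eval2_horner_map h.
exists (map_poly (fun c : {poly C} => c %/ ('X - tau%:P)) Q).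
apply/polyP => j; rewrite coefCM coef_map_id0 ?div0p// mulrC divpK//.
by rewrite dvdp_XsubCl /root -[_.[_]]/(horner_eval tau _) -coef_map E coef0.
Qed.

Lemma eval2_swap (Q : {poly {poly C}}) z : eval2 (swapXY Q) z = eval2 Q (z.2, z.1).
Proof. by rewrite /eval2 horner2_swapXY. Qed.

Lemma reflect_swap m n (Q : {poly {poly C}}) :
  reflect_poly n m (swapXY Q) = swapXY (reflect_poly m n Q).
Proof.
apply/polyP => k; apply/polyP => j.
rewrite coef_swapXY /reflect_poly !coef_poly.
case: (ltnP k n.+1) => kn; case: (ltnP j m.+1) => jm;
  rewrite ?coef0 ?coef_poly ?kn ?jm ?coef_swapXY//.
- by rewrite ltnNge jm.
- by rewrite ltnNge kn.
Qed.

Lemma rif_denominator_swap m n (Q : {poly {poly C}}) :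
  rif_denominator m n Q -> rif_denominator n m (swapXY Q).
Proof.
move=> [[sQ sY] hQ ncf]; split.
- by split; [rewrite -sizeYE|rewrite sizeYE swapXYK].
- by move=> z [z1 z2]; rewrite eval2_swap; apply: hQ.
- move=> d u v; rewrite reflect_swap => /(congr1 (@swapXY _)); rewrite swapXYK rmorphM /= => h1.
  move=> /(congr1 (@swapXY _)); rewrite swapXYK rmorphM /= => h2.
  by apply: swapXY_unit; exact: ncf h1 h2.
Qed.

(** A zero of the denominator inside the slice would make it vanish on the whole slice, and with it
    the reflected polynomial; both would then have the factor $z_2-\tau$. Hence the polynomial
    identity can be divided. *)
Lemma slice_exceptional m n (Q : {poly {poly C}}) (tau alpha : C) :
  rif_denominator m n Q -> nm tau = 1 ->
  (forall x, nm x < 1 -> eval2 (reflect_poly m n Q) (x, tau) = alpha * eval2 Q (x, tau)) ->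
  forall x, nm x < 1 -> rif m n Q (x, tau) = alpha.
Proof.
move=> hQ tau1 h x x1; rewrite /rif h// mulfK//; apply/eqP => Q0.
have h0 := slice_eq0 (rif_den_neq0 hQ) tau1 x1 Q0.
have [u Eu] : exists u, Q = ('X - tau%:P)%:P * u.
  by apply: slice_factor => y y1; rewrite h0// ltW.
have [v Ev] : exists v, reflect_poly m n Q = ('X - tau%:P)%:P * v.
  by apply: slice_factor => y y1; rewrite h// h0 ?mulr0// ltW.
have [_ _ /(_ _ _ _ Eu Ev)] := hQ.
by rewrite poly_unitE coefC /= poly_unitE size_XsubC andbF.
Qed.

End Slices.

(** * Sums of Poisson kernels over roots of unity *)

Section PoissonMeans.
Variable R : realType.
Local Notation C := R[i].

Definition poisson1 (x e : C) : R := (1 - nm x ^+ 2) / nm (e - x) ^+ 2.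

Lemma poisson1_ge0 x e : nm x < 1 -> 0 <= poisson1 x e.
Proof. by move=> x1; rewrite divr_ge0 ?sqr_ge0// subr_ge0 expr_le1 ?nm_ge0 ?ltW. Qed.

Lemma poisson1E (x e : C) : nm e = 1 -> nm x < 1 ->
  (poisson1 x e)%:C%C = (1 - x * e^*)^-1 + ((1 - x * e^*)^-1)^* - 1.
Proof.
move=> e1 x1; set b := x * e^*.
have b1 : nm b = nm x by rewrite nmM nmJ e1 mulr1.
have eb : nm (e - x) = nm (1 - b).
  rewrite -[LHS]mul1r -{1}e1 -(nmJ e) -nmM mulrBr mulrC -sqr_nm_conj e1 expr1n.
  by rewrite mulrC.
have nb : 1 - b != 0 by rewrite nm_lt1_neq1// b1.
have nbc : 1 - b^* != 0 by rewrite nm_lt1_neq1// nmJ b1.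
have -> : (poisson1 x e)%:C%C = (1 - b * b^*) / ((1 - b) * (1 - b^*)).
  have -> : 1 - b^* = (1 - b)^* by rewrite rmorphB rmorph1.
  rewrite -!sqr_nm_conj b1 -eb -(rmorph1 (real_complex R)) -(rmorphB (real_complex R)).
  by rewrite -(fmorphV (real_complex R)) -(rmorphM (real_complex R)).
have -> : ((1 - b)^-1)^* = (1 - b^*)^-1 by rewrite fmorphV rmorphB rmorph1.
by move: (b^*) nb nbc => c nb nbc; field; rewrite nb nbc.
Qed.

(** Written through resolvents, the sum is exactly $N$ times the Poisson kernel at $B=(r\bar e)^N$.
    For $|B|\le 1/2$ it lies between $(1-|B|)/(1+|B|)\ge 1/3$ and $(1+|B|)/(1-|B|)\le 3$. *)
Lemma sum_poisson1 N (z e : C) (r : R) : N.-primitive_root z -> nm e = 1 -> 0 <= r < 1 ->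
  r ^+ N <= 1 / 2 ->
  N%:R / 3 <= \sum_(i < N) poisson1 (r%:C%C * z ^+ i) e <= 3 * N%:R.
Proof.
move=> zP e1 /andP[r0 r1] rN; set B := (r%:C%C * e^*) ^+ N.
have nB : nm B = r ^+ N by rewrite nmX nmM nmJ e1 mulr1 nm_real ger0_norm.
have B1 : nm B < 1 by rewrite nB (le_lt_trans rN)//; lra.
have nr i : nm (r%:C%C * z ^+ i) < 1 by rewrite nmM (nm_root zP) mulr1 nm_real ger0_norm.
have nre : nm (r%:C%C * e^*) < 1 by rewrite nmM nmJ e1 mulr1 nm_real ger0_norm.
have -> : \sum_(i < N) poisson1 (r%:C%C * z ^+ i) e = N%:R * poisson1 B 1.
  apply: (@complexI R); rewrite rmorphM rmorph_nat rmorph_sum /=.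
  have E i : (poisson1 (r%:C%C * z ^+ i) e)%:C%C =
      (1 - r%:C%C * e^* * z ^+ i)^-1 + ((1 - r%:C%C * e^* * z ^+ i)^-1)^* - 1.
    by rewrite poisson1E// mulrAC.
  rewrite (eq_bigr _ (fun i _ => E (val i))) sumrB big_split /= -rmorph_sum.
  rewrite (sum_resolvent zP nre) -/B poisson1E ?nm1// rmorph1 mulr1.
  rewrite sumr_const card_ord !rmorphM /= rmorph_nat mulrBr mulrDr mulr1.
  by [].
have s0 : 0 <= nm B := nm_ge0 B; have s1 : nm B <= 1 / 2 by rewrite nB.
have lo : 1 - nm B <= nm (1 - B) by rewrite -{1}nm1 nm_subr.
have hi : nm (1 - B) <= 1 + nm B by rewrite -[in leRHS](nm1 R) nmB.
have N0 : 0 < N%:R :> R by rewrite ltr0n (prim_order_gt0 zP).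
rewrite [3 * _]mulrC !(ler_pM2l N0).
move: s0 s1 lo hi; rewrite /poisson1; move: (nm B) (nm (1 - B)) => s t s0 s1 lo hi.
have t0 : 0 < t ^+ 2 by rewrite exprn_gt0//; lra.
rewrite ler_pdivlMr// ler_pdivrMr//; apply/andP; split; nra.
Qed.

End PoissonMeans.

Section PoissonIntegrals.
Variable R : realType.
Local Notation C := R[i].
Local Notation T := (borel_torus R).
Implicit Types (z w : C * C) (t : T).

Lemma poisson_kernelE z t :
  poisson_kernel z t = poisson1 z.1 (pt t).1 * poisson1 z.2 (pt t).2.
Proof. by []. Qed.

Lemma poisson_ge0 z t : nm z.1 < 1 -> nm z.2 < 1 -> 0 <= poisson_kernel z t.
Proof. by move=> z1 z2; rewrite poisson_kernelE mulr_ge0// poisson1_ge0. Qed.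

Lemma measurable_poisson z : measurable_fun setT (fun t => poisson_kernel z t).
Proof.
have aux (e : T -> C) (x : C) : cmeas e -> measurable_fun setT (fun t => poisson1 x (e t)).
  move=> me; apply: measurable_funM; first exact: measurable_cst.
  apply: measurable_inv_ge0; first by move=> t; rewrite sqr_ge0.
  by apply: measurable_sqr_nm; apply: cmeasB => //; exact: cmeas_cst.
apply: measurable_funM; apply: aux; [exact: cmeas_pt1|exact: cmeas_pt2].
Qed.

Lemma poisson1_lower (x e : C) : nm x < 1 -> nm e = 1 -> (1 - nm x ^+ 2) / 4 <= poisson1 x e.
Proof.
move=> x1 e1; have x2 : 0 <= 1 - nm x ^+ 2 by rewrite subr_ge0 expr_le1 ?nm_ge0 ?ltW.
have lo : 0 < nm (e - x).
  by apply: lt_le_trans (nm_subr _ _); rewrite e1 subr_gt0.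
have hi : nm (e - x) <= 2.
  by rewrite (le_trans (nmB _ _))// e1 -[2]/(1 + 1 : R) lerD2l ltW.
rewrite ler_wpM2l// lef_pV2 ?posrE ?exprn_gt0//.
have -> : 4 = 2 ^+ 2 :> R by rewrite expr2; lra.
by rewrite ler_sqr ?nnegrE ?nm_ge0.
Qed.

Lemma poisson1_radial (r : R) (tau : C) : 0 <= r < 1 -> nm tau = 1 ->
  (1 - r)^-1 <= poisson1 (r%:C%C * tau) tau.
Proof.
move=> /andP[r0 r1] tau1; rewrite /poisson1 (nm_sub_dilate (ltW r1) tau1) nmM nm_real tau1 mulr1.
rewrite ger0_norm//; have d0 : 0 < 1 - r by rewrite subr_gt0.
have -> : (1 - r ^+ 2) / (1 - r) ^+ 2 = (1 + r) / (1 - r) by field; rewrite gt_eqF.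
by rewrite ler_peMl ?invr_ge0 ?(ltW d0)// lerDl.
Qed.

Variable sigma : {measure set T -> \bar R}.
Variables (phi : C * C -> C) (alpha : C).
Hypothesis a1 : nm alpha = 1.
Hypothesis hC : clark_measure phi alpha sigma.
Local Notation u z := ((1 - nm (phi z) ^+ 2) / nm (alpha - phi z) ^+ 2).

Lemma clark_integral z : nm z.1 < 1 -> nm z.2 < 1 ->
  (\int[sigma]_t (poisson_kernel z t)%:E)%E = (u z)%:E.
Proof. by move=> z1 z2; rewrite -hC//; split; rewrite norm_lt1. Qed.

(** At the origin the Poisson kernel is identically $1$ on the torus. *)
Lemma clark_finite : (sigma setT < +oo)%E.
Proof.
have n0 : nm (0 : C) < 1 by rewrite nm0.
have := @clark_integral (0, 0) n0 n0.
have -> : (\int[sigma]_t (poisson_kernel (0, 0) t)%:E = \int[sigma]_t (cst 1%E t))%E.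
  apply: eq_integral => t _; rewrite poisson_kernelE /poisson1 /cst.
  have [-> ->] : nm ((pt t).1 - 0) = 1 /\ nm ((pt t).2 - 0) = 1.
    by rewrite !subr0; exact: pt_torus.
  by rewrite nm0 expr0n /= subr0 expr1n divr1 mulr1.
by rewrite integral_cst// mul1e => ->; rewrite ltry.
Qed.

(** The Poisson integral of a positive measure is nonnegative, which forces $1-|\phi|^2\ge 0$
    wherever $\phi\ne\alpha$; elsewhere $|\phi|=|\alpha|=1$. *)
Lemma clark_phi_le1 z : nm z.1 < 1 -> nm z.2 < 1 -> nm (phi z) <= 1.
Proof.
move=> z1 z2; have [->|na] := eqVneq (phi z) alpha; first by rewrite a1.
have d0 : 0 < nm (alpha - phi z) ^+ 2 by rewrite exprn_gt0// nm_gt0 subr_eq0 eq_sym.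
have : (0 <= (u z)%:E)%E.
  by rewrite -clark_integral//; apply: integral_ge0 => t _; rewrite lee_fin poisson_ge0.
rewrite lee_fin pmulr_lge0 ?invr_gt0// subr_ge0 => h.
by rewrite -(expr_le1 (n := 2)) ?nm_ge0.
Qed.

(** Where $\phi=\alpha$ the numerator $1-|\phi|^2$ vanishes, so the Poisson integral is $0$; the
    kernel at [z] is bounded below by a positive constant on the torus, so the measure would be
    zero. *)
Lemma clark_phi_neq z : sigma setT != 0%E -> nm z.1 < 1 -> nm z.2 < 1 -> phi z != alpha.
Proof.
move=> s0 z1 z2; apply/eqP => E; have := clark_integral z1 z2.
rewrite E a1 expr1n subrr mul0r => h.
pose c := (1 - nm z.1 ^+ 2) / 4 * ((1 - nm z.2 ^+ 2) / 4).
have aux (x : C) : nm x < 1 -> 0 < (1 - nm x ^+ 2) / 4.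
  by move=> x1; rewrite divr_gt0// subr_gt0 expr_lt1 ?nm_ge0.
have c0 : 0 < c by rewrite mulr_gt0// aux.
have : (\int[sigma]_t (cst c%:E t) <= \int[sigma]_t (poisson_kernel z t)%:E)%E.
  apply: ge0_le_integral => //.
  - by move=> t _; rewrite lee_fin ltW.
  - by apply/measurable_EFinP; exact: measurable_poisson.
  - move=> t _; rewrite lee_fin poisson_kernelE; have [t1 t2] := pt_torus t.
    by apply: ler_pM; rewrite ?poisson1_lower// ltW// aux.
rewrite h integral_cst// => h1; move: s0; apply/negP; rewrite negbK.
rewrite eq_le measure_ge0 andbT leNgt; apply/negP => s0.
by move: h1; apply/negP; rewrite -ltNge mule_gt0.
Qed.

End PoissonIntegrals.

(** * The zero set of the Clark polynomial and the Poisson integral *)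

Section ClarkSupport.
Variable R : realType.
Local Notation C := R[i].
Local Notation T := (borel_torus R).
Variables (m n : nat) (p : {poly {poly C}}) (alpha : C).
Variable sigma : {measure set T -> \bar R}.
Hypothesis hp : rif_denominator m n p.
Hypothesis a1 : nm alpha = 1.
Local Notation phi := (rif m n p).
Local Notation rp := (reflect_poly m n p).
Hypothesis hC : clark_measure phi alpha sigma.
Local Notation u z := ((1 - nm (phi z) ^+ 2) / nm (alpha - phi z) ^+ 2).

Definition clark_poly : {poly {poly C}} := rp - alpha%:P%:P * p.

Lemma eval2_clark_poly z : eval2 clark_poly z = eval2 rp z - alpha * eval2 p z.
Proof. by rewrite /eval2 /clark_poly !(hornerE, hornerM, hornerC). Qed.

(** $|q|^2=|p|^2|\phi-\alpha|^2$ cancels the denominator of the Poisson integral. Where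
    $\phi=\alpha$ both sides are $0$. *)
Lemma clark_poly_defect z : nm z.1 < 1 -> nm z.2 < 1 ->
  nm (eval2 clark_poly z) ^+ 2 * u z = nm (eval2 p z) ^+ 2 - nm (eval2 rp z) ^+ 2.
Proof.
move=> z1 z2; have p0 := rif_den_neq0 hp z1 z2.
have Er : eval2 rp z = phi z * eval2 p z by rewrite /rif divfK.
rewrite eval2_clark_poly; move: Er; move: (phi z) => f ->.
rewrite -mulrBl !nmM (nm_distC alpha).
have [->|ne] := eqVneq f alpha; first by rewrite a1 subrr nm0 !mul0r expr0n/= mul0r mul1r subrr.
have : nm (f - alpha) != 0 by rewrite nm_eq0 subr_eq0.
by move: (nm (f - alpha)) (nm f) (nm (eval2 p z)) => s t v s0; field.
Qed.

Lemma cmeas_eval2 (Q : {poly {poly C}}) : cmeas (fun t : T => eval2 Q (pt t)).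
Proof.
have mp (P : {poly C}) : cmeas (fun t : T => P.[(pt t).2]).
  apply: cmeas_ext (cmeas_sum (index_enum 'I_(size P)) (F := fun i t => P`_i * (pt t).2 ^+ i) _).
    by move=> t; rewrite horner_coef.
  move=> i; apply: cmeasZ; elim: (nat_of_ord i) => [|k IH].
    by apply: (cmeas_ext (u := fun=> 1)) => //; exact: cmeas_cst.
  apply: (cmeas_ext (u := fun t => (pt t).2 * (pt t).2 ^+ k)) => [t|]; first by rewrite exprS.
  by apply: cmeasM => //; exact: cmeas_pt2.
apply: cmeas_ext (cmeas_sum (index_enum 'I_(size Q))
  (F := fun i t => (Q`_i).[(pt t).2] * (pt t).1 ^+ i) _).
  move=> t; rewrite /eval2 (horner_coef Q) horner_sum; apply: eq_bigr => i _.
  by rewrite hornerM -polyC_exp hornerC.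
move=> i; apply: cmeasM => //; elim: (nat_of_ord i) => [|k IH].
  by apply: (cmeas_ext (u := fun=> 1)) => //; exact: cmeas_cst.
apply: (cmeas_ext (u := fun t => (pt t).1 * (pt t).1 ^+ k)) => [t|]; first by rewrite exprS.
by apply: cmeasM => //; exact: cmeas_pt1.
Qed.

(* In each variable the Poisson kernel has grid mean between 1/3 and 3, and
   [P_w(zeta) |zeta - w|^2 = 1 - r^2] absorbs the variation of [Q] between [w] and [zeta]. *)
Lemma poly_le_poisson_sum (Q : {poly {poly C}}) : exists K, 0 <= K /\
  forall r N (z : C) (t : T), N.-primitive_root z -> 0 <= r < 1 -> r ^+ N <= 1 / 2 ->
  nm (eval2 Q (pt t)) ^+ 2 <= K * (1 - r) + \sum_(q : 'I_N * 'I_N)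
    18 / (N * N)%:R * nm (eval2 Q (tor r z q)) ^+ 2 * poisson_kernel (tor r z q) t.
Proof.
have [L [L0 hL]] := eval2_lipschitz Q.
(* The factor $48=4\cdot2\cdot6$ comes from $4L^2(1-r^2)N(S_1+S_2)$ with $1-r^2\le2(1-r)$ and
   $S_1+S_2\le6N$. Dividing by $S_1S_2\ge N^2/9$ brings the $9$, and $18=2\cdot9$ in front of the
   Poisson sum. *)
exists (9 * (48 * L ^+ 2)); split; first by rewrite !mulr_ge0 ?sqr_ge0.
move=> r N z t zP /[dup] r01 /andP[r0 r1] rN.
have [t1 t2] := pt_torus t.
have N0 : 0 < N%:R :> R by rewrite ltr0n (prim_order_gt0 zP).
pose x (i : 'I_N) : C := r%:C%C * z ^+ i.
have x1 i : nm (x i) = r by rewrite nmM (nm_root zP) mulr1 nm_real ger0_norm.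
pose P1 i := poisson1 (x i) (pt t).1; pose P2 i := poisson1 (x i) (pt t).2.
have P10 i : 0 <= P1 i by rewrite poisson1_ge0 ?x1.
have P20 i : 0 <= P2 i by rewrite poisson1_ge0 ?x1.
have hP (e : C) i : nm e = 1 -> nm (e - x i) ^+ 2 * poisson1 (x i) e = 1 - r ^+ 2.
  move=> e1; rewrite /poisson1 x1 mulrC divfK// expf_eq0/= nm_eq0 subr_eq0.
  by apply/eqP => E; move: r1; rewrite -(x1 i) -E e1 ltxx.
have /andP[lo1 hi1] := sum_poisson1 zP t1 r01 rN.
have /andP[lo2 hi2] := sum_poisson1 zP t2 r01 rN.
rewrite -/(P1 _) in lo1 hi1.
pose S1 := \sum_i P1 i; pose S2 := \sum_i P2 i.
have pw i j : nm (eval2 Q (pt t)) ^+ 2 * (P1 i * P2 j) <=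
    2 * (nm (eval2 Q (tor r z (i, j))) ^+ 2 * poisson_kernel (tor r z (i, j)) t) +
    4 * L ^+ 2 * (1 - r ^+ 2) * (P1 i + P2 j).
  rewrite poisson_kernelE -/(x i) -/(x j) -/(P1 i) -/(P2 j).
  have cw : closed_bidisk (tor r z (i, j)) by split; rewrite /= -/(x _) x1 ltW.
  have := hL _ _ (torus_closed (conj t1 t2)) cw.
  rewrite /= -/(x i) -/(x j); set a := nm (_ - x i); set b := nm (_ - x j).
  set Qw := eval2 Q (tor _ _ _); set Qt := eval2 Q (pt t) => hd.
  have ha : a ^+ 2 * P1 i = 1 - r ^+ 2 by exact: hP.
  have hb : b ^+ 2 * P2 j = 1 - r ^+ 2 by exact: hP.
  have h1 : nm Qt ^+ 2 <= 2 * nm Qw ^+ 2 + 4 * L ^+ 2 * (a ^+ 2 + b ^+ 2).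
    have := sqr_nmD (Qt - Qw) Qw; rewrite subrK addrC => h; apply: (le_trans h).
    rewrite lerD2l.
    have h2 : nm (Qt - Qw) ^+ 2 <= (L * (a + b)) ^+ 2.
      by rewrite ler_sqr ?nnegrE ?nm_ge0// mulr_ge0// addr_ge0 ?nm_ge0.
    apply: (@le_trans _ _ (2 * (L * (a + b)) ^+ 2)); first by rewrite ler_pM2l.
    rewrite -subr_ge0.
    have -> : 4 * L ^+ 2 * (a ^+ 2 + b ^+ 2) - 2 * (L * (a + b)) ^+ 2 =
      2 * (L * (a - b)) ^+ 2 by ring.
    by rewrite mulr_ge0 ?sqr_ge0.
  have h3 := ler_wpM2r (mulr_ge0 (P10 i) (P20 j)) h1.
  apply: (le_trans h3); rewrite le_eqVlt; apply/orP; left; apply/eqP.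
  transitivity (2 * (nm Qw ^+ 2 * (P1 i * P2 j)) +
    4 * L ^+ 2 * (a ^+ 2 * P1 i * P2 j + b ^+ 2 * P2 j * P1 i)); first by ring.
  by rewrite ha hb; ring.
have sum1 : \sum_i \sum_j nm (eval2 Q (pt t)) ^+ 2 * (P1 i * P2 j) =
    nm (eval2 Q (pt t)) ^+ 2 * (S1 * S2).
  by rewrite big_distrlr /= mulr_sumr; apply: eq_bigr => i _; rewrite mulr_sumr.
have sum2 : \sum_(i < N) \sum_(j < N) (P1 i + P2 j) = N%:R * (S1 + S2).
  under eq_bigr do rewrite big_split /= sumr_const card_ord.
  rewrite big_split /= sumr_const card_ord mulrDr; congr (_ + _).
    by rewrite sumrMnl -[LHS]mulr_natl.
  by rewrite -[LHS]mulr_natl.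
pose A := \sum_(q : 'I_N * 'I_N) nm (eval2 Q (tor r z q)) ^+ 2 * poisson_kernel (tor r z q) t.
have main : nm (eval2 Q (pt t)) ^+ 2 * (S1 * S2) <=
    2 * A + 4 * L ^+ 2 * (1 - r ^+ 2) * (N%:R * (S1 + S2)).
  rewrite -sum1 -sum2 /A -(pair_big xpredT xpredT (fun i j =>
    nm (eval2 Q (tor r z (i, j))) ^+ 2 * poisson_kernel (tor r z (i, j)) t)) /=.
  rewrite !mulr_sumr -big_split /=; apply: ler_sum => i _.
  by rewrite !mulr_sumr -big_split /=; apply: ler_sum => j _.
have -> : \sum_(q : 'I_N * 'I_N) 18 / (N * N)%:R * nm (eval2 Q (tor r z q)) ^+ 2 *
    poisson_kernel (tor r z q) t = 18 / (N * N)%:R * A.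
  by rewrite mulr_sumr; apply: eq_bigr => q _; rewrite [RHS]mulrA.
rewrite natrM.
have B0 : 0 <= nm (eval2 Q (pt t)) ^+ 2 by exact: sqr_ge0.
have SS : N%:R / 3 * (N%:R / 3) <= S1 * S2 by apply: ler_pM => //; rewrite divr_ge0// ltW.
have SD : S1 + S2 <= 6 * N%:R by move: hi1 hi2; rewrite -/S1 -/S2; lra.
have sd0 : 0 <= S1 + S2 by rewrite addr_ge0// sumr_ge0.
have rr : 1 - r ^+ 2 <= 2 * (1 - r) by nra.
have rr0 : 0 <= 1 - r ^+ 2 by nra.
move: B0 main SS SD sd0 N0; move: (nm (eval2 Q (pt t)) ^+ 2) A (S1 * S2) (S1 + S2) (N%:R : R) => B A' SP SD' M.
move=> B0 main SS SD SD0 M0.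
have L20 : 0 <= L ^+ 2 := sqr_ge0 L.
have e1 : B * (M / 3 * (M / 3)) <= B * SP by rewrite ler_wpM2l.
have e2 : 4 * L ^+ 2 * (1 - r ^+ 2) * (M * SD') <= 4 * L ^+ 2 * (2 * (1 - r)) * (M * (6 * M)).
  apply: ler_pM; rewrite ?mulr_ge0// ?ler_wpM2l ?mulr_ge0// ?(ltW M0)//.
have e3 : B * (M / 3 * (M / 3)) <= 2 * A' + 48 * L ^+ 2 * (1 - r) * (M * M).
  apply: (le_trans e1); apply: (le_trans main); rewrite lerD2l; apply: (le_trans e2).
  by rewrite le_eqVlt; apply/orP; left; apply/eqP; ring.
have M9 : 0 <= 9 / (M * M) by rewrite divr_ge0// mulr_ge0// ltW.
have := ler_wpM2r M9 e3.
have -> : B * (M / 3 * (M / 3)) * (9 / (M * M)) = B by field; rewrite gt_eqF.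
move=> h; apply: (le_trans h); rewrite le_eqVlt; apply/orP; left; apply/eqP.
by field; rewrite gt_eqF.
Qed.
End ClarkSupport.

Section ClarkNullSets.
Variable R : realType.
Local Notation C := R[i].
Local Notation T := (borel_torus R).
Variables (m n : nat) (p : {poly {poly C}}) (alpha : C).
Variable sigma : {measure set T -> \bar R}.
Hypothesis hp : rif_denominator m n p.
Hypothesis a1 : nm alpha = 1.
Local Notation phi := (rif m n p).
Local Notation rp := (reflect_poly m n p).
Hypothesis hC : clark_measure phi alpha sigma.
Local Notation u z := ((1 - nm (phi z) ^+ 2) / nm (alpha - phi z) ^+ 2).
Local Notation q := (clark_poly m n p alpha).

(** Integrating [poly_le_poisson_sum] turns each Poisson kernel into the value of the Poisson
    integral at a grid point, and there $|q|^2$ times that value is $|p|^2-|\tilde p|^2=O(1-r)$. So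
    the energy of [q] is $O(1-r)$ for every $r<1$. *)
Lemma clark_poly_ae0 : {ae sigma, forall t, eval2 q (pt t) = 0}.
Proof.
have sfin := clark_finite hC.
pose s := fine (sigma setT).
have sE : sigma setT = s%:E by rewrite fineK// ge0_fin_numE.
have [K1 [K10 hK1]] := poly_le_poisson_sum q.
have [K2 [K20 hK2]] := rif_defect hp.
pose e := energy sigma (fun t => eval2 q (pt t)).
have main (r : R) : 0 <= r < 1 -> (e <= ((K1 * s + 18 * K2) * (1 - r))%:E)%E.
  move=> /[dup] r01 /andP[r0 r1].
  have half0 : 0 < 1 / 2 :> R by rewrite divr_gt0.
  have [N0 hN] := expr_small r01 half0.
  pose N := N0.+1; have rN : r ^+ N <= 1 / 2 by exact: hN.
  have [z zP] := prim_root_exists R (ltn0Sn N0).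
  pose c (k : 'I_N * 'I_N) := 18 / (N * N)%:R * nm (eval2 q (tor r z k)) ^+ 2.
  have c0 k : 0 <= c k by rewrite mulr_ge0 ?sqr_ge0// divr_ge0.
  have wt k : in_torus (z ^+ (k : 'I_N * 'I_N).1, z ^+ k.2) by split; rewrite /= (nm_root zP).
  have [w1 w2] : (forall k : 'I_N * 'I_N, nm (tor r z k).1 < 1) /\
      (forall k : 'I_N * 'I_N, nm (tor r z k).2 < 1).
    by split=> k; have [e1 e2] := nm_dilate r0 (wt k); rewrite ?[nm _]e1 ?[nm _]e2.
  have cu k : c k * u (tor r z k) <= 18 / (N * N)%:R * (K2 * (1 - r)).
    rewrite /c -[leLHS]mulrA (clark_poly_defect hp a1)//.
    have r01' : 0 <= r <= 1 by rewrite r0 (ltW r1).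
    have k18 : 0 <= 18 / (N * N)%:R :> R by rewrite divr_ge0.
    exact: ler_wpM2l k18 _ _ (hK2 r _ r01' (wt k)).
  have mP k : measurable_fun setT (fun t : T => (poisson_kernel (tor r z k) t)%:E).
    by apply/measurable_EFinP; exact: measurable_poisson.
  have mcP k : measurable_fun setT (fun t : T => (c k)%:E * (poisson_kernel (tor r z k) t)%:E)%E.
    by apply/measurable_EFinP; apply: measurable_funM => //; exact: measurable_poisson.
  have cP0 k t : (0 <= (c k)%:E * (poisson_kernel (tor r z k) t)%:E)%E.
    by rewrite mule_ge0 ?lee_fin// poisson_ge0.
  have d0 : 0 <= K1 * (1 - r) by rewrite mulr_ge0// subr_ge0 ltW.
  apply: (@le_trans _ _ (\int[sigma]_t ((K1 * (1 - r))%:E +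
      \sum_k (c k)%:E * (poisson_kernel (tor r z k) t)%:E)))%E.
    apply: ge0_le_integral => //.
    - by move=> t _; rewrite lee_fin sqr_ge0.
    - by apply: measurable_energy; exact: cmeas_eval2.
    - by apply: emeasurable_funD => //; exact: emeasurable_sum.
    - by move=> t _; rewrite sumEFin -EFinD lee_fin; exact: hK1.
  rewrite ge0_integralD//; last 2 first.
  - by move=> t _; apply: sume_ge0.
  - exact: emeasurable_sum.
  rewrite integral_cst// sE ge0_integral_sum//.
  have E k : (\int[sigma]_t ((c k)%:E * (poisson_kernel (tor r z k) t)%:E))%E =
      (c k * u (tor r z k))%:E.
    rewrite ge0_integralZl_EFin//; last by move=> t _; rewrite lee_fin poisson_ge0.
    by rewrite (clark_integral hC).
  rewrite (eq_bigr _ (fun k _ => E k)) sumEFin -EFinM -EFinD lee_fin mulrDl.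
  rewrite mulrAC lerD2l; apply: (le_trans (ler_sum _ (fun k _ => cu k))).
  rewrite sumr_const card_prod card_ord -[leLHS]mulr_natr.
  have NN : (N * N)%:R != 0 :> R by rewrite pnatr_eq0.
  move: ((N * N)%:R) NN => A NN.
  by rewrite le_eqVlt; apply/orP; left; apply/eqP; field.
have e0 : (0 <= e)%E by exact: energy_ge0.
have fe : e \is a fin_num.
  rewrite ge0_fin_numE//; have := main 0; rewrite lexx ltr01 => /(_ isT) h.
  exact: le_lt_trans h (ltry _).
apply: (energy_eq0 (cmeas_eval2 q)); rewrite -/e; apply/eqP; rewrite eq_le e0 andbT.
rewrite -(fineK fe) lee_fin; apply: (@le0_linear _ _ (K1 * s + 18 * K2)) => r r01.
by rewrite -lee_fin fineK// main.
Qed.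

Lemma clark_null (E : set T) z0 (zr : R -> C * C) (c : R) : measurable E ->
  closed_bidisk z0 -> eval2 q z0 != 0 -> 0 < c ->
  (forall r, 0 <= r < 1 -> [/\ nm (zr r).1 < 1, nm (zr r).2 < 1,
    nm (z0.1 - (zr r).1) + nm (z0.2 - (zr r).2) <= 1 - r &
    forall t, E t -> c * (1 - r)^-1 <= poisson_kernel (zr r) t]) ->
  sigma E = 0%E.
Proof.
move=> mE cz0 qz0 c0 hzr.
have Efin : sigma E \is a fin_num.
  by rewrite ge0_fin_numE// (le_lt_trans _ (clark_finite hC))// le_measure ?inE.
pose e := fine (sigma E); have eE : sigma E = e%:E by rewrite fineK.
have e0 : 0 <= e by rewrite -lee_fin -eE.
have [L [L0 hL]] := eval2_lipschitz q.
have [M [M0 hM]] := eval2_bounded p.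
have d0 : 0 < nm (eval2 q z0) ^+ 2 by rewrite exprn_gt0// nm_gt0.
suff : e * c * nm (eval2 q z0) ^+ 2 <= 0.
  by rewrite !pmulr_lle0// => h; rewrite eE; congr EFin; apply/eqP; rewrite eq_le h.
apply: (@le0_linear _ _ (2 * M ^+ 2 + 2 * (e * c * L ^+ 2))) => r /[dup] r01 /andP[r0 r1].
have [z1 z2 zd hE] := hzr r r01; set z := zr r in z1 z2 zd hE.
have r10 : 0 < 1 - r by rewrite subr_gt0.
have h1 : e * (c * (1 - r)^-1) <= u z.
  rewrite -lee_fin -(clark_integral hC)// mulrC EFinM -eE -integral_cst//.
  have k0 : 0 <= c * (1 - r)^-1 by rewrite mulr_ge0 ?invr_ge0 ?(ltW c0) ?(ltW r10).
  apply: (@le_trans _ _ (\int[sigma]_(t in E) (poisson_kernel z t)%:E)%E).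
    apply: ge0_le_integral => //.
    by apply/measurable_EFinP; apply: measurable_funTS; exact: measurable_poisson.
  apply: ge0_subset_integral => //.
  - by apply/measurable_EFinP; exact: measurable_poisson.
  - by move=> t _; rewrite lee_fin poisson_ge0.
have cz : closed_bidisk z by split; exact: ltW.
have h2 : nm (eval2 q z) ^+ 2 * u z <= M ^+ 2.
  rewrite (clark_poly_defect hp a1)// (le_trans (_ : _ <= nm (eval2 p z) ^+ 2))//.
    by rewrite gerBl sqr_ge0.
  by rewrite ler_sqr ?nnegrE ?nm_ge0// hM.
have h3 : nm (eval2 q z0) ^+ 2 <= 2 * nm (eval2 q z) ^+ 2 + 2 * (L ^+ 2 * (1 - r)).
  have := sqr_nmD (eval2 q z0 - eval2 q z) (eval2 q z); rewrite subrK addrC => h.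
  apply: (le_trans h); rewrite lerD2l ler_wpM2l//.
  apply: (@le_trans _ _ ((L * (1 - r)) ^+ 2)).
    rewrite ler_sqr ?nnegrE ?nm_ge0 ?mulr_ge0 ?(ltW r10)//.
    by rewrite (le_trans (hL _ _ cz0 cz))// ler_wpM2l.
  rewrite exprMn ler_wpM2l ?sqr_ge0// expr2 ler_piMl ?(ltW r10)//.
  by rewrite gerBl.
move: h1 h2 h3 d0; move: (u z) (nm (eval2 q z) ^+ 2) (sqr_ge0 (nm (eval2 q z))).
move: (nm (eval2 q z0) ^+ 2) => D U Q2 Q20 h1 h2 h3 D0.
have ec0 : 0 <= e * c by rewrite mulr_ge0// ltW.
have h4 : e * c * Q2 <= M ^+ 2 * (1 - r).
  have h5 : e * c <= U * (1 - r).
    by rewrite -ler_pdivrMr// -mulrA.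
  apply: (le_trans (ler_wpM2r Q20 h5)); rewrite mulrC mulrA.
  by rewrite ler_wpM2r ?(ltW r10).
apply: (le_trans (ler_wpM2l ec0 h3)).
have -> : e * c * (2 * Q2 + 2 * (L ^+ 2 * (1 - r))) =
  2 * (e * c * Q2) + 2 * (e * c * L ^+ 2) * (1 - r) by ring.
by rewrite [leRHS]mulrDl lerD2r -[leRHS]mulrA ler_wpM2l.
Qed.

Lemma measurable_fiber (f : T -> C) (tau : C) : cmeas f -> measurable [set t | f t = tau].
Proof.
move=> mf; have mg : measurable_fun setT (fun t => nm (f t - tau) ^+ 2).
  by apply: measurable_sqr_nm; apply: cmeasB => //; exact: cmeas_cst.
have -> : [set t | f t = tau] = setT `&` (fun t => nm (f t - tau) ^+ 2) @^-1` [set 0].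
  apply/seteqP; split=> t /=; first by move=> ->; rewrite subrr nm0 expr0n.
  by move=> [_ /eqP]; rewrite expf_eq0 /= nm_eq0 subr_eq0 => /eqP.
exact: mg.
Qed.

Lemma ae_neq (f : T -> C) (tau : C) : cmeas f ->
  sigma [set t | f t = tau] = 0%E -> {ae sigma, forall t, f t <> tau}.
Proof.
move=> mf h; exists [set t | f t = tau]; split => //.
- exact: measurable_fiber.
- by move=> t /contrapT.
Qed.

End ClarkNullSets.

Section ClarkDensity.
Variable R : realType.
Local Notation C := R[i].
Local Notation T := (borel_torus R).
Variables (m n : nat) (p : {poly {poly C}}) (alpha : C).
Variable sigma : {measure set T -> \bar R}.
Hypothesis hp : rif_denominator m n p.
Hypothesis a1 : nm alpha = 1.
Local Notation phi := (rif m n p).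
Local Notation rp := (reflect_poly m n p).
Hypothesis hC : clark_measure phi alpha sigma.
Local Notation q := (clark_poly m n p alpha).

(** A non-exceptional slice contains a point $(x,\tau)$ with $|x|<1$ and $q\ne0$. Along $(x,r\tau)$
    the Poisson kernel is at least $\frac{1-|x|^2}{4}(1-r)^{-1}$ on the whole slice. *)
Lemma clark_slice2 (tau : C) : nm tau = 1 ->
  ~ (forall x, nm x < 1 -> phi (x, tau) = alpha) -> {ae sigma, forall t : T, (pt t).2 <> tau}.
Proof.
move=> tau1 ngen.
have [x x1 qx] : exists2 x, nm x < 1 & eval2 q (x, tau) != 0.
  apply: contrapT => h; apply: ngen; apply: (slice_exceptional hp tau1) => x x1.
  apply/eqP; rewrite -subr_eq0 -eval2_clark_poly; apply/negPn/negP => qx.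
  by apply: h; exists x.
apply: ae_neq; first exact: cmeas_pt2.
have c0 : 0 < (1 - nm x ^+ 2) / 4 by rewrite divr_gt0// subr_gt0 expr_lt1 ?nm_ge0.
apply: (clark_null hp a1 hC (zr := fun r => (x, r%:C%C * tau)) _ _ qx c0).
- by apply: measurable_fiber; exact: cmeas_pt2.
- by split; rewrite /= ?tau1// ltW.
move=> r /[dup] r01 /andP[r0 r1]; split => //=.
- by rewrite nmM nm_real tau1 mulr1 ger0_norm.
- by rewrite subrr nm0 add0r nm_sub_dilate// ltW.
move=> t Et; have [t1 _] := pt_torus t.
rewrite poisson_kernelE /= Et; apply: ler_pM; [exact: ltW| |exact: poisson1_lower|].
  by rewrite invr_ge0 subr_ge0 ltW.
exact: poisson1_radial.
Qed.

Lemma clark_slice1 (tau : C) : nm tau = 1 ->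
  ~ (forall x, nm x < 1 -> phi (tau, x) = alpha) -> {ae sigma, forall t : T, (pt t).1 <> tau}.
Proof.
move=> tau1 ngen.
have [x x1 qx] : exists2 x, nm x < 1 & eval2 q (tau, x) != 0.
  apply: contrapT => h; apply: ngen => x x1.
  (* The divisibility argument concerns the second variable and is transported here by exchanging
     the variables. *)
  have := slice_exceptional (rif_denominator_swap hp) tau1 (alpha := alpha) _ x1.
  rewrite /rif reflect_swap !eval2_swap; apply => y y1.
  rewrite !eval2_swap; apply/eqP.
  rewrite -subr_eq0 -eval2_clark_poly; apply/negPn/negP => qx.
  by apply: h; exists y.
apply: ae_neq; first exact: cmeas_pt1.
have c0 : 0 < (1 - nm x ^+ 2) / 4 by rewrite divr_gt0// subr_gt0 expr_lt1 ?nm_ge0.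
apply: (clark_null hp a1 hC (zr := fun r => (r%:C%C * tau, x)) _ _ qx c0).
- by apply: measurable_fiber; exact: cmeas_pt1.
- by split; rewrite /= ?tau1// ltW.
move=> r /[dup] r01 /andP[r0 r1]; split => //=.
- by rewrite nmM nm_real tau1 mulr1 ger0_norm.
- by rewrite subrr nm0 addr0 nm_sub_dilate// ltW.
move=> t Et; have [_ t1] := pt_torus t.
rewrite poisson_kernelE /= Et mulrC; apply: ler_pM; [|exact: ltW| |exact: poisson1_lower].
  by rewrite invr_ge0 subr_ge0 ltW.
exact: poisson1_radial.
Qed.

(** For a nonzero measure $\phi$ omits $\alpha$, so $q$ has no zero in the open bidisk; setting
    either variable to $0$ yields the two zero-free constant coefficients required. *)
Lemma clark_kernel_dense : generic phi alpha -> sigma setT != 0%E ->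
  forall v, L2fun sigma v -> clspan sigma (@kernel_set R) v.
Proof.
move=> gen s0.
have n0 : nm (0 : C) < 1 by rewrite nm0.
have qnz z : nm z.1 < 1 -> nm z.2 < 1 -> eval2 q z != 0.
  move=> z1 z2; have p0 := rif_den_neq0 hp z1 z2.
  have := clark_phi_neq a1 hC s0 z1 z2; apply: contra_neq => E.
  move/eqP: E; rewrite eval2_clark_poly subr_eq0 => /eqP E.
  by rewrite /rif E mulfK.
have E0 (Q : {poly {poly C}}) z : (Q`_0).[z] = eval2 Q (0, z) by rewrite /eval2 /= horner_coef0.
apply: (kernel_span_dense (clark_finite hC) (q := q)).
- exact: (clark_poly_ae0 hp a1 hC).
- by move=> z z1; rewrite E0 qnz.
- by move=> z z1; rewrite E0 eval2_swap qnz.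
- move=> tau tau1; apply: clark_slice1 => // h; apply: gen.
  by exists tau; [apply/norm_eq1|left => x; rewrite norm_lt1 => /h].
- move=> tau tau1; apply: clark_slice2 => // h; apply: gen.
  by exists tau; [apply/norm_eq1|right => x; rewrite norm_lt1 => /h].
Qed.

End ClarkDensity.

(** * The range of the embedding *)

Lemma quarter_sum_le (R : realType) (a b : \bar R) (e : R) :
  (a <= (e / 4)%:E -> b <= (e / 4)%:E -> 2%:E * a + 2%:E * b <= e%:E)%E.
Proof.
move=> ha hb; have E : e%:E = (2%:E * (e / 4)%:E + 2%:E * (e / 4)%:E)%E.
  by rewrite -!EFinM -EFinD; congr EFin; field.
by rewrite E; apply: leeD; rewrite lee_pmul2l ?lte_fin.
Qed.

Section ClarkRange.
Variable R : realType.
Local Notation C := R[i].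
Local Notation T := (borel_torus R).
Variables (m n : nat) (p : {poly {poly C}}) (alpha : C).
Variable sigma : {measure set T -> \bar R}.
Variable J : (C * C -> C) -> T -> C.
Hypothesis hp : rif_denominator m n p.
Hypothesis a1 : nm alpha = 1.
Local Notation phi := (rif m n p).
Local Notation K := (model_space phi).
Hypothesis hC : clark_measure phi alpha sigma.
Hypothesis hJ : clark_embedding sigma phi alpha J.
Local Notation energy := (energy sigma).

Lemma energy_L2_norm (v : T -> C) : energy v = (L2_norm sigma v `^ 2)%E.
Proof.
rewrite /L2_norm poweR_Lnorm//; apply: eq_integral => t _.
by rewrite /= ger0_norm ?nm_ge0// powR_mulrn ?nm_ge0.
Qed.

Lemma L2P (v : T -> C) : L2 sigma v <-> L2fun sigma v.
Proof.
split=> [[v1 v2 h]|[[v1 v2] h]]; split => //.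
  by rewrite energy_L2_norm poweR_lty.
have -> : L2_norm sigma v = (energy v `^ 2^-1)%E.
  by rewrite energy_L2_norm -poweRrM mulfV// poweRe1// Lnorm_ge0.
exact: poweR_lty.
Qed.

Lemma energy_isometry f : K f -> energy (J f) = (hardy_norm f ^+ 2)%:E.
Proof.
move=> Kf; have [[_ _ /(_ _ Kf) E] _] := hJ.
by rewrite energy_L2_norm E /= powR_mulrn// sqrtr_ge0.
Qed.

Lemma embedding_cmeas f : K f -> cmeas (J f).
Proof. by move=> Kf; have [[/(_ _ Kf)/L2P[]]] := hJ. Qed.

(** Differences have the shape [-1 * f + g] so that the linearity clause of the embedding applies to
    them directly. *)
Lemma energy_embeddingB f g : K f -> K g ->
  energy (fun t => -1 * J f t + J g t) = (hardy_norm (fun z => (-1) * f z + g z) ^+ 2)%:E.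
Proof.
move=> Kf Kg; have phi_le1 := clark_phi_le1 a1 hC.
have Kfg := model_space_lin hp phi_le1 (-1) Kf Kg.
rewrite -(energy_isometry Kfg); apply: energy_ae.
- by apply: cmeasD; [apply: cmeasZ|]; exact: embedding_cmeas.
- exact: embedding_cmeas.
have [[_ lin _] _] := hJ.
by apply: filterS (lin (-1) f g Kf Kg) => t ->.
Qed.

Definition in_range (v : T -> C) : Prop := exists2 f, K f & ae_equal sigma (J f) v.

Lemma range_base v : sigma setT != 0%E -> kernel_set v -> in_range v.
Proof.
move=> s0 [w [w1 w2 ->]]; have phi_le1 := clark_phi_le1 a1 hC.
have Kw := model_kernel_in hp phi_le1 w1 w2.
have nz : 1 - alpha * (phi w)^* != 0.
  rewrite subr_eq0; apply: contra_neq (clark_phi_neq a1 hC s0 w1 w2) => E.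
  have a0 : alpha != 0 by rewrite -nm_gt0 a1.
  apply: (can_inj (@conjCK _)); apply: (mulfI a0).
  by rewrite -E conj_unit// mulfV.
pose c := (1 - alpha * (phi w)^*)^-1.
(* The multiple $cK_w$ written in the form [c * f + g] of the linearity clause. *)
exists (fun z => (c - 1) * model_kernel phi w z + model_kernel phi w z).
  exact: model_space_lin.
have [[_ lin _] Jw] := hJ.
have bw : bidisk w by split; rewrite norm_lt1.
apply: filterS2 (lin (c - 1) _ _ Kw Kw) (Jw w bw) => t -> ->.
by rewrite mulrBl mul1r subrK mulrA mulVf// mul1r.
Qed.

Lemma range_lin c u v : in_range u -> in_range v -> in_range (fun t => c * u t + v t).
Proof.
move=> [f Kf fu] [g Kg gv]; exists (fun z => c * f z + g z).
  exact: (model_space_lin hp (clark_phi_le1 a1 hC)).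
have [[_ lin _] _] := hJ.
have h := lin c _ _ Kf Kg.
by apply: filterS3 h fu gv => t -> -> ->.
Qed.

(** Preimages of an energy-convergent sequence are Cauchy by isometry, so they converge in the
    complete model space, and the image of their limit is at zero energy distance from [v]. *)
Lemma range_lim (u : nat -> T -> C) v : (forall k, in_range (u k)) -> (forall k, cmeas (u k)) ->
  cmeas v ->
  (forall e : R, 0 < e -> exists k, (energy (fun t => v t - u k t)%R <= e%:E)%E) ->
  in_range v.
Proof.
move=> hu mu' mv hv; have phi_le1 := clark_phi_le1 a1 hC.
(* The hypothesis only gives one good index per tolerance; a sequence with explicit rate $1/(k+1)$
   is extracted to obtain genuine convergence. *)
have [s hs] : {s : nat -> nat & forall k, (energy (fun t => v t - u (s k) t)%R <= (k.+1%:R^-1)%:E)%E}.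
  apply: (@choice _ _ (fun k l => (energy (fun t => v t - u l t)%R <= (k.+1%:R^-1)%:E)%E)) => k.
  by apply: hv; rewrite invr_gt0.
have [F hF] : {F : nat -> C * C -> C & forall k, K (F k) /\ ae_equal sigma (J (F k)) (u (s k))}.
  apply: (@choice _ _ (fun k f => K f /\ ae_equal sigma (J f) (u (s k)))) => k.
  by have [f Kf fu] := hu (s k); exists f.
have vF k : (energy (fun t => v t - J (F k) t)%R <= (k.+1%:R^-1)%:E)%E.
  have [KF Fu] := hF k; apply: le_trans (hs k); rewrite le_eqVlt; apply/orP; left; apply/eqP.
  apply: energy_ae; do ?[apply: cmeasB => //; exact: embedding_cmeas].
  by apply: filterS Fu => t ->.
have small (e : R) : 0 < e -> exists k0, forall k, (k0 <= k)%N ->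
    (energy (fun t => v t - J (F k) t)%R <= e%:E)%E.
  move=> e0; have [k0 hk] := @inv_expn_cvg R 1 e e0; exists k0 => k /hk.
  by rewrite div1r => h; apply: (le_trans (vF k)); rewrite lee_fin.
have mF k : cmeas (fun t => v t - J (F k) t).
  by apply: cmeasB => //; apply: embedding_cmeas; have [] := hF k.
have [f Kf hf] : exists2 f, K f & forall e, 0 < e -> exists n0, forall k, (n0 <= k)%N ->
    hardy_norm (fun z => -1 * F k z + f z) ^+ 2 <= e.
  apply: (model_space_complete hp phi_le1) => [k|e e0]; first by have [] := hF k.
  have e4 : 0 < e / 4 by rewrite divr_gt0.
  have [k0 hk0] := small _ e4; exists k0 => k l kk kl.
  have [KFk _] := hF k; have [KFl _] := hF l.
  rewrite -lee_fin -(energy_embeddingB KFl KFk).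
  have -> : (fun t => -1 * J (F l) t + J (F k) t) =
      (fun t => (v t - J (F l) t) + (-1) * (v t - J (F k) t)).
    by apply/funext => t; ring.
  apply: (le_trans (energyD _ (mF l) (cmeasZ (-1) (mF k)))).
  rewrite energyZ// nmN nm1 expr1n mul1e.
  by apply: quarter_sum_le; exact: hk0.
exists f => //.
have mfv : cmeas (fun t => v t - J f t) by apply: cmeasB => //; exact: embedding_cmeas.
suff h : {ae sigma, forall t, v t - J f t = 0}.
  by apply: filterS h => t /eqP; rewrite subr_eq0 => /eqP.
apply: (energy_eq0_le mfv) => e e0.
have e4 : 0 < e / 4 by rewrite divr_gt0.
have [k0 hk0] := small _ e4; have [k1 hk1] := hf _ e4.
pose k := maxn k0 k1; have [KF _] := hF k.
have -> : (fun t => v t - J f t) = (fun t => (v t - J (F k) t) + (-1) * (-1 * J (F k) t + J f t)).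
  by apply/funext => t; ring.
have mg : cmeas (fun t => -1 * J (F k) t + J f t).
  by apply: cmeasD; [apply: cmeasZ|]; exact: embedding_cmeas.
apply: (le_trans (energyD _ (mF k) (cmeasZ (-1) mg))).
rewrite energyZ// nmN nm1 expr1n mul1e energy_embeddingB//.
apply: quarter_sum_le.
  by apply: hk0; rewrite leq_maxl.
by rewrite lee_fin; apply: hk1; rewrite leq_maxr.
Qed.

Lemma range_clspan v : sigma setT != 0%E -> clspan sigma (@kernel_set R) v -> in_range v.
Proof.
move=> s0; elim=> [{}v|c u {}v _ hu _ hv|u {}v Mu hu mv h].
- exact: range_base.
- exact: range_lin.
- apply: (range_lim hu) => // k.
  by have [] := clspan_L2 (kernel_set_L2 (clark_finite hC)) (Mu k).
Qed.

End ClarkRange.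

Theorem theorem4p2 (R : realType) (m n : nat) (p : {poly {poly R[i]}})
    (alpha : R[i]) (sigma : {measure set (borel_torus R) -> \bar R})
    (J : (R[i] * R[i] -> R[i]) -> borel_torus R -> R[i]) :
  (0 < m)%N -> (0 < n)%N ->
  rif_denominator m n p ->
  `|alpha| = 1 ->
  generic (rif m n p) alpha ->
  clark_measure (rif m n p) alpha sigma ->
  clark_embedding sigma (rif m n p) alpha J ->
  unitary sigma (model_space (rif m n p)) J.
Proof.
move=> _ _ hp /norm_eq1 a1 gen hC hJ; split; first by case: hJ.
move=> v /L2P Lv; have [s0|s0] := eqVneq (sigma setT) 0%E; last first.
  exact: (range_clspan hp a1 hC hJ s0 (clark_kernel_dense hp a1 hC gen s0 Lv)).
have n0 : nm (0 : R[i]) < 1 by rewrite nm0.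
(* When $\sigma=0$ any two functions agree almost everywhere, so any element of the model space is a
   preimage. *)
exists (model_kernel (rif m n p) (0, 0)).
  exact: (model_kernel_in hp (clark_phi_le1 a1 hC)).
by exists setT; split.
Qed.
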